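(* Let $\frac23<\alpha<1$, $\lambda\in(0,1]$ and $I\in\mathbb{N}$. Let $b$ be an $\alpha$-Hölder function, let $\{v_1(\cdot,a_0),\dots,v_I(\cdot,a_0)\}_{a_0\in[\lambda,1/\lambda]}$ be $I$ families of functions and $\{b\diamond\partial_1^2v_1(\cdot,a_0),\dots,b\diamond\partial_1^2v_I(\cdot,a_0)\}_{a_0}$ be $I$ families of distributions with $$[v_i]_{\alpha,1}\le N_i,\qquad\|[b,(\cdot)]\diamond\partial_1^2v_i\|_{2\alpha-2,1}\le N_0N_i,\qquad i=1,\dots,I,$$ for some constants $N_0,\dots,N_I$. Let the function $u$ be modelled after $(v_1,\dots,v_I)$ according to the $\alpha$-Hölder functions $a$ (with values in $[\lambda,\frac1\lambda]$) and $(\sigma_1,\dots,\sigma_I)$ with constant $M$. Then there exists a unique distribution $b\diamond\partial_1^2u$ such that $$\lim_{T\downarrow0}\Big\|[b,(\cdot)_T]\diamond\partial_1^2u-\sum_i\sigma_iE[b,(\cdot)_T]\diamond\partial_1^2v_i\Big\|=0,$$ where $E$ evaluates a function of $(x,a_0)$ at $(x,a(x))$. Moreover, provided $[a]_\alpha\le1$, $$\|[b,(\cdot)]\diamond\partial_1^2u\|_{2\alpha-2}\le C\Big([b]_\alpha M+N_0\sum_iN_i\big([\sigma_i]_\alpha+\|\sigma_i\|\big)\Big),$$ with $C$ depending only on $\lambda$ and $\alpha$.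
   Context: Points are $x=(x_1,x_2)\in\mathbb{R}^2$; $d(x,y):=|x_1-y_1|+\sqrt{|x_2-y_2|}$; $[u]_\alpha:=\sup_{x\neq y}|u(x)-u(y)|/d^\alpha(x,y)$; $\|\cdot\|$ is the supremum norm; an $\alpha$-Hölder function is a bounded function with $[\cdot]_\alpha<\infty$. For $T>0$, $\psi_T$ is the Schwartz function with Fourier transform $\exp(-T(k_1^4+k_2^2))$ and $f_T=(f)_T:=f*\psi_T$. For a function $h$ and distribution $g$, $h\diamond g$ denotes a given (or constructed) distribution playing the role of the product, not determined by $h$ and $g$; $[h,(\cdot)_T]\diamond g:=h\,g_T-(h\diamond g)_T$; $\|[h,(\cdot)]\diamond g\|_{2\alpha-2}:=\sup_{0<T\le1}(T^{1/4})^{2-2\alpha}\|[h,(\cdot)_T]\diamond g\|$. An additional subscript $1$ on a semi-norm $|\cdot|$ means $|u|_1:=\sup_{a_0\in[\lambda,1/\lambda]}\max_{i=0,1}|(\partial/\partial a_0)^iu(a_0)|$. Modelledness: $u$ is modelled after $(v_1,\dots,v_I)$ according to $a$ and $(\sigma_1,\dots,\sigma_I)$ with constant $M$ if there is a (then unique) function $\nu$ such that $$M:=\sup_{x\ne y}\frac{1}{d^{2\alpha}(y,x)}\Big|u(y)-u(x)-\sum_i\sigma_i(x)\big(v_i(y,a(x))-v_i(x,a(x))\big)-\nu(x)(y-x)_1\Big|<\infty .$$ *)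

(* Defs.v *)
From HB Require Import structures.
From mathcomp Require Import all_boot all_order all_algebra.
From mathcomp Require Import all_classical all_reals all_analysis.

Set Implicit Arguments.
Unset Strict Implicit.
Unset Printing Implicit Defensive.

Import Order.TTheory GRing.Theory Num.Theory.
Import numFieldNormedType.Exports.

Local Open Scope classical_set_scope.
Local Open Scope ring_scope.

Notation plane R := (R * R)%type.

Section Planar.
Context {R : realType}.
Implicit Types (x y : plane R) (f u phi : plane R -> R) (alpha lam T : R).

Definition pdist x y : R := `|x.1 - y.1| + Num.sqrt `|x.2 - y.2|.

Definition supnorm f : \bar R := ereal_sup [set `|f x|%:E | x in setT].

Definition holder alpha u : \bar R :=
  ereal_sup [set (`|u z.1 - u z.2| / pdist z.1 z.2 `^ alpha)%:E
            | z in [set z : plane R * plane R | z.1 != z.2]].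

Definition holder_function alpha u : Prop :=
  (supnorm u < +oo)%E /\ (holder alpha u < +oo)%E.

Definition prange lam : set R := [set a0 | lam <= a0 <= lam^-1].

(* The derivative is taken relative to [A], so that it is one-sided at the
   end points of an interval; at an isolated point of [A] it is
   unconstrained. *)
Definition derivative_within (A : set R) (f f' : R -> R) : Prop :=
  forall a0, A a0 ->
    (f a - f a0) / (a - a0) @[a --> within A a0^'] --> f' a0.

(* [norm1 lam D N F] is |F|_1 for a semi-norm [N] on functions of p that only
   depends on their values on [D]; the parameter a0 is the first argument of
   [F] and the derivative in a0 is taken for each fixed p in [D].
   When lam < 1 the derivative [F'] is determined by [F], and the infimum is
   over a singleton; it is +oo if [F] is not differentiable in a0.
   When lam = 1 the parameter range is a point, there is no derivative to take,
   and the infimum (attained at F' = 0) leaves the i = 0 term only. *)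
Definition norm1 (P : Type) lam (D : set P) (N : (P -> R) -> \bar R)
    (F : R -> P -> R) : \bar R :=
  ereal_inf
    [set ereal_sup [set maxe (N (F a0)) (N (F' a0)) | a0 in prange lam]
    | F' in [set F' : R -> P -> R | forall p, D p ->
              derivative_within (prange lam) (F ^~ p) (F' ^~ p)]].

Definition holder1 alpha lam (v : R -> plane R -> R) : \bar R :=
  norm1 lam setT (holder alpha) v.

Definition d1 f : plane R -> R := 'D_((1, 0) : plane R) f.
Definition d2 f : plane R -> R := 'D_((0, 1) : plane R) f.
Definition dmix (m n : nat) f : plane R -> R := iter m d1 (iter n d2 f).

Definition smooth f : Prop := forall m n x, differentiable (dmix m n f) x.

Definition schwartz_norm (k : nat) phi : \bar R :=
  ereal_sup [set ((1 + `|z.1.1| + `|z.1.2|) ^+ k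
                   * `|dmix z.2.1 z.2.2 phi z.1|)%:E
            | z in [set z : plane R * (nat * nat) |
                     (z.2.1 <= k)%N /\ (z.2.2 <= k)%N]].

Definition schwartz phi : Prop :=
  smooth phi /\ forall k, (schwartz_norm k phi < +oo)%E.

(* A distribution is represented by a functional on all functions, of which
   only the restriction to Schwartz functions is meaningful: equality of
   distributions is [dist_eq]. *)
Definition functional := (plane R -> R) -> R.

Definition tempered (g : functional) : Prop :=
  (forall c phi1 phi2, schwartz phi1 -> schwartz phi2 ->
     g (fun x => c * phi1 x + phi2 x) = c * g phi1 + g phi2) /\
  (exists (k : nat) (C : R), forall phi, schwartz phi ->
     (`|g phi|%:E <= C%:E * schwartz_norm k phi)%E).

Definition dist_eq (g h : functional) : Prop :=
  forall phi, schwartz phi -> g phi = h phi.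

Definition leb2 := (@lebesgue_measure R \x @lebesgue_measure R)%E.

Definition dist_of u : functional :=
  fun phi => \int[leb2]_(x in setT) (u x * phi x).

Definition dist_d1 (g : functional) : functional := fun phi => - g (d1 phi).

Definition d11 u : functional := dist_d1 (dist_d1 (dist_of u)).

Definition dconv (g : functional) phi : plane R -> R :=
  fun x => g (fun y => phi (x - y)).

(* [fhat] is the Fourier transform of the real function [f], with the
   convention int e^{-i k.x} f(x) dx, in the case where it is real-valued. *)
Definition has_real_fourier f (fhat : plane R -> R) : Prop :=
  forall k : plane R,
    \int[leb2]_(x in setT) (f x * cos (k.1 * x.1 + k.2 * x.2)) = fhat k /\
    \int[leb2]_(x in setT) (f x * sin (k.1 * x.1 + k.2 * x.2)) = 0.

(* These two conditions determine [psi T] for every T > 0. *)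
Definition is_psi (psi : R -> plane R -> R) : Prop :=
  forall T, 0 < T ->
    schwartz (psi T) /\
    has_real_fourier (psi T) (fun k => expR (- T * (k.1 ^+ 4 + k.2 ^+ 2))).

(* [h, (.)_T] <> g = h g_T - (h <> g)_T, with [hg] standing for h <> g *)
Definition comm (psi : R -> plane R -> R) (h : plane R -> R)
    (g hg : functional) T : plane R -> R :=
  fun x => h x * dconv g (psi T) x - dconv hg (psi T) x.

Definition comm_dom : set (R * plane R) := [set p | 0 < p.1 <= 1].

(* sup over 0 < T <= 1 of (T^{1/4})^{- beta} ||F_T||, for F = F_T(x) *)
Definition comm_norm (beta : R) (F : R * plane R -> R) : \bar R :=
  ereal_sup [set (((T `^ 4^-1) `^ (- beta))%:E * supnorm (fun x => F (T, x)))%E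
            | T in [set T : R | 0 < T <= 1]].

Definition comm_norm1 (beta lam : R) (F : R -> R * plane R -> R) : \bar R :=
  norm1 lam comm_dom (comm_norm beta) F.

Definition evalE (a : plane R -> R) (F : R -> plane R -> R) : plane R -> R :=
  fun x => F (a x) x.

Definition modelled alpha (I : nat) u (v : 'I_I -> R -> plane R -> R)
    (a : plane R -> R) (sigma : 'I_I -> plane R -> R) (M : R) : Prop :=
  exists nu : plane R -> R,
    ereal_sup
      [set ((pdist z.2 z.1 `^ (2 * alpha))^-1 *
             `|u z.2 - u z.1
               - \sum_(i < I) sigma i z.1 *
                   (v i (a z.1) z.2 - v i (a z.1) z.1)
               - nu z.1 * (z.2.1 - z.1.1)|)%:E
      | z in [set z : plane R * plane R | z.1 != z.2]] = M%:E.

End Planar.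
Arguments functional R : clear implicits.

(* Main.v *)
Require Import Defs.
From HB Require Import structures.
From mathcomp Require Import all_boot all_order all_algebra.
From mathcomp Require Import all_classical all_reals all_analysis.
From mathcomp Require Import measurable_realfun ring lra.
Import Order.TTheory GRing.Theory Num.Theory.
Import numFieldNormedType.Exports.
Local Open Scope classical_set_scope.
Local Open Scope ring_scope.

Set Implicit Arguments.
Unset Strict Implicit.

(** Put F^T = b u''_T - sum_i sigma_i E[b,(.)_T]<>v_i''; the product b<>u'' is
    required to satisfy ||(b<>u'')_T - F^T|| -> 0 as T -> 0.  Expanding (F^s)_t - F^(s+t) for t <= s, the modelledness
    of u appears under the second derivative of psi_s, which annihilates affine
    functions and so removes both u(x) and nu; the rest is controlled by the
    Hoelder bounds and by the bounds on the given commutators, including their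
    Lipschitz dependence on a_0.  This gives
    ||(F^s)_t - F^(s+t)|| <= C A s^delta with delta = (3 alpha - 2) / 4 > 0.
    Hence the functions (F^(2^-n))_(T - 2^-n) form a Cauchy sequence in n; the
    limits G_T satisfy (G_T)_t = G_(T+t) and ||G_T - F^T|| <= C A T^delta.
    As ||G_T|| grows at most like T^(-(2 - alpha) / 4) while
    phi_t - phi = O(t^(1/2)) in L^1 for every Schwartz phi, the pairings of
    G_(2^-n) with phi converge, and their limit is b<>u''.  Uniqueness holds
    because a tempered g with ||g_T|| -> 0 vanishes. *)

(** * Integration on the plane *)

(** [is_psi] gives the kernel only through its Fourier transform, so evenness, mass, parabolic
    scaling and the semigroup law are all read off from injectivity of the transform, which is
    proved by averaging over frequencies. A distribution is merely a functional with a Schwartz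
    bound; it is carried through integrals by Riemann sums that converge in every Schwartz norm. The
    defect (F^s)_t - F^(s+t) contains s^(-1/2) t^(3 alpha / 4), which is acceptable only for t <= s;
    this forces the dyadic scales. In the passage from G_T to a distribution the growth exponent (2
    - alpha) / 4 lies between 1/4 and 1/2, so an approximation phi_t - phi = O(t^(1/4)) would not
    do: the order 1/2 comes from the vanishing first moment of psi in x_1. The condition alpha > 2/3
    is exactly delta > 0. The constant is fixed before psi, which is possible because it involves
    psi_1 only and [is_psi] determines psi_1. *)

Lemma le_of_eq d (T : porderType d) (x y : T) : x = y -> (x <= y)%O.
Proof. by move->. Qed.

Section PlaneIntegration.
Variable R : realType.
Implicit Types (f g : plane R -> R) (x y z : plane R).

Local Notation Rm := (measurableTypeR R).
Local Notation mplane := (Rm * Rm)%type.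

Let leb1 : {sigma_finite_measure set Rm -> \bar R} := @lebesgue_measure R.

(* [leb2] with its sigma-finite structure: the integrals [I2] are convertible to
   those of [dist_of] and [has_real_fourier]. *)
Definition mu2 : {sigma_finite_measure set mplane -> \bar R} :=
  HB.pack (leb1 \x leb1)%E
    (lebesgue_integral_fubini.measure_function_Measure_isSigmaFinite__to__measure_function_isSFinite
       leb1 leb1)
    (lebesgue_integral_fubini.measure_function_Measure_isSigmaFinite__to__measure_function_isSigmaFinite
       leb1 leb1).

Definition mfun2 f : Prop := measurable_fun (setT : set mplane) (f : mplane -> R).
Definition L1 f : Prop := mu2.-integrable setT (EFin \o f).
Definition I2 f : R := \int[mu2]_(x in setT) f x.

(** An open set is the union of the countably many squares with rational centre and radius 1 / (n +
    1) that it contains; this ties the topology of the plane to the product sigma-algebra. *)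
Lemma open_plane_measurable (A : set (plane R)) :
  open A -> measurable (A : set mplane).
Proof.
move=> oA.
pose B (q : rat * rat * nat) : set mplane :=
  (ball (ratr q.1.1 : R) q.2.+1%:R^-1 : set Rm) `*`
  (ball (ratr q.1.2 : R) q.2.+1%:R^-1 : set Rm).
pose B' q : set mplane := if `[< B q `<=` A >] then B q else set0.
suff -> : A = \bigcup_q B' q.
  apply: countable_bigcupT_measurable => [|q]; first exact: countableP.
  rewrite /B'; case: ifPn => _; last exact: measurable0.
  by apply: measurableX; exact: measurable_ball.
apply/seteqP; split => [x Ax|x [q _]]; last first.
  by rewrite /B'; case: ifPn => // /asboolP; apply.
move: oA; rewrite openE => /(_ _ Ax) /nbhs_ballP[e /= e0 eA].
(* The radius is below e / 2: the centre is within one radius of x, and the whole square then within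
   e. *)
pose n := Num.truncn (2 / e).
have ne : n.+1%:R^-1 < e / 2.
  by rewrite invf_plt ?posrE ?divr_gt0// invf_div truncnS_gt.
set r : R := n.+1%:R^-1 in ne.
have r0 : 0 < r by rewrite invr_gt0.
have rat_near (t : R) : exists q : rat, `|ratr q - t| < r.
  have tr : t - r < t + r by lra.
  have [q] := rat_in_itvoo tr.
  by rewrite in_itv/= => /andP[? ?]; exists q; rewrite ltr_norml; apply/andP; split; lra.
have [q1 hq1] := rat_near x.1; have [q2 hq2] := rat_near x.2.
exists (q1, q2, n) => //; rewrite /B' asboolT.
  by split; rewrite /= -ball_normE.
move=> y [/=]; rewrite -!ball_normE/= -/r => y1 y2; apply: eA.
move: hq1 hq2 y1 y2; rewrite !ltr_norml => /andP[? ?] /andP[? ?] /andP[? ?] /andP[? ?].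
split; rewrite -ball_normE /= ltr_norml; apply/andP; split; lra.
Qed.

Lemma continuous_mfun2 f : continuous f -> mfun2 f.
Proof.
move=> cf; apply: (measurability _ (RGenOpens.measurableE R)).
move=> _ [_ [a [b ->] <-]]; rewrite setTI; apply: open_plane_measurable.
by move/continuousP : cf; apply; exact: interval_open.
Qed.

(** Both sides are measures in A, so they only have to agree on half-open intervals. For a < 0 the
    preimage is closed on the other side, which does not change its length. *)
Lemma lebesgue_affine (a b : R) (A : set Rm) : a != 0 -> measurable A ->
  (lebesgue_measure A = `|a|%:E * lebesgue_measure [set t : Rm | A (a * t + b)%R])%E.
Proof.
move=> a0 mA.
have mphi : measurable_fun (setT : set Rm) (fun t : Rm => a * t + b : Rm).
  apply: continuous_measurable_fun => t.
  by apply: cvgD; [exact: cvgMl_tmp|exact: cvg_cst].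
pose p : {measure set Rm -> \bar R} :=
  measure_function_pushforward__canonical__measure_function_Measure leb1 mphi.
pose m := mscale (NngNum (normr_ge0 a)) p.
rewrite -[RHS]/(m A); apply: lebesgue_measure_unique => // _ [[u v] _ <-] /=.
rewrite /m /mscale /= /pushforward /= /preimage/=.
rewrite lebesgue_measure_itv/=.
have [ap|an|/eqP] := ltgtP 0 a; last by rewrite eq_sym (negbTE a0).
- have -> : [set t : Rm | `]u, v]%classic (a * t + b)] = `](u - b) / a, (v - b) / a]%classic :> set Rm.
    apply/seteqP; split => t /=; rewrite !in_itv/= ltr_pdivrMr// ler_pdivlMr//;
      move=> /andP[? ?]; apply/andP; split; lra.
  rewrite lebesgue_measure_itv/= !lte_fin ltr_pM2r ?invr_gt0// ltrD2r gtr0_norm//.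
  case: ifPn => _; last by rewrite mule0.
  by rewrite -!EFinD -EFinM; congr EFin; field.
- have -> : [set t : Rm | `]u, v]%classic (a * t + b)] = `[(v - b) / a, (u - b) / a[%classic :> set Rm.
    apply/seteqP; split => t /=; rewrite !in_itv/= ltr_ndivlMr// ler_ndivrMr//;
      move=> /andP[? ?]; apply/andP; split; lra.
  rewrite lebesgue_measure_itv/= !lte_fin ltr_nM2r ?invr_lt0// ltrD2r ltr0_norm//.
  case: ifPn => _; last by rewrite mule0.
  by rewrite -!EFinD -EFinM; congr EFin; field.
Qed.

Definition affine2 (a b : R) z x : plane R := (a * x.1 + z.1, b * x.2 + z.2).

Lemma measurable_affine2 (a b : R) z :
  measurable_fun (setT : set mplane) (affine2 a b z : mplane -> mplane).
Proof.
apply: measurable_fun_pair; apply: measurable_funD => //;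
  apply: measurable_funM => //.
Qed.

Lemma mu2_affine (a b : R) z (A : set mplane) : a != 0 -> b != 0 -> measurable A ->
  (mu2 A = (`|a| * `|b|)%:E * mu2 (affine2 a b z @^-1` A))%E.
Proof.
move=> a0 b0 mA.
pose p : {measure set mplane -> \bar R} :=
  measure_function_pushforward__canonical__measure_function_Measure mu2
    (measurable_affine2 a b z).
pose k := NngNum (mulr_ge0 (normr_ge0 a) (normr_ge0 b)).
pose m := mscale k p.
rewrite -[RHS]/(m A); apply: product_measure_unique => // B C mB mC.
rewrite /m /= /mscale /= /pushforward /=.
have -> : affine2 a b z @^-1` (B `*` C) =
  [set t : Rm | B (a * t + z.1)] `*` [set t : Rm | C (b * t + z.2)] by [].
have mpre (c e : R) (D : set Rm) : measurable D -> measurable [set t : Rm | D (c * t + e)].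
  move=> mD; rewrite -[X in measurable X]setTI.
  have : measurable_fun (setT : set Rm) (fun t : Rm => c * t + e : Rm).
    apply: continuous_measurable_fun => t.
    by apply: cvgD; [exact: cvgMl_tmp|exact: cvg_cst].
  by apply.
rewrite [X in (_ * X)%E](product_measure1E _ _ (mpre _ _ _ mB) (mpre _ _ _ mC)).
by rewrite /leb1 (lebesgue_affine z.1 a0 mB) (lebesgue_affine z.2 b0 mC) EFinM muleACA.
Qed.

Lemma ge0_integral_affine (a b : R) z (f : mplane -> \bar R) : a != 0 -> b != 0 ->
  measurable_fun setT f -> (forall x, 0 <= f x)%E ->
  (\int[mu2]_x f x = (`|a| * `|b|)%:E * \int[mu2]_x f (affine2 a b z x))%E.
Proof.
move=> a0 b0 mf f0.
pose p : {measure set mplane -> \bar R} :=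
  measure_function_pushforward__canonical__measure_function_Measure mu2
    (measurable_affine2 a b z).
pose k := NngNum (mulr_ge0 (normr_ge0 a) (normr_ge0 b)).
rewrite (@eq_measure_integral _ _ _ _ (mscale k p)); last first.
  by move=> A mA _; exact: (mu2_affine z a0 b0 mA).
rewrite (ge0_integral_mscale p measurableT k mf (fun x _ => f0 x)).
apply: (congr1 (mule (`|a| * `|b|)%:E)).
exact: (ge0_integral_pushforward (measurable_affine2 a b z) mu2 measurableT mf
  (fun x _ => f0 x)).
Qed.

Lemma L1_affine (a b : R) z f : a != 0 -> b != 0 ->
  L1 f -> L1 (f \o affine2 a b z).
Proof.
move=> a0 b0 /integrableP[mf foo]; apply/integrableP; split.
  exact: (measurableT_comp mf (measurable_affine2 a b z)).
have mabs : measurable_fun setT (fun x : mplane => `|(EFin \o f) x|%E).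
  exact: measurableT_comp mf.
rewrite (ge0_integral_affine z a0 b0 mabs (fun=> abse_ge0 _)) in foo.
change (\int[mu2]_x `|(EFin \o f) (affine2 a b z x)| < +oo)%E.
have Y0 : (0 <= \int[mu2]_x `|(EFin \o f) (affine2 a b z x)|)%E by exact: integral_ge0.
have k0 : 0 < `|a| * `|b| by rewrite mulr_gt0// normr_gt0.
move: (integral _ _ _) Y0 foo => [r| |]// _; rewrite ?ltry// mulry.
by rewrite gtr0_sg// mul1e.
Qed.

(** This one change of variables serves for reflections (a = b = -1), for parabolic scaling, and for
    shrinking the plane to a point in [fourier_vanish]. *)
Lemma I2_affine (a b : R) z f : a != 0 -> b != 0 -> L1 f ->
  I2 f = `|a| * `|b| * I2 (f \o affine2 a b z).
Proof.
move=> a0 b0 Lf; have Laf := L1_affine z a0 b0 Lf.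
have mf := measurable_int _ Lf.
rewrite /I2 /Rintegral integralE [in RHS]integralE.
rewrite (ge0_integral_affine z a0 b0 (measurable_funepos mf) (fun=> funepos_ge0 _ _)).
rewrite (ge0_integral_affine z a0 b0 (measurable_funeneg mf) (fun=> funeneg_ge0 _ _)).
have Ep : (fun x => (EFin \o f)^\+ (affine2 a b z x))%E =
    (fun x => ((f \o affine2 a b z) x)%:E)^\+%E.
  by apply/funext => x; rewrite !funeposE.
have En : (fun x => (EFin \o f)^\- (affine2 a b z x))%E =
    (fun x => ((f \o affine2 a b z) x)%:E)^\-%E.
  by apply/funext => x; rewrite !funenegE.
rewrite Ep En.
have hp := integrable_pos_fin_num measurableT Laf.
have hn := integrable_neg_fin_num measurableT Laf.
rewrite -muleBr//; last by apply: fin_num_adde_defl; rewrite fin_numN; exact: hn.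
rewrite fineM//; rewrite fin_numB; apply/andP; split; [exact: hp|exact: hn].
Qed.

Lemma L1_measurable f : L1 f -> mfun2 f.
Proof. by move=> /measurable_int/measurable_EFinP. Qed.

Lemma L1D f g : L1 f -> L1 g -> L1 (fun x => f x + g x).
Proof. by move=> hf hg; exact: (integrableD measurableT hf hg). Qed.

Lemma L1Z (c : R) f : L1 f -> L1 (fun x => c * f x).
Proof. by move=> hf; exact: (integrableZl measurableT c hf). Qed.

Lemma L1B f g : L1 f -> L1 g -> L1 (fun x => f x - g x).
Proof. by move=> hf hg; exact: (integrableB measurableT hf hg). Qed.

Lemma L1_norm f : L1 f -> L1 (fun x => `|f x|).
Proof. exact: integrable_norm. Qed.

Lemma I2D f g : L1 f -> L1 g -> I2 (fun x => f x + g x) = I2 f + I2 g.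
Proof. by move=> hf hg; exact: RintegralD. Qed.

Lemma I2B f g : L1 f -> L1 g -> I2 (fun x => f x - g x) = I2 f - I2 g.
Proof. by move=> hf hg; exact: RintegralB. Qed.

Lemma I2Z (c : R) f : L1 f -> I2 (fun x => c * f x) = c * I2 f.
Proof. by move=> hf; exact: RintegralZl. Qed.

Lemma I2_0 : I2 (fun=> 0) = 0.
Proof. by rewrite /I2 /Rintegral integral0. Qed.

Lemma L1_0 : L1 (fun=> 0).
Proof. exact: integrable0. Qed.

Lemma L1_sum (T : Type) (s : seq T) (F : T -> plane R -> R) :
  (forall i, L1 (F i)) -> L1 (fun x => \sum_(i <- s) F i x).
Proof.
move=> LF; elim: s => [|i s IH].
  by under eq_fun do rewrite big_nil; exact: L1_0.
by under eq_fun do rewrite big_cons; exact: L1D.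
Qed.

Lemma I2_sum (T : Type) (s : seq T) (F : T -> plane R -> R) :
  (forall i, L1 (F i)) ->
  I2 (fun x => \sum_(i <- s) F i x) = \sum_(i <- s) I2 (F i).
Proof.
move=> LF; elim: s => [|i s IH].
  by under eq_fun do rewrite big_nil; rewrite I2_0 big_nil.
by under eq_fun do rewrite big_cons; rewrite I2D ?big_cons ?IH//; exact: L1_sum.
Qed.

Lemma le_I2 f g : L1 f -> L1 g -> (forall x, f x <= g x) -> I2 f <= I2 g.
Proof. by move=> hf hg fg; apply: le_Rintegral. Qed.

Lemma normI2 f : L1 f -> `|I2 f| <= I2 (fun x => `|f x|).
Proof. by move=> hf; exact: le_normr_Rintegral. Qed.

Lemma I2_ge0 f : (forall x, 0 <= f x) -> 0 <= I2 f.
Proof. by move=> f0; apply: Rintegral_ge0. Qed.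

Lemma L1_le f g : mfun2 f -> L1 g -> (forall x, `|f x| <= g x) -> L1 f.
Proof.
move=> mf Lg fg; apply: le_integrable Lg => //.
  exact/measurable_EFinP.
by move=> x _ /=; rewrite lee_fin (le_trans (fg x))// ler_norm.
Qed.

Lemma normI2_le f g : mfun2 f -> L1 g -> (forall x, `|f x| <= g x) ->
  `|I2 f| <= I2 g.
Proof.
move=> mf Lg fg; have Lf := L1_le mf Lg fg.
by apply: le_trans (normI2 Lf) _; apply: le_I2 => //; exact: L1_norm.
Qed.

Lemma I2_cvg (f_ : (plane R -> R)^nat) f g :
  (forall n, mfun2 (f_ n)) -> L1 g -> (forall n x, `|f_ n x| <= g x) ->
  (forall x, f_ n x @[n --> \oo] --> f x) ->
  L1 f /\ I2 (f_ n) @[n --> \oo] --> I2 f.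
Proof.
move=> mf_ Lg fg ff.
have mf : mfun2 f by exact: (measurable_fun_cvg mf_ (fun x _ => ff x)).
have fgl x : `|f x| <= g x.
  have cn : `|f_ n x| @[n --> \oo] --> `|f x| by apply: cvg_norm; exact: ff.
  rewrite -(cvg_lim _ cn)//; apply: limr_le; first by apply/cvg_ex; exists `|f x|.
  by apply: nearW => n; exact: fg.
have Lf := L1_le mf Lg fgl; split => //.
have Lf_ n := L1_le (mf_ n) Lg (fg n).
have mEf n : measurable_fun setT (EFin \o f_ n : mplane -> \bar R).
  by apply/measurable_EFinP; exact: mf_.
have mEl : measurable_fun setT (EFin \o f : mplane -> \bar R).
  by apply/measurable_EFinP; exact: mf.
have [| |_ _ cf] := dominated_convergence measurableT mEf mEl _ Lg.
- by apply: aeW => x _; apply: cvg_EFin; [exact: nearW|exact: ff].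
- by apply: aeW => x n _ /=; rewrite lee_fin.
apply: fine_cvg; rewrite fineK; first exact: cf.
exact: integrable_fin_num.
Qed.

(** Product of two unnormalised Cauchy densities: an integrable majorant with an explicit integral,
    and also the Poisson kernel of [fourier_vanish] at unit scale. *)
Definition wt x : R := (oneDsqr x.1)^-1 * (oneDsqr x.2)^-1.

Lemma wt_gt0 x : 0 < wt x.
Proof. by rewrite /wt mulr_gt0// invr_gt0 (lt_le_trans ltr01)// oneDsqr_ge1. Qed.

Lemma measurable_wt : mfun2 wt.
Proof.
apply: measurable_funM; apply: (measurableT_comp (f := fun t : R => (oneDsqr t)^-1)) => //;
  exact: (continuous_measurable_fun (@continuous_oneDsqrV R)).
Qed.

Lemma integral_oneDsqrV :
  (\int[leb1]_x ((oneDsqr x)^-1)%:E = (pi : R)%:E)%E.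
Proof.
rewrite ge0_symfun_integralT//.
- by rewrite -set_itvcy integral0y_oneDsqr -EFinM; congr EFin; field.
- exact: continuous_oneDsqrV.
- by move=> x /=; rewrite /oneDsqr sqrrN.
Qed.

Lemma integral_wt : (\int[mu2]_x (wt x)%:E = (pi * pi : R)%:E)%E.
Proof.
have mwt : measurable_fun setT (fun x : mplane => (wt x)%:E).
  by apply/measurable_EFinP; exact: measurable_wt.
rewrite (@fubini_tonelli1 _ _ _ _ _ leb1 leb1 (EFin \o wt))//=; last first.
  by move=> x; rewrite lee_fin ltW// wt_gt0.
rewrite /fubini_F/= /wt/=.
have v0 t : (0 <= (oneDsqr t : R)^-1)%R.
  by rewrite invr_ge0 (le_trans ler01)// oneDsqr_ge1.
have mv : measurable_fun (setT : set Rm) (fun t : Rm => ((oneDsqr t)^-1)%:E).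
  by apply/measurable_EFinP; exact: (continuous_measurable_fun (@continuous_oneDsqrV R)).
under eq_integral => t _.
  under eq_integral => u _ do rewrite EFinM.
  rewrite ge0_integralZl//= ?lee_fin//.
  rewrite integral_oneDsqrV muleC.
  over.
by rewrite ge0_integralZl//= ?lee_fin ?pi_ge0// integral_oneDsqrV -EFinM.
Qed.

Lemma L1_wt : L1 wt.
Proof.
apply/integrableP; split; first by apply/measurable_EFinP; exact: measurable_wt.
rewrite (_ : (fun x => _) = EFin \o wt); last first.
  by apply/funext => x /=; rewrite ger0_norm// ltW// wt_gt0.
by rewrite integral_wt ltry.
Qed.

Lemma I2_wt : I2 wt = pi * pi.
Proof. by rewrite /I2 /Rintegral integral_wt. Qed.

Lemma L1_dom (C : R) f : mfun2 f -> (forall x, `|f x| <= C * wt x) -> L1 f.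
Proof. by move=> mf; apply: L1_le => //; exact: L1Z L1_wt. Qed.

End PlaneIntegration.

(** * Differential calculus on the plane *)

Section Calculus.
Variable R : realType.
Implicit Types (f g : plane R -> R) (x y z h : plane R).

Definition n1 h : R := `|h.1| + `|h.2|.
Definition br x : R := 1 + n1 x.

Lemma n1_ge0 h : 0 <= n1 h.
Proof. by rewrite addr_ge0. Qed.

Lemma br_ge1 x : 1 <= br x.
Proof. by rewrite lerDl n1_ge0. Qed.

Lemma br_gt0 x : 0 < br x.
Proof. exact: lt_le_trans ltr01 (br_ge1 x). Qed.

Lemma br_ge0 x : 0 <= br x.
Proof. exact: ltW (br_gt0 x). Qed.
Hint Resolve br_ge0 br_ge1 br_gt0 n1_ge0 : core.

Lemma n1N x : n1 (- x) = n1 x.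
Proof. by rewrite /n1 /= !normrN. Qed.

Lemma brN x : br (- x) = br x.
Proof. by rewrite /br n1N. Qed.

Lemma n1D x y : n1 (x + y) <= n1 x + n1 y.
Proof. by rewrite /n1 addrACA; apply: lerD; exact: ler_normD. Qed.

Lemma brD x y : br (x + y) <= br x * br y.
Proof.
rewrite /br; have := n1D x y; have := n1_ge0 x; have := n1_ge0 y; nra.
Qed.

Lemma n1Z (t : R) x : n1 (t *: x) = `|t| * n1 x.
Proof. by rewrite /n1 /= !normrM mulrDr. Qed.

(** Peetre's inequality: decay at y can be traded for decay at x at the price of the same power of
    the weight of y - x. *)
Lemma brV_le (k : nat) x y : (br x ^+ k)^-1 <= br (y - x) ^+ k * (br y ^+ k)^-1.
Proof.
rewrite -ler_pdivrMl ?exprn_gt0// -invfM lef_pV2 ?posrE ?mulr_gt0 ?exprn_gt0//.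
rewrite -exprMn lerXn2r ?nnegrE ?mulr_ge0 ?(ltW (br_gt0 _))//.
by rewrite (le_trans _ (brD _ _))// subrK.
Qed.

(** Two powers of [br] for each coordinate. Hence 4 is the number of powers spent on integrability
    in every estimate below. *)
Lemma brV4_wt x : (br x ^+ 4)^-1 <= wt x.
Proof.
rewrite /wt -invfM lef_pV2 ?posrE ?exprn_gt0// ?mulr_gt0 ?(lt_le_trans ltr01) ?oneDsqr_ge1//.
rewrite (_ : br x ^+ 4 = br x ^+ 2 * br x ^+ 2); last by rewrite -exprD.
have H (t : R) : `|t| <= n1 x -> oneDsqr t <= br x ^+ 2.
  move=> tx; rewrite /oneDsqr /br -real_normK ?num_real//.
  by have := n1_ge0 x; have := normr_ge0 t; nra.
by apply: ler_pM; rewrite ?(le_trans ler01) ?oneDsqr_ge1//; apply: H;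
  rewrite /n1 ?lerDl ?lerDr.
Qed.

Lemma diffE1 f x h : differentiable f x -> 'd f x h = h.1 * d1 f x + h.2 * d2 f x.
Proof.
move=> df; rewrite /d1 /d2 !deriveE//.
have {1}-> : h = h.1 *: ((1, 0) : plane R) + h.2 *: ((0, 1) : plane R).
  by case: h => a b; congr pair; rewrite /= /GRing.scale/= !(mulr1, mulr0) ?addr0 ?add0r.
by rewrite linearD !linearZ.
Qed.

Lemma MVT_plane f x h : (forall y, differentiable f y) ->
  exists2 t : R, 0 <= t <= 1 &
    f (x + h) - f x = h.1 * d1 f (x + t *: h) + h.2 * d2 f (x + t *: h).
Proof.
move=> df.
pose gam (t : R) : plane R := x + t *: h.
have dgam (t : R) := is_diffD (is_diff_cst x t) (is_diff_scalel t h).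
have gamE : cst x + *:%R^~ h = gam by [].
pose g t := f (gam t).
have dg (t : R) : is_derive t 1 g (h.1 * d1 f (gam t) + h.2 * d2 f (gam t)).
  have dga : differentiable gam t by rewrite -gamE; case: (dgam t).
  have dgt : differentiable g t by apply: differentiable_comp.
  split; first exact: diff_derivable.
  rewrite deriveE// diff_comp//= -diffE1//; congr ('d f _ _).
  have [_ E] := dgam t; rewrite gamE in E.
  by rewrite E/= add0r scale1r.
have [|c c01] := @MVT R g (fun t => h.1 * d1 f (gam t) + h.2 * d2 f (gam t)) 0 1 ltr01.
- apply: continuous_subspaceT => t.
  by apply/differentiable_continuous/derivable1_diffP; case: (dg t).
rewrite /g /gam scale1r scale0r addr0 subr0 mulr1 => ->.
by exists c => //; move: c01; rewrite in_itv/= => /andP[/ltW -> /ltW ->].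
Qed.

Lemma n1_norm x : n1 x <= 2 * `|x|.
Proof.
rewrite mulr_natl mulr2n /n1 prod_normE.
by apply: lerD; rewrite le_max lexx ?orbT.
Qed.

(** A quadratic rest is o(h), so the linear part is the differential. Unlike a limit of difference
    quotients, such a bound passes through integrals, and all derivatives of convolutions are
    obtained in this way. *)
Lemma diff_taylor f x (a b C : R) :
  (forall h, n1 h <= 1 ->
    `|f (x + h) - f x - h.1 * a - h.2 * b| <= C * n1 h ^+ 2) ->
  [/\ differentiable f x, d1 f x = a & d2 f x = b].
Proof.
move=> H.
pose L (h : plane R) : R := h.1 * a + h.2 * b.
have linL : linear L.
  by move=> c u v; rewrite /L /= /GRing.scale /= !mulrDl mulrDr !mulrA addrACA.
pose LL : {linear plane R -> R} := HB.pack L (GRing.isLinear.Build _ _ _ _ L linL).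
have cL : continuous LL.
  move=> [p q]; apply: cvgD; apply: cvgM; do ?exact: cvg_cst.
    exact: cvg_fst.
  exact: cvg_snd.
have fL : forall e : R, 0 < e -> \forall h \near (0 : plane R),
    `|(f \o shift x - (cst (f x) + L)) h| <= e * `|h|.
  move=> e e0.
  (* The factor 4 is the square of the 2 in [n1_norm], which compares [n1] with the sup norm. *)
  pose K := 4 * (`|C| + 1).
  have K0 : 0 < K by rewrite mulr_gt0// ltr_wpDl.
  have m0 : 0 < Num.min 2^-1 (e / K) by rewrite lt_min invr_gt0 ltr0n divr_gt0.
  have : \forall h \near (0 : plane R), `|h| < Num.min 2^-1 (e / K).
    exact: nbhs0_lt.
  apply: filterS => h hd.
  move: hd; rewrite lt_min => /andP[h1 h2].
  have n2 := n1_norm h.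
  have -> : (f \o shift x - (cst (f x) + L)) h = f (x + h) - f x - h.1 * a - h.2 * b.
    rewrite -[LHS]/(f (h + x) - (f x + L h)) /L (addrC h x); ring.
  have nh : n1 h <= 1 by lra.
  apply: (le_trans (H _ nh)).
  rewrite ltr_pdivlMr// in h2.
  have hn := normr_ge0 h; have n0 := n1_ge0 h; have Cn := ler_norm C.
  rewrite /K in h2.
  have X : C * n1 h ^+ 2 <= `|C| * (2 * `|h|) ^+ 2.
    apply: (le_trans (ler_wpM2r (sqr_ge0 _) (ler_norm C))).
    by rewrite ler_wpM2l// lerXn2r// nnegrE// mulr_ge0.
  have Y : `|C| * (2 * `|h|) ^+ 2 <= e * `|h| by have := normr_ge0 C; nra.
  exact: le_trans X Y.
have dE : 'd f x = LL :> (plane R -> R).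
  by apply: diff_unique => //; apply/eqaddoP => e; exact: fL.
have df : differentiable f x.
  by apply/diff_locallyP; rewrite dE; split => //; apply/eqaddoP => e; exact: fL.
split=> //.
  by rewrite /d1 deriveE// dE /LL/= /L /= mul1r mul0r addr0.
by rewrite /d2 deriveE// dE /LL/= /L /= mul1r mul0r add0r.
Unshelve. all: by end_near. Qed.

Lemma derive_shift f (c v : plane R) x :
  'D_v (fun y => f (y + c)) x = 'D_v f (x + c).
Proof.
rewrite /derive.
suff -> : (fun h : R => h^-1 *: (((fun y => f (y + c)) \o shift x) (h *: v) - f (x + c)))
  = (fun h : R => h^-1 *: ((f \o shift (x + c)) (h *: v) - f (x + c))) by [].
by apply/funext => t /=; rewrite addrA.
Qed.

(** Schwarz's theorem in an asymmetric form: continuity is asked of [d1 (d2 f)] only, and the value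
    of [d2 (d1 f)] is a conclusion. The induction in [d2_dmix] needs exactly this form. *)
Lemma derivative_symmetric f : (forall x, differentiable f x) ->
  (forall x, differentiable (d2 f) x) -> continuous (d1 (d2 f)) ->
  d2 (d1 f) = d1 (d2 f).
Proof.
move=> df dd2 cd12; apply/funext => x.
rewrite {1}/d2 /derive; apply: cvg_lim => //.
set L := d1 (d2 f) x.
apply/cvgrPdist_le => e e0.
have /cvgrPdist_le /(_ _ e0) /nbhs_ballP[d /= d0 dP] := cd12 x.
near=> k.
have k0 : k != 0 by near: k; exact: nbhs_dnbhs_neq.
have kd : `|k| < d by near: k; apply: dnbhs0_lt.
pose e1 : plane R := (1, 0); pose e2 : plane R := (0, 1).
rewrite -/e2.
(* Two mean value steps, first along e2 for the increment in e1 and then along e1, write the second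
   difference as h k times a nearby value of [d1 (d2 f)]. *)
have key (h : R) : `|h| < d -> h != 0 -> `|(f (x + k *: e2 + h *: e1) - f (x + h *: e1)
    - (f (x + k *: e2) - f x)) - h * k * L| <= e * `|h| * `|k|.
  move=> hd h0.
  pose g y := f (y + h *: e1) - f y.
  have dg y : differentiable g y.
    apply: differentiableB; last exact: df.
    by apply: differentiable_comp; [apply: differentiableD|exact: df].
  have [t t01 gE] := MVT_plane x (k *: e2) dg.
  have d2g y : d2 g y = d2 f (y + h *: e1) - d2 f y.
    rewrite /d2 /g deriveB; last 2 first.
    - by apply: diff_derivable; apply: differentiable_comp => //; apply: differentiableD.
    - exact: diff_derivable.
    by rewrite derive_shift.
  have [s s01 hE] := MVT_plane (x + t *: (k *: e2)) (h *: e1) dd2.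
  have -> : f (x + k *: e2 + h *: e1) - f (x + h *: e1) - (f (x + k *: e2) - f x)
     = g (x + k *: e2) - g x by rewrite /g; ring.
  rewrite gE d2g hE /= /GRing.scale /= !(mulr0, mulr1, mul0r, add0r, addr0).
  rewrite (_ : _ - _ = - (h * k) * (L - d1 (d2 f) (x + t *: (k *: e2) + s *: (h *: e1)))); last by ring.
  rewrite normrM normrN normrM mulrC -mulrA ler_wpM2r ?mulr_ge0//.
  apply: dP; move: t01 s01 => /andP[t0 t1] /andP[s0 s1].
  have ti (u v : R) : 0 <= u -> u <= 1 -> `|v| < d -> `|u * v| < d.
    move=> u0 u1 vd; rewrite normrM (ger0_norm u0).
    by apply: le_lt_trans vd; rewrite ler_piMl.
  split; rewrite /= -ball_normE /= /GRing.scale/= !(mulr0, mulr1, addr0, add0r);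
    by rewrite opprD addrA subrr add0r normrN; apply: ti.
have cvgd y : (fun h : R => h^-1 *: (f (h *: e1 + y) - f y)) @ 0^' --> d1 f y.
  have dv : derivable f y e1 by apply: diff_derivable; exact: df.
  exact: dv.
(* Divide by h and let h tend to 0 with k fixed; the second difference becomes an increment of
   [d1 f]. *)
have lim_le : `|d1 f (x + k *: e2) - d1 f x - k * L| <= e * `|k|.
  have c1 : (fun h : R => `|h^-1 *: (f (h *: e1 + (x + k *: e2)) - f (x + k *: e2))
      - h^-1 *: (f (h *: e1 + x) - f x) - k * L|) @ 0^'
      --> `|d1 f (x + k *: e2) - d1 f x - k * L|.
    apply: cvg_norm; apply: cvgB; last exact: cvg_cst.
    by apply: cvgB; exact: cvgd.
  rewrite -(cvg_lim _ c1)//; apply: limr_le; first by apply/cvg_ex; eexists; exact: c1.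
  near=> h.
  have h0 : h != 0 by near: h; exact: nbhs_dnbhs_neq.
  have hd : `|h| < d by near: h; apply: dnbhs0_lt.
  have := key h hd h0.
  rewrite (_ : _ - h * k * L = h * (h^-1 *: (f (h *: e1 + (x + k *: e2)) - f (x + k *: e2))
      - h^-1 *: (f (h *: e1 + x) - f x) - k * L)); last first.
    rewrite /GRing.scale /= !(addrC (h *: e1)); field.
    exact: h0.
  by rewrite normrM mulrAC mulrC ler_pM2r ?normr_gt0.
rewrite [X in `|X|](_ : _ = - (k^-1 * (d1 f (x + k *: e2) - d1 f x - k * L))); last first.
  rewrite /GRing.scale /= (addrC (k *: e2)); field.
  exact: k0.
by rewrite normrN normrM normfV ler_pdivrMl ?normr_gt0// (mulrC `|k|).
Unshelve. all: by end_near. Qed.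

End Calculus.

#[global] Hint Extern 0 (is_true (_ <= br _)) => solve [exact: br_ge0 | exact: br_ge1] : core.
#[global] Hint Extern 0 (is_true (_ < br _)) => solve [exact: br_gt0] : core.
#[global] Hint Extern 0 (is_true (_ <= n1 _)) => solve [exact: n1_ge0] : core.

(** * Schwartz functions *)

Section Jets.
Variable R : realType.
Implicit Types (f g phi : plane R -> R) (x y z h : plane R).

Definition sn k phi : R := fine (schwartz_norm k phi).

Lemma schwartz_norm_ge0 k phi : (0 <= schwartz_norm k phi)%E.
Proof.
apply: (@le_trans _ _
  ((1 + `|(0 : plane R).1| + `|(0 : plane R).2|) ^+ k * `|phi 0|)%:E).
  by rewrite lee_fin mulr_ge0// exprn_ge0// !addr_ge0.
by apply: ereal_sup_ubound; exists ((0, (0%N, 0%N)) : plane R * (nat * nat)).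
Qed.

Lemma schwartz_normE k phi : schwartz phi -> schwartz_norm k phi = (sn k phi)%:E.
Proof.
by move=> [_ /(_ k) foo]; rewrite fineK// ge0_fin_numE// schwartz_norm_ge0.
Qed.

Lemma sn_ge0 k phi : 0 <= sn k phi.
Proof. exact: fine_ge0 (schwartz_norm_ge0 k phi). Qed.
Hint Resolve sn_ge0 : core.

Lemma schwartz_bound phi k m n x : schwartz phi -> (m <= k)%N -> (n <= k)%N ->
  `|dmix m n phi x| <= sn k phi * (br x ^+ k)^-1.
Proof.
move=> sp mk nk; rewrite ler_pdivlMr ?exprn_gt0//.
rewrite -lee_fin -(schwartz_normE k sp) mulrC /br /n1 addrA.
by apply: ereal_sup_ubound; exists ((x, (m, n)) : plane R * (nat * nat)).
Qed.

Lemma schwartz_norm_le phi k (B : R) :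
  (forall m n x, (m <= k)%N -> (n <= k)%N ->
    `|dmix m n phi x| <= B * (br x ^+ k)^-1) ->
  (schwartz_norm k phi <= B%:E)%E.
Proof.
move=> H; apply: ge_ereal_sup => _ [[x [m n]] /= [mk nk] <-].
rewrite lee_fin -addrA -/(n1 x) -/(br x) mulrC -ler_pdivlMr ?exprn_gt0//.
exact: H.
Qed.

(** [dmix] applies all of [d2] before any [d1], so a further [d2] has to be commuted inwards past
    the [d1] one at a time. *)
Lemma d2_dmix phi m n : smooth phi -> d2 (dmix m n phi) = dmix m n.+1 phi.
Proof.
move=> sp; elim: m => [//|m IH].
rewrite -[dmix m.+1 n phi]/(d1 (dmix m n phi)) derivative_symmetric.
- by rewrite IH.
- exact: sp.
- by rewrite IH; exact: sp.
- by rewrite IH => x; apply: differentiable_continuous; exact: (sp m.+1 n.+1 x).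
Qed.

Lemma schwartz_bound_shift phi k m n x h (t : R) : schwartz phi ->
  (m <= k)%N -> (n <= k)%N -> 0 <= t <= 1 ->
  `|dmix m n phi (x + t *: h)| <= sn k phi * br h ^+ k * (br x ^+ k)^-1.
Proof.
move=> sp mk nk /andP[t0 t1]; apply: (le_trans (schwartz_bound _ sp mk nk)).
rewrite -mulrA ler_wpM2l//.
apply: (le_trans (brV_le k _ x)); rewrite ler_wpM2r ?invr_ge0 ?exprn_ge0//.
rewrite lerXn2r ?nnegrE// opprD addrA subrr add0r brN.
by rewrite /br lerD2l n1Z ger0_norm// ler_piMl.
Qed.

Lemma schwartz_taylor1 phi k m n x h (t : R) : schwartz phi ->
  (m < k)%N -> (n < k)%N -> 0 <= t <= 1 ->
  `|dmix m n phi (x + t *: h) - dmix m n phi x|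
    <= n1 h * (sn k phi * br h ^+ k * (br x ^+ k)^-1).
Proof.
move=> sp mk nk /andP[t0 t1].
have [s s01 ->] := MVT_plane x (t *: h) (sp.1 m n).
rewrite (d2_dmix _ _ sp.1) -[d1 _]/(dmix m.+1 n phi) scalerA.
have st01 : 0 <= s * t <= 1.
  by move/andP : s01 => [s0 s1]; rewrite mulr_ge0//= mulr_ile1.
have B1 := schwartz_bound_shift x h sp mk (ltnW nk) st01.
have B2 := schwartz_bound_shift x h sp (ltnW mk) nk st01.
set B := sn k phi * _ * _ in B1 B2 *.
apply: (le_trans (ler_normD _ _)); rewrite /= !normrM (ger0_norm t0) /n1 mulrDl.
have B0 : 0 <= B by apply: le_trans B1.
by apply: lerD; apply: ler_pM => //; rewrite ?mulr_ge0// ler_piMl.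
Qed.

Lemma schwartz_taylor2 phi k m n x h : schwartz phi ->
  (m.+1 < k)%N -> (n.+1 < k)%N ->
  `|dmix m n phi (x + h) - dmix m n phi x - h.1 * dmix m.+1 n phi x
     - h.2 * dmix m n.+1 phi x|
    <= n1 h ^+ 2 * (sn k phi * br h ^+ k * (br x ^+ k)^-1).
Proof.
move=> sp mk nk.
have [s s01 ->] := MVT_plane x h (sp.1 m n).
rewrite (d2_dmix _ _ sp.1) -[d1 _]/(dmix m.+1 n phi).
have B1 := schwartz_taylor1 x h sp mk (ltnW nk) s01.
have B2 := schwartz_taylor1 x h sp (ltnW mk) nk s01.
set B := sn k phi * _ * _ in B1 B2 *.
rewrite (_ : _ - _ = h.1 * (dmix m.+1 n phi (x + s *: h) - dmix m.+1 n phi x) +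
  h.2 * (dmix m n.+1 phi (x + s *: h) - dmix m n.+1 phi x)); last by ring.
apply: (le_trans (ler_normD _ _)); rewrite !normrM expr2 -mulrA [leRHS]mulrDl.
by apply: lerD; apply: ler_wpM2l.
Qed.

(* [D m n] stands for the derivative of order [(m, n)].  The Taylor bound is an
   estimate without any limit, which makes the class easily seen to be closed
   under convolution and reflection. *)
Definition jet (D : nat -> nat -> plane R -> R) : Prop := forall m n k,
  exists C : R, (forall x, `|D m n x| <= C * (br x ^+ k)^-1) /\
  (forall x h, n1 h <= 1 ->
    `|D m n (x + h) - D m n x - h.1 * D m.+1 n x - h.2 * D m n.+1 x|
     <= n1 h ^+ 2 * (C * (br x ^+ k)^-1)).

Lemma schwartz_jet phi : schwartz phi -> jet (fun m n => dmix m n phi).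
Proof.
(* A single index of [schwartz_norm] governs the decay and both orders of differentiation, and the
   Taylor rest uses two derivatives more. The factor 2 ^ K below bounds br h ^ K for n1 h <= 1. *)
move=> sp m n k; pose K := maxn k (maxn m n).+2.
have kK : (k <= K)%N by exact: leq_maxl.
have mnK : ((maxn m n).+2 <= K)%N by exact: leq_maxr.
have mK : (m.+1 < K)%N by apply: leq_trans mnK; rewrite ltnS ltnS leq_maxl.
have nK : (n.+1 < K)%N by apply: leq_trans mnK; rewrite ltnS ltnS leq_maxr.
have brkK x : (br x ^+ K)^-1 <= (br x ^+ k)^-1.
  by rewrite lef_pV2 ?posrE ?exprn_gt0// ler_weXn2l.
have s0 : 0 <= sn K phi := sn_ge0 _ _.
exists (sn K phi * 2 ^+ K); split=> [x|x h h1].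
  apply: (le_trans (schwartz_bound x sp (ltnW (ltnW mK)) (ltnW (ltnW nK)))).
  rewrite -mulrA ler_wpM2l// (le_trans (brkK x))// ler_peMl ?invr_ge0 ?exprn_ge0//.
  by rewrite exprn_ege1// ler1n.
apply: (le_trans (schwartz_taylor2 x h sp mK nK)).
rewrite ler_wpM2l ?sqr_ge0// ler_pM ?mulr_ge0 ?invr_ge0 ?exprn_ge0//.
by rewrite ler_wpM2l// lerXn2r ?nnegrE//; rewrite /br; lra.
Qed.

Lemma jet_dmix D : jet D -> forall m n x,
  [/\ differentiable (D m n) x, d1 (D m n) x = D m.+1 n x & d2 (D m n) x = D m n.+1 x].
Proof.
move=> jD m n x; have [C [C1 C2]] := jD m n 0%N.
have C0 : 0 <= C by have := C1 0; rewrite expr0 invr1 mulr1; apply: le_trans.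
apply: (@diff_taylor _ _ _ _ _ C) => h h1.
by apply: (le_trans (C2 x h h1)); rewrite expr0 invr1 mulr1 mulrC.
Qed.

Lemma jetE D : jet D -> forall m n, dmix m n (D 0%N 0%N) = D m n.
Proof.
move=> jD; have J := jet_dmix jD.
have E n : iter n d2 (D 0%N 0%N) = D 0%N n.
  by elim: n => //= n ->; apply/funext => x; case: (J 0%N n x).
by elim=> [|m IH] n /=; [exact: E|rewrite /dmix/= -/(dmix m n _) IH; apply/funext => x; case: (J m n x)].
Qed.

Lemma jet_schwartz D : jet D -> schwartz (D 0%N 0%N).
Proof.
move=> jD; split=> [m n x|k].
  by rewrite jetE//; case: (jet_dmix jD m n x).
pose C m n := sval (cid (jD m n k)).
have CP m n := svalP (cid (jD m n k)); rewrite -/(C _ _) in CP.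
have C0 m n : 0 <= C m n.
  have [/(_ 0) + _] := CP m n; rewrite /br /n1 !normr0 !addr0 expr1n invr1 mulr1.
  exact: le_trans.
apply: (@le_lt_trans _ _ (\sum_(m < k.+1) \sum_(n < k.+1) C m n)%:E); last exact: ltry.
apply: schwartz_norm_le => m n x mk nk; rewrite jetE//.
have [/(_ x) + _] := CP m n; move=> /le_trans; apply.
rewrite ler_wpM2r ?invr_ge0 ?exprn_ge0//.
rewrite (bigD1 (Ordinal (mk : (m < k.+1)%N)))//= (bigD1 (Ordinal (nk : (n < k.+1)%N)))//=.
by rewrite -addrA lerDl addr_ge0 ?sumr_ge0// => i _; rewrite sumr_ge0.
Qed.

End Jets.

(** * Closure properties of Schwartz functions, and decay of convolutions *)

Section Closure.
Variable R : realType.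
Implicit Types (f g phi : plane R -> R) (x y z h : plane R).

Lemma invbr_ge0 x k : 0 <= (br x ^+ k)^-1.
Proof. by rewrite invr_ge0 exprn_ge0. Qed.
Hint Resolve invbr_ge0 : core.

Lemma schwartz_dmix phi m n : schwartz phi -> schwartz (dmix m n phi).
Proof.
move=> sp; have := @jet_schwartz R (fun a b => dmix (a + m) (b + n) phi).
by apply=> a b k; exact: (schwartz_jet sp (a + m) (b + n) k).
Qed.

Lemma dmixD phi m n a b : schwartz phi ->
  dmix a b (dmix m n phi) = dmix (a + m) (b + n) phi.
Proof.
move=> sp; have := @jetE R (fun a b => dmix (a + m) (b + n) phi).
by apply=> i j k; exact: (schwartz_jet sp (i + m) (j + n) k).
Qed.

Lemma schwartz_continuous phi : schwartz phi -> continuous phi.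
Proof. by move=> [sm _] x; apply: differentiable_continuous; exact: (sm 0%N 0%N x). Qed.

Lemma schwartz_mfun2 phi : schwartz phi -> mfun2 phi.
Proof. by move=> /schwartz_continuous; exact: continuous_mfun2. Qed.

Lemma jet_reflect x phi : schwartz phi ->
  jet (fun m n y => (- 1) ^+ (m + n) * dmix m n phi (x - y)).
Proof.
move=> sp m n k; have [C [C1 C2]] := schwartz_jet sp m n k.
have C0 : 0 <= C.
  have := C1 0; rewrite /br /n1 !normr0 !addr0 expr1n invr1 mulr1.
  exact: le_trans.
have W y : (br (x - y) ^+ k)^-1 <= br x ^+ k * (br y ^+ k)^-1.
  apply: (le_trans (brV_le k _ (- y))); rewrite brN.
  by rewrite opprB addrA addNr add0r brN.
exists (C * br x ^+ k); split=> [y|y h h1].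
  rewrite normrM normrX normrN1 expr1n mul1r (le_trans (C1 _))//.
  by rewrite -mulrA ler_wpM2l.
have hN : n1 (- h) <= 1 by rewrite n1N.
have := C2 (x - y) (- h) hN; rewrite n1N.
have -> : x - y - h = x - (y + h) by rewrite opprD addrA.
move=> /le_trans H; rewrite (_ : _ - _ = (- 1) ^+ (m + n) *
   (dmix m n phi (x - (y + h)) - dmix m n phi (x - y)
    - (- h).1 * dmix m.+1 n phi (x - y) - (- h).2 * dmix m n.+1 phi (x - y))).
  rewrite normrM normrX normrN1 expr1n mul1r; apply: H.
  by rewrite ler_wpM2l ?sqr_ge0// -mulrA ler_wpM2l.
by rewrite addnS addSn !exprS /=; ring.
Qed.

Lemma schwartz_reflect x phi : schwartz phi -> schwartz (fun y => phi (x - y)).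
Proof.
move=> sp; have := jet_schwartz (jet_reflect x sp); rewrite /= expr0.
by under eq_fun do rewrite mul1r.
Qed.

Lemma dmix_reflect x phi m n : schwartz phi ->
  dmix m n (fun y => phi (x - y)) = fun y => (- 1) ^+ (m + n) * dmix m n phi (x - y).
Proof.
move=> sp; have := jetE (jet_reflect x sp) m n; rewrite /= expr0.
by under eq_fun do rewrite mul1r.
Qed.

Lemma jet_lin (c : R) D1 D2 : jet D1 -> jet D2 ->
  jet (fun m n (y : plane R) => c * D1 m n y + D2 m n y).
Proof.
move=> j1 j2 m n k; have [A [A1 A2]] := j1 m n k; have [B [B1 B2]] := j2 m n k.
exists (`|c| * A + B); split=> [y|y h h1].
  rewrite (le_trans (ler_normD _ _))// mulrDl lerD// normrM -mulrA.
  by rewrite ler_wpM2l.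
rewrite (_ : _ - _ = c * (D1 m n (y + h) - D1 m n y - h.1 * D1 m.+1 n y - h.2 * D1 m n.+1 y)
  + (D2 m n (y + h) - D2 m n y - h.1 * D2 m.+1 n y - h.2 * D2 m n.+1 y)); last by ring.
rewrite (le_trans (ler_normD _ _))// mulrDl mulrDr lerD//; last exact: B2.
rewrite normrM -(mulrA `|c|) (mulrCA _ `|c|) ler_wpM2l//; exact: A2.
Qed.

Lemma schwartz_lin (c : R) f g : schwartz f -> schwartz g ->
  schwartz (fun y => c * f y + g y).
Proof.
by move=> sf sg; exact: (jet_schwartz (jet_lin c (schwartz_jet sf) (schwartz_jet sg))).
Qed.

Lemma dmix_lin (c : R) f g m n : schwartz f -> schwartz g ->
  dmix m n (fun y => c * f y + g y) = fun y => c * dmix m n f y + dmix m n g y.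
Proof.
by move=> sf sg; exact: (jetE (jet_lin c (schwartz_jet sf) (schwartz_jet sg)) m n).
Qed.

Lemma schwartz0 : schwartz (fun _ : plane R => 0 : R).
Proof.
apply: (@jet_schwartz R (fun _ _ _ => 0)) => m n k; exists 0.
by split=> *; rewrite ?mulr0 ?subr0 normr0 mul0r ?mulr0.
Qed.

Lemma mfun2_reflect x f : mfun2 f -> mfun2 (fun y => f (x - y)).
Proof.
move=> mf; have := measurableT_comp mf (measurable_affine2 (- 1) (- 1) x).
rewrite (_ : f \o affine2 (- 1) (- 1) x = fun y => f (x - y))//.
by apply/funext => y; rewrite /= /affine2 !mulN1r; congr f; rewrite [RHS]surjective_pairing /= ![- _ + _]addrC.
Qed.

Lemma affine2_reflect x f : f \o affine2 (- 1) (- 1) x = fun y => f (x - y).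
Proof.
apply/funext => y; rewrite /= /affine2 !mulN1r; congr f.
by rewrite [RHS]surjective_pairing /= ![- _ + _]addrC.
Qed.

Lemma L1_reflect x f : L1 f -> L1 (fun y => f (x - y)).
Proof. by move=> Lf; rewrite -affine2_reflect; apply: L1_affine; rewrite ?oppr_eq0 ?oner_eq0. Qed.

Lemma I2_reflect x f : L1 f -> I2 (fun y => f (x - y)) = I2 f.
Proof.
move=> Lf; rewrite (@I2_affine _ (- 1) (- 1) x f) ?oppr_eq0 ?oner_eq0//.
by rewrite affine2_reflect normrN1 !mul1r.
Qed.

Definition W : R := I2 (@wt R).

Lemma W_ge0 : 0 <= W.
Proof. by apply: I2_ge0 => x; rewrite ltW// wt_gt0. Qed.

Lemma mfun2_br : mfun2 (@br R).
Proof.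
apply: measurable_funD => //; apply: measurable_funD;
  exact: measurableT_comp.
Qed.

Lemma mfun2M f g : mfun2 f -> mfun2 g -> mfun2 (fun x => f x * g x).
Proof. exact: measurable_funM. Qed.

Lemma mfun2D f g : mfun2 f -> mfun2 g -> mfun2 (fun x => f x + g x).
Proof. exact: measurable_funD. Qed.

Lemma mfun2B f g : mfun2 f -> mfun2 g -> mfun2 (fun x => f x - g x).
Proof. exact: measurable_funB. Qed.

Lemma mfun2Z (c : R) f : mfun2 f -> mfun2 (fun x => c * f x).
Proof. by move=> mf; apply: mfun2M => //; exact: measurable_cst. Qed.

(** The convolution of [f] with [g]; f_T is [cv f (psi T)]. *)
Definition cv f g x : R := I2 (fun y => f y * g (x - y)).

(** As br y <= br x br (x - y), the growth of f costs p powers of the decay of G and leaves br x ^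
    p; the remaining four powers make the integrand integrable. *)
Lemma cv_grow (p : nat) (A B : R) f G x : mfun2 f -> mfun2 G ->
  (forall y, `|f y| <= A * br y ^+ p) -> (forall y, `|G y| <= B * (br y ^+ (p + 4))^-1) ->
  L1 (fun y => f y * G (x - y)) /\ `|cv f G x| <= A * B * W * br x ^+ p.
Proof.
move=> mf mG fA GB.
have A0 : 0 <= A.
  have := fA 0; rewrite /br /n1 !normr0 !addr0 expr1n mulr1; exact: le_trans.
have B0 : 0 <= B.
  have := GB 0; rewrite /br /n1 !normr0 !addr0 expr1n invr1 mulr1; exact: le_trans.
have mp : mfun2 (fun y => f y * G (x - y)) by apply: mfun2M => //; exact: mfun2_reflect.
have Lw : L1 (fun y => A * B * br x ^+ p * wt (x - y)).
  by apply: L1Z; apply: L1_reflect; exact: L1_wt.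
have bd y : `|f y * G (x - y)| <= A * B * br x ^+ p * wt (x - y).
  rewrite normrM; apply: (le_trans (ler_pM _ _ (fA y) (GB (x - y)))) => //.
  rewrite mulrACA -[leRHS]mulrA ler_wpM2l ?mulr_ge0//.
  rewrite exprD invfM mulrA; apply: ler_pM; rewrite ?mulr_ge0 ?exprn_ge0//; last exact: brV4_wt.
  rewrite ler_pdivrMr ?exprn_gt0// -exprMn lerXn2r ?nnegrE ?mulr_ge0//.
  by rewrite -[y in leLHS](subKr x); apply: (le_trans (brD _ _)); rewrite brN.
split; first exact: L1_le mp Lw bd.
apply: (le_trans (normI2_le mp Lw bd)).
by rewrite I2Z ?I2_reflect ?/W; [rewrite -!mulrA (mulrC (br x ^+ p))|exact: L1_wt|apply: L1_reflect; exact: L1_wt].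
Qed.

(** Here f pays: k of its powers move the decay of G from x - y to x, and four are left for
    integrability. *)
Lemma cv_decay (k : nat) (A B : R) f G x : mfun2 f -> mfun2 G ->
  (forall y, `|f y| <= A * (br y ^+ (k + 4))^-1) -> (forall y, `|G y| <= B * (br y ^+ k)^-1) ->
  L1 (fun y => f y * G (x - y)) /\ `|cv f G x| <= A * B * W * (br x ^+ k)^-1.
Proof.
move=> mf mG fA GB.
have A0 : 0 <= A.
  have := fA 0; rewrite /br /n1 !normr0 !addr0 expr1n invr1 mulr1; exact: le_trans.
have B0 : 0 <= B.
  have := GB 0; rewrite /br /n1 !normr0 !addr0 expr1n invr1 mulr1; exact: le_trans.
have mp : mfun2 (fun y => f y * G (x - y)) by apply: mfun2M => //; exact: mfun2_reflect.
have Lw : L1 (fun y => A * B * (br x ^+ k)^-1 * wt y) by apply: L1Z; exact: L1_wt.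
have bd y : `|f y * G (x - y)| <= A * B * (br x ^+ k)^-1 * wt y.
  rewrite normrM; apply: (le_trans (ler_pM _ _ (fA y) (GB (x - y)))) => //.
  rewrite mulrACA -[leRHS]mulrA ler_wpM2l ?mulr_ge0//.
  rewrite exprD invfM mulrAC; apply: ler_pM; rewrite ?mulr_ge0//; last exact: brV4_wt.
  rewrite ler_pdivrMl ?exprn_gt0//.
  by apply: (le_trans (brV_le k _ x)); rewrite subKr.
split; first exact: L1_le mp Lw bd.
apply: (le_trans (normI2_le mp Lw bd)).
by rewrite I2Z ?/W; [rewrite -!mulrA (mulrC W)|exact: L1_wt].
Qed.

End Closure.

(** * Convolutions and tempered distributions *)

Section Convolution.
Variable R : realType.
Implicit Types (f g phi : plane R -> R) (x y z h : plane R).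

Definition grows f := mfun2 f /\ exists p A, forall y, `|f y| <= A * br y ^+ p.

Lemma grows_L1 f phi x : grows f -> schwartz phi -> L1 (fun y => f y * phi (x - y)).
Proof.
move=> [mf [p [A fA]]] sp.
have pB y : `|phi y| <= sn (p + 4) phi * (br y ^+ (p + 4))^-1.
  exact: (@schwartz_bound R phi (p + 4) 0 0 y sp).
by case: (cv_grow x mf (schwartz_mfun2 sp) fA pB).
Qed.

Lemma grows_L1M f phi : grows f -> schwartz phi -> L1 (fun y => f y * phi y).
Proof.
move=> gf sp; have := grows_L1 0 gf (schwartz_reflect 0 sp).
by under eq_fun do rewrite sub0r sub0r opprK.
Qed.

Lemma schwartz_grows phi : schwartz phi -> grows phi.
Proof.
move=> sp; split; first exact: schwartz_mfun2.
exists 0%N, (sn 0 phi) => y.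
by have := schwartz_bound y sp (leqnn 0) (leqnn 0); rewrite expr0 invr1.
Qed.

Definition taylor_rest phi m n h u : R :=
  dmix m n phi (u + h) - dmix m n phi u - h.1 * dmix m.+1 n phi u - h.2 * dmix m n.+1 phi u.

(** Convolution is linear in the kernel, so the Taylor rest of a convolution is the convolution with
    the Taylor rest. This takes the place of differentiation under the integral sign. *)
Lemma cv_taylor f phi m n x h : grows f -> schwartz phi ->
  cv f (dmix m n phi) (x + h) - cv f (dmix m n phi) x
   - h.1 * cv f (dmix m.+1 n phi) x - h.2 * cv f (dmix m n.+1 phi) x
  = cv f (taylor_rest phi m n h) x.
Proof.
move=> gf sp; rewrite /cv.
have L a b z : L1 (fun y => f y * dmix a b phi (z - y)).
  by apply: grows_L1 => //; exact: schwartz_dmix.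
have Z c a b z : L1 (fun y => c * (f y * dmix a b phi (z - y))) by exact: L1Z.
rewrite -(I2Z h.1 (L _ _ x)) -(I2Z h.2 (L _ _ x)) -(I2B (L _ _ _) (L _ _ _)).
rewrite -(I2B (L1B (L _ _ _) (L _ _ _)) (Z _ _ _ _)).
rewrite -(I2B (L1B (L1B (L _ _ _) (L _ _ _)) (Z _ _ _ _)) (Z _ _ _ _)).
by congr I2; apply/funext => y; rewrite /taylor_rest (addrAC x (- y)); ring.
Qed.

Lemma mfun2_shift h f : mfun2 f -> mfun2 (fun y => f (y + h)).
Proof.
move=> mf; have := mfun2_reflect (0 : plane R) (mfun2_reflect h mf).
by under eq_fun do rewrite sub0r opprK addrC.
Qed.

Lemma mfun2_taylor_rest phi m n h : schwartz phi -> mfun2 (taylor_rest phi m n h).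
Proof.
move=> sp; have M a b : mfun2 (dmix a b phi) by apply: schwartz_mfun2; exact: schwartz_dmix.
apply: mfun2B; [apply: mfun2B; [apply: mfun2B|]|].
- exact: mfun2_shift.
- exact: M.
- by apply: mfun2Z.
- by apply: mfun2Z.
Qed.

Lemma cv_diff f phi m n x : grows f -> schwartz phi ->
  [/\ differentiable (cv f (dmix m n phi)) x,
      d1 (cv f (dmix m n phi)) x = cv f (dmix m.+1 n phi) x &
      d2 (cv f (dmix m n phi)) x = cv f (dmix m n.+1 phi) x].
Proof.
move=> gf sp; have [mf [p [A fA]]] := gf.
have [C [_ C2]] := schwartz_jet sp m n (p + 4).
apply: (@diff_taylor _ _ _ _ _ (A * C * W R * br x ^+ p)) => h h1.
rewrite cv_taylor//.
have B u : `|taylor_rest phi m n h u| <= n1 h ^+ 2 * C * (br u ^+ (p + 4))^-1.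
  by rewrite -mulrA; exact: C2.
have [_] := cv_grow x mf (mfun2_taylor_rest m n h sp) fA B.
move=> /le_trans; apply; apply: le_of_eq; ring.
Qed.

Lemma cv_continuous f phi : grows f -> schwartz phi -> continuous (cv f phi).
Proof.
by move=> gf sp x; apply: differentiable_continuous; case: (cv_diff 0 0 x gf sp).
Qed.

Lemma jet_cv f phi : schwartz f -> schwartz phi -> jet (fun m n => cv f (dmix m n phi)).
Proof.
move=> sf sp m n k; have gf := schwartz_grows sf.
have [C [C1 C2]] := schwartz_jet sp m n k.
have fB y : `|f y| <= sn (k + 4) f * (br y ^+ (k + 4))^-1.
  exact: (@schwartz_bound R f (k + 4) 0 0 y sf).
exists (sn (k + 4) f * C * W R); split=> [x|x h h1].
  by have [] := cv_decay x (schwartz_mfun2 sf) (schwartz_mfun2 (schwartz_dmix m n sp)) fB C1.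
rewrite cv_taylor//.
have B u : `|taylor_rest phi m n h u| <= n1 h ^+ 2 * C * (br u ^+ k)^-1.
  by rewrite -mulrA; exact: C2.
have [_] := cv_decay x (schwartz_mfun2 sf) (mfun2_taylor_rest m n h sp) fB B.
move=> /le_trans; apply; apply: le_of_eq; ring.
Qed.

Lemma schwartz_cv f phi : schwartz f -> schwartz phi -> schwartz (cv f phi).
Proof.
move=> sf sp; have := jet_schwartz (jet_cv sf sp); cbv beta.
by rewrite -[dmix 0 0 phi]/phi.
Qed.

Lemma dmix_cv f phi m n : schwartz f -> schwartz phi ->
  dmix m n (cv f phi) = cv f (dmix m n phi).
Proof.
move=> sf sp; have := jetE (jet_cv sf sp) m n; cbv beta.
by rewrite -[dmix 0 0 phi]/phi.
Qed.

Lemma tempered_bound (g : functional R) : tempered g ->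
  exists (k : nat) (C : R), 0 <= C /\ forall phi, schwartz phi -> `|g phi| <= C * sn k phi.
Proof.
move=> [_ [k [C gC]]]; exists k, `|C|; split => // phi sp.
rewrite -lee_fin; apply: (le_trans (gC phi sp)).
by rewrite schwartz_normE// -EFinM lee_fin ler_wpM2r ?sn_ge0// ler_norm.
Qed.

Lemma temperedI (g : functional R) (k : nat) (C : R) :
  (forall c phi1 phi2, schwartz phi1 -> schwartz phi2 ->
     g (fun x => c * phi1 x + phi2 x) = c * g phi1 + g phi2) ->
  (forall phi, schwartz phi -> `|g phi| <= C * sn k phi) -> tempered g.
Proof.
move=> lg gC; split=> //; exists k, C => phi sp.
by rewrite schwartz_normE// -EFinM lee_fin gC.
Qed.

Lemma tempered_dist_of f : grows f -> tempered (dist_of f).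
Proof.
move=> gf; have [mf [p [A fA]]] := gf.
apply: (@temperedI _ (p + 4) (A * W R)) => [c f1 f2 s1 s2|phi sp].
  rewrite -[dist_of f f1]/(I2 (fun y => f y * f1 y)) -[dist_of f f2]/(I2 (fun y => f y * f2 y)).
  rewrite -(I2Z c (grows_L1M gf s1)) -(I2D (L1Z c (grows_L1M gf s1)) (grows_L1M gf s2)).
  by congr I2; apply/funext => y; ring.
have := schwartz_reflect 0 sp => sr.
have pB y : `|phi (0 - y)| <= sn (p + 4) phi * (br y ^+ (p + 4))^-1.
  by have := schwartz_bound (- y) sp (leq0n (p + 4)) (leq0n (p + 4)); rewrite brN sub0r.
have [_] := cv_grow 0 mf (schwartz_mfun2 sr) fA pB.
rewrite /br /n1 !normr0 !addr0 expr1n mulr1 mulrAC /cv.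
have -> : (fun y => f y * phi (0 - (0 - y))) = fun y => f y * phi y.
  by apply/funext => y; rewrite !sub0r opprK.
by [].
Qed.

Lemma tempered_d1 (g : functional R) : tempered g -> tempered (dist_d1 g).
Proof.
move=> tg; have [k [C [C0 gC]]] := tempered_bound tg.
apply: (@temperedI _ k.+1 C) => [c f1 f2 s1 s2|phi sp].
  rewrite /dist_d1 -[d1 (fun x => _)]/(dmix 1 0 (fun x => c * f1 x + f2 x)) dmix_lin//.
  rewrite tg.1; [|exact: (schwartz_dmix 1 0)..].
  by rewrite /dmix/=; ring.
rewrite /dist_d1 normrN; have sd := schwartz_dmix 1 0 sp.
apply: (le_trans (gC _ sd)); rewrite ler_wpM2l//.
rewrite -lee_fin -schwartz_normE//; apply: schwartz_norm_le => m n x mk nk.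
rewrite (dmixD 1 0 m n sp) addn1 addn0.
have mk1 : (m.+1 <= k.+1)%N by [].
apply: (le_trans (schwartz_bound x sp mk1 (leqW nk))).
by rewrite ler_wpM2l ?sn_ge0// lef_pV2 ?posrE ?exprn_gt0// ler_weXn2l.
Qed.

(** The two signs of the distributional derivatives cancel, and so do the two produced by
    differentiating y |-> phi (x - y). *)
Lemma dconv_d11 f phi : schwartz phi -> dconv (d11 f) phi = cv f (dmix 2 0 phi).
Proof.
move=> sp; apply/funext => x; rewrite /dconv /d11 /dist_d1 opprK.
rewrite -[d1 (d1 _)]/(dmix 2 0 (fun y => phi (x - y))) dmix_reflect//.
rewrite -[LHS]/(I2 _); congr I2; apply/funext => y.
by rewrite addn0 sqrrN expr1n mul1r.
Qed.

End Convolution.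

(** * Exchanging a distribution with an integral *)

Section Riemann.
Variable R : realType.
Implicit Types (f g phi : plane R -> R) (x y z h : plane R).

Variable N' : nat.
Let N := N'.+1.
(** Number of nodes per axis of the grid of mesh 1 / N on [-N, N): refining the mesh and exhausting
    the plane are governed by the same N. *)
Let K := (2 * N ^ 2)%N.
Let d : R := N%:R^-1.
Let nd (i : nat) : R := - N%:R + i%:R * d.

Definition rsum f : R := \sum_(i < K) \sum_(j < K) d ^+ 2 * f (nd i, nd j).

Let e (i : nat) (t : R) : R := ((nd i <= t) && (t < nd i + d))%R%:R.

Let d0 : 0 < d. Proof. by rewrite invr_gt0. Qed.
Let Nd : N%:R * d = 1. Proof. by rewrite mulfV ?pnatr_eq0. Qed.

Let cellP (t : R) : (exists i : 'I_K, nd i <= t < nd i + d) \/ N%:R <= `|t| /\ forall i : 'I_K, e i t = 0.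
Proof.
have [/andP[t1 t2]|H] := boolP (- N%:R <= t < N%:R); [left|right].
  have u0 : 0 <= (t + N%:R) * N%:R by rewrite mulr_ge0//; lra.
  pose i := Num.truncn ((t + N%:R) * N%:R).
  have /andP[i1 i2] := truncn_itv u0; rewrite -/i in i1 i2.
  have iK : (i < K)%N.
    rewrite -(ltr_nat R); apply: (le_lt_trans i1).
    rewrite /K natrM natrX expr2 mulrA ltr_pM2r ?ltr0n//; lra.
  exists (Ordinal iK); rewrite /nd /=.
  have E : t + N%:R = (t + N%:R) * N%:R * d by rewrite -mulrA Nd mulr1.
  have A : i%:R * d <= t + N%:R by rewrite E ler_pM2r.
  have B : t + N%:R < i.+1%:R * d by rewrite E ltr_pM2r.
  rewrite -natr1 mulrDl mul1r in B; apply/andP; split; lra.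
have H' : N%:R <= `|t|.
  move: H; rewrite negb_and -ltNge -leNgt => /orP[|] H.
    by rewrite ler_normr; apply/orP; right; lra.
  by rewrite ler_normr H.
split=> [//|i]; rewrite /e; case: (boolP (_ && _)) => [/andP[a b]|//]; exfalso.
move/negP : H; apply; apply/andP; split.
  by apply: le_trans a; rewrite /nd lerDl mulr_ge0// ltW.
apply: (lt_le_trans b); rewrite /nd -addrA -{2}(mul1r d) -mulrDl natr1.
have : i.+1%:R * d <= K%:R * d by rewrite ler_pM2r// ler_nat.
rewrite /K natrM natrX expr2 -!mulrA Nd mulr1; lra.
Qed.

Let cell_unique (t : R) (i j : nat) :
  nd i <= t < nd i + d -> nd j <= t < nd j + d -> i = j.
Proof.
move=> /andP[a b] /andP[a' b']; apply/eqP; rewrite eqn_leq; apply/andP; split.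
  rewrite -ltnS -(ltr_nat R) -natr1 -(ltr_pM2r d0); rewrite /nd in a b a' b'; lra.
rewrite -ltnS -(ltr_nat R) -natr1 -(ltr_pM2r d0); rewrite /nd in a b a' b'; lra.
Qed.

Let eE (t : R) (i j : 'I_K) : nd i <= t < nd i + d -> e j t = (j == i)%:R.
Proof.
move=> ti; rewrite /e; congr (nat_of_bool _)%:R; apply/idP/eqP => [tj|->//].
by apply/val_inj; exact: (cell_unique tj ti).
Qed.

Let step f x := \sum_(i < K) \sum_(j < K) f (nd i, nd j) * (e i x.1 * e j x.2).

Let cell (i j : nat) : set (measurableTypeR R * measurableTypeR R) :=
  (`[nd i, nd i + d[%classic : set (measurableTypeR R)) `*`
  (`[nd j, nd j + d[%classic : set (measurableTypeR R)).

Let eeE i j : (fun x : plane R => e i x.1 * e j x.2) = \1_(cell i j).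
Proof.
apply/funext => x; rewrite indicE /e -natrM mulnb; congr (nat_of_bool _)%:R.
by apply/idP/idP => [/andP[a b]|]; [rewrite inE; split; rewrite /= in_itv|
  rewrite inE => -[/=]; rewrite !in_itv/= => -> ->].
Qed.

Let mcell i j : measurable (cell i j).
Proof. by apply: measurableX; exact: measurable_itv. Qed.

Let mu_cell i j : mu2 R (cell i j) = (d ^+ 2)%:E.
Proof.
transitivity (mule (lebesgue_measure (`[nd i, nd i + d[%classic : set (measurableTypeR R)))
  (lebesgue_measure (`[nd j, nd j + d[%classic : set (measurableTypeR R)))).
  by apply: product_measure1E; exact: measurable_itv.
rewrite !lebesgue_measure_itv/= !lte_fin !ltrDl d0 -!EFinD -EFinM expr2.
by congr EFin; ring.
Qed.

Let L1_ee i j : L1 (fun x : plane R => e i x.1 * e j x.2).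
Proof.
have mI : measurable_fun setT (fun x : measurableTypeR R * measurableTypeR R =>
    ((\1_(cell i j) x : R)%:E)).
  by apply/measurable_EFinP; exact: measurable_indic.
rewrite eeE; apply/integrableP; split; first exact: mI.
rewrite (_ : (fun x => _) = fun x => (\1_(cell i j) x : R)%:E); last first.
  by apply/funext => t; rewrite gee0_abs// lee_fin.
apply: (le_lt_trans _ (ltry (d ^+ 2))); rewrite integral_indic// setIT.
by apply: le_of_eq; exact: mu_cell.
Qed.

Let I2_ee i j : I2 (fun x : plane R => e i x.1 * e j x.2) = d ^+ 2.
Proof.
rewrite eeE /I2 /Rintegral.
have -> : (\int[mu2 R]_x ((\1_(cell i j) x : R)%:E) = mu2 R (cell i j))%E.
  by rewrite integral_indic// setIT.
exact: (congr1 fine (mu_cell i j)).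
Qed.

Let L1_step f : L1 (step f).
Proof. by apply: L1_sum => i; apply: L1_sum => j; exact: L1Z. Qed.

Let I2_step f : I2 (step f) = rsum f.
Proof.
rewrite /step I2_sum; last by move=> i; apply: L1_sum => j; exact: L1Z.
apply: eq_bigr => i _; rewrite I2_sum; last by move=> j; exact: L1Z.
by apply: eq_bigr => j _; rewrite I2Z// I2_ee mulrC.
Qed.

(** The sum is the integral of a step function. Inside the square the pointwise error is the
    Lipschitz bound times the cell diameter 2 d; outside, the step function vanishes and br x >= N
    turns the fifth power of decay into a factor d. *)
Lemma riemann f (A : R) : mfun2 f ->
  (forall x, `|f x| <= A * (br x ^+ 5)^-1) ->
  (forall x z, n1 (z - x) <= 2 -> `|f z - f x| <= A * n1 (z - x) * (br x ^+ 4)^-1) ->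
  `|I2 f - rsum f| <= 2 * A * W R * d.
Proof.
move=> mf fA fL.
have A0 : 0 <= A.
  have := fA 0; rewrite /br /n1 !normr0 !addr0 expr1n invr1 mulr1; exact: le_trans.
have Lf : L1 f.
  apply: (@L1_dom _ A) => // x; apply: (le_trans (fA x)); rewrite ler_wpM2l//.
  apply: le_trans (brV4_wt x).
  by rewrite lef_pV2 ?posrE ?exprn_gt0// ler_weXn2l.
have d1 : d <= 1 by rewrite invf_le1// ler1n.
rewrite -I2_step -I2B//.
have -> : 2 * A * W R * d = I2 (fun x => 2 * A * d * wt x).
  by rewrite I2Z; [rewrite /W; ring|exact: L1_wt].
apply: normI2_le; [|by apply: L1Z; exact: L1_wt|].
  by apply: mfun2B => //; exact: (L1_measurable (L1_step f)).
move=> x.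
have out : (N%:R <= `|x.1| \/ N%:R <= `|x.2|) -> step f x = 0 -> `|f x - step f x| <= 2 * A * d * wt x.
  move=> Nx ->; rewrite subr0; apply: (le_trans (fA x)).
  have Nb : N%:R <= br x.
    rewrite /br /n1; have := normr_ge0 x.1; have := normr_ge0 x.2; case: Nx; lra.
  rewrite exprS invfM mulrA ler_pM ?mulr_ge0 ?invr_ge0 ?exprn_ge0 ?brV4_wt//.
  have : (br x)^-1 <= d by rewrite lef_pV2 ?posrE.
  have := ltW d0; nra.
have [[i xi]|[Nx e0]] := cellP x.1; last first.
  by apply: out; [left|rewrite /step !big1// => i _; rewrite big1// => j _; rewrite e0 mul0r mulr0].
have [[j xj]|[Nx e0]] := cellP x.2; last first.
  by apply: out; [right|rewrite /step !big1// => i' _; rewrite big1// => j _; rewrite e0 !mulr0].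
have -> : step f x = f (nd i, nd j).
  rewrite /step (bigD1 i)//= (bigD1 j)//= big1 => [|j' jj]; last first.
    by rewrite (eE j' xj) (negbTE jj) !mulr0.
  rewrite big1 => [|i' ii]; last first.
    by rewrite big1// => j' _; rewrite (eE i' xi) (negbTE ii) mul0r mulr0.
  by rewrite (eE i xi) (eE j xj) !eqxx !mulr1 !addr0.
set z := (nd i, nd j).
have zn : n1 (z - x) <= 2 * d.
  move: xi xj => /andP[a b] /andP[a' b'].
  rewrite /n1 /= !ler0_norm; lra.
have zn2 : n1 (z - x) <= 2 by lra.
rewrite distrC; apply: (le_trans (fL x z zn2)).
apply: ler_pM; rewrite ?mulr_ge0 ?invr_ge0 ?exprn_ge0 ?brV4_wt//.
rewrite (mulrC 2) -mulrA ler_wpM2l//.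
Qed.

(** As a weighted sum over a list, the Riemann sum is accessible to the induction of
    [reflect_sum]. *)
Lemma rsum_seq : exists s : seq (R * plane R),
  forall f, rsum f = \sum_(p <- s) p.1 * f p.2.
Proof.
exists [seq (d ^+ 2, (nd p.1, nd p.2)) | p : 'I_K * 'I_K] => f.
by rewrite /rsum pair_big/= big_map big_enum.
Qed.

End Riemann.

Section TameFunctions.
Variable R : realType.
Implicit Types (f g phi chi : plane R -> R) (x y z h : plane R).
#[local] Hint Extern 0 (is_true (_ <= (br _ ^+ _)^-1)) => solve [exact: invbr_ge0] : core.

(** One B controls both growth and local Lipschitz constant, so that quadrature errors are linear in
    B. The radius 2 covers a grid cell of mesh at most 1. *)
Definition tame (k : nat) (B : R) f : Prop :=
  (forall x, `|f x| <= B * br x ^+ k) /\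
  (forall x z, n1 (z - x) <= 2 -> `|f z - f x| <= B * n1 (z - x) * br x ^+ k).

Lemma tame_ge0 k B f : tame k B f -> 0 <= B.
Proof.
move=> [/(_ 0) + _]; rewrite /br /n1 !normr0 !addr0 expr1n mulr1; exact: le_trans.
Qed.

Lemma tame_continuous k B f : tame k B f -> continuous f.
Proof.
move=> tf x; have B0 := tame_ge0 tf; have [_ fL] := tf.
apply/cvgrPdist_le => e e0.
pose r := Num.min 1 (e / (2 * (B * br x ^+ k + 1))).
have D0 : 0 < B * br x ^+ k + 1 by rewrite ltr_wpDl// mulr_ge0// exprn_ge0.
have r0 : 0 < r by rewrite lt_min ltr01 divr_gt0// mulr_gt0.
have : \forall z \near x, `|x - z| < r.
  have /cvgrPdist_lt := @cvg_id (plane R) (nbhs x); exact.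
apply: filterS => z; rewrite distrC => zr; have := n1_norm (z - x).
have zr1 : `|z - x| < 1 by apply: lt_le_trans zr _; rewrite ge_min lexx.
have zr2 : `|z - x| < e / (2 * (B * br x ^+ k + 1)).
  by apply: lt_le_trans zr _; rewrite ge_min lexx orbT.
move=> nz; have n2 : n1 (z - x) <= 2 by lra.
rewrite distrC; apply: (le_trans (fL _ _ n2)).
rewrite ltr_pdivlMr ?mulr_gt0// in zr2.
have n0 := n1_ge0 (z - x); have := mulr_ge0 B0 (exprn_ge0 k (br_ge0 x)).
rewrite mulrAC; move: zr2; set Q := B * _; nra.
Qed.

Lemma tame_grows k B f : tame k B f -> grows f.
Proof.
move=> tf; split; first by apply: continuous_mfun2; exact: tame_continuous tf.
by exists k, B; exact: tf.1.
Qed.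

(** The constant c depends on f and k only. Uniformity in G is the point: G will be a derivative of
    phi (x - y) with a B that decays in y. *)
Lemma riemann_prod f k : schwartz f -> exists c : R, 0 <= c /\
  forall G B N, tame k B G ->
  `|I2 (fun x => f x * G x) - rsum N (fun x => f x * G x)| <= c * B * N.+1%:R^-1.
Proof.
(* k powers of the decay of f absorb the growth of G, and the others cover the fifth power that
   [riemann] asks for. *)
move=> sf; pose K := (k + 6)%N; pose P := sn K f.
have P0 : 0 <= P := sn_ge0 _ _.
pose Q := P * (3 ^+ K * 3 ^+ k + 1).
have Q0 : 0 <= Q by rewrite mulr_ge0// addr_ge0// mulr_ge0.
exists (2 * Q * W R); split; first by rewrite !mulr_ge0// W_ge0.
move=> G B N tG; have B0 := tame_ge0 tG; have [GB GL] := tG.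
have fB x : `|f x| <= P * (br x ^+ K)^-1.
  exact: (schwartz_bound x sf (leq0n K) (leq0n K)).
have decr x j : (j <= 6)%N -> br x ^+ k * (br x ^+ K)^-1 <= (br x ^+ j)^-1.
  move=> j6; rewrite /K exprD invfM mulrA divff ?gt_eqF ?exprn_gt0// mul1r.
  by rewrite lef_pV2 ?posrE ?exprn_gt0// ler_weXn2l.
have -> : 2 * Q * W R * B * N.+1%:R^-1 = 2 * (Q * B) * W R * N.+1%:R^-1 by ring.
apply: riemann.
- apply: mfun2M; first exact: schwartz_mfun2.
  by apply: continuous_mfun2; exact: tame_continuous tG.
- move=> x; rewrite normrM; apply: (le_trans (ler_pM _ _ (fB x) (GB x))) => //.
  rewrite [leLHS](_ : _ = P * B * (br x ^+ k * (br x ^+ K)^-1)); last by ring.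
  apply: ler_pM; rewrite ?mulr_ge0 ?exprn_ge0 ?invbr_ge0//; last exact: decr.
  by rewrite ler_wpM2r// /Q ler_peMr// lerDr mulr_ge0.
- move=> x z zx; set n := n1 (z - x).
  have n0 : 0 <= n := n1_ge0 _.
  have K1 : (0 < K)%N by rewrite /K addnS.
  have t1 : 0 <= (1 : R) <= 1 by rewrite ler01 lexx.
  have := schwartz_taylor1 x (z - x) sf K1 K1 t1.
  rewrite scale1r addrCA subrr addr0 -[dmix 0 0 f]/f -/n -/P => F1.
  have b3 : br (z - x) <= 3 by rewrite /br; lra.
  have bz : br z <= 3 * br x.
    by rewrite -[z](subrK x); apply: (le_trans (brD _ _)); rewrite ler_wpM2r.
  have G1 : `|G z| <= B * (3 ^+ k * br x ^+ k).
    by apply: (le_trans (GB z)); rewrite ler_wpM2l// -exprMn lerXn2r ?nnegrE ?mulr_ge0.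
  have F2 : `|f z - f x| <= n * (P * 3 ^+ K * (br x ^+ K)^-1).
    apply: (le_trans F1); rewrite ler_wpM2l// ler_wpM2r ?invbr_ge0// ler_wpM2l//.
    by rewrite lerXn2r ?nnegrE.
  rewrite (_ : _ - _ = (f z - f x) * G z + f x * (G z - G x)); last by ring.
  apply: (le_trans (ler_normD _ _)); rewrite !normrM.
  apply: (@le_trans _ _ (n * (P * 3 ^+ K * (br x ^+ K)^-1) * (B * (3 ^+ k * br x ^+ k))
     + P * (br x ^+ K)^-1 * (B * n * br x ^+ k))).
    by apply: lerD; apply: ler_pM => //; rewrite ?fB//; exact: GL.
  rewrite [leLHS](_ : _ = Q * B * n * (br x ^+ k * (br x ^+ K)^-1)); last by rewrite /Q; ring.
  by rewrite ler_wpM2l ?mulr_ge0//; exact: decr.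
Qed.

Lemma brV_reflect k x y : (br (x - y) ^+ k)^-1 <= br x ^+ k * (br y ^+ k)^-1.
Proof.
apply: (le_trans (brV_le k _ (- y))); rewrite brN.
by rewrite opprB addrA addNr add0r brN.
Qed.

(** The variable is x and y is a parameter in which B decays like br y ^- k; the quadrature error is
    thereby bounded in the Schwartz norm of index k in y. *)
Lemma schwartz_tame phi k m n y : schwartz phi -> (m <= k)%N -> (n <= k)%N ->
  tame k ((sn k phi + sn k.+1 phi * 3 ^+ k.+1) * (br y ^+ k)^-1)
    (fun x => (-1) ^+ (m + n) * dmix m n phi (x - y)).
Proof.
move=> sp mk nk.
have S0 : 0 <= sn k phi := sn_ge0 _ _; have S1 : 0 <= sn k.+1 phi := sn_ge0 _ _.
have W1 x : (br (x - y) ^+ k)^-1 <= (br y ^+ k)^-1 * br x ^+ k.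
  by rewrite mulrC; exact: brV_reflect.
split=> [x|x z zx].
  rewrite normrM normrX normrN1 expr1n mul1r (le_trans (schwartz_bound _ sp mk nk))//.
  rewrite -[leRHS]mulrA ler_pM ?W1// lerDl mulr_ge0// exprn_ge0//.
rewrite -mulrBr normrM normrX normrN1 expr1n mul1r.
have t1 : 0 <= (1 : R) <= 1 by rewrite ler01 lexx.
have mk1 : (m < k.+1)%N by []. have nk1 : (n < k.+1)%N by [].
have := schwartz_taylor1 (x - y) (z - x) sp mk1 nk1 t1.
rewrite scale1r (_ : x - y + (z - x) = z - y); last first.
  by rewrite addrC addrA subrK.
move=> /le_trans; apply.
rewrite [leRHS](_ : _ = n1 (z - x) * ((sn k phi + sn k.+1 phi * 3 ^+ k.+1) *
  ((br y ^+ k)^-1 * br x ^+ k))); last by ring.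
rewrite ler_wpM2l//.
have b3 : br (z - x) <= 3 by rewrite /br; lra.
have b0 : 0 <= sn k.+1 phi * br (z - x) ^+ k.+1 by rewrite mulr_ge0// exprn_ge0.
apply: ler_pM => //.
  apply: (@le_trans _ _ (sn k.+1 phi * 3 ^+ k.+1)).
    by rewrite ler_wpM2l// lerXn2r ?nnegrE.
  by rewrite lerDr.
apply: le_trans (W1 x).
by rewrite lef_pV2 ?posrE ?exprn_gt0// ler_weXn2l.
Qed.

End TameFunctions.

Section TemperedExchange.
Variable R : realType.
Implicit Types (f phi chi : plane R -> R) (x y z h : plane R) (g : functional R).

Lemma sn_le phi k (B : R) : schwartz phi ->
  (forall m n x, (m <= k)%N -> (n <= k)%N ->
    `|dmix m n phi x| <= B * (br x ^+ k)^-1) -> sn k phi <= B.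
Proof. by move=> sp H; rewrite -lee_fin -schwartz_normE//; exact: schwartz_norm_le. Qed.

Lemma tempered0 g : tempered g -> g (fun=> 0) = 0.
Proof.
move=> [lg _]; have := lg 1 _ _ (schwartz0 R) (schwartz0 R).
rewrite !mul1r addr0; set u := g _; move=> E; apply: (@addrI _ u); by rewrite addr0 -E.
Qed.

(** The exchange of g with a finite sum is plain linearity; [dconv_exchange] is its limit. *)
Lemma reflect_sum phi (s : seq (R * plane R)) : schwartz phi ->
  let S y := \sum_(p <- s) p.1 * phi (p.2 - y) in
  [/\ schwartz S,
      forall m n, dmix m n S = fun y => \sum_(p <- s) p.1 * ((- 1) ^+ (m + n) * dmix m n phi (p.2 - y)) &
      forall g, tempered g -> g S = \sum_(p <- s) p.1 * dconv g phi p.2].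
Proof.
move=> sp; elim: s => [|p s [IH1 IH2 IH3]] S.
  have -> : S = fun=> 0 by apply/funext => y; rewrite /S big_nil.
  split; first exact: schwartz0.
    move=> m n; apply/funext => y; rewrite big_nil.
    have := dmix_lin (- 1) m n (schwartz0 R) (schwartz0 R).
    rewrite mulr0 addr0 => -> ; ring.
  by move=> g tg; rewrite big_nil tempered0.
have -> : S = fun y => p.1 * phi (p.2 - y) + \sum_(p <- s) p.1 * phi (p.2 - y).
  by apply/funext => y; rewrite /S big_cons.
have sr := schwartz_reflect p.2 sp.
split; first exact: schwartz_lin.
  by move=> m n; rewrite dmix_lin// IH2 dmix_reflect//; apply/funext => y; rewrite big_cons.
by move=> g tg; rewrite tg.1// IH3// big_cons.
Qed.

Lemma dconv_tame g phi : tempered g -> schwartz phi -> exists k B, tame k B (dconv g phi).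
Proof.
move=> tg sp; have [k [C [C0 gC]]] := tempered_bound tg.
have S0 : 0 <= sn k phi := sn_ge0 _ _; have S1 : 0 <= sn k.+1 phi := sn_ge0 _ _.
pose B := sn k phi + sn k.+1 phi * 3 ^+ k.+1.
have B0 : 0 <= B by rewrite addr_ge0// mulr_ge0.
exists k, (C * B); split=> [x|x z zx].
  have sr := schwartz_reflect x sp.
  apply: (le_trans (gC _ sr)); rewrite -mulrA ler_wpM2l//.
  apply: sn_le => // m n y mk nk; rewrite dmix_reflect//.
  have [H _] := schwartz_tame y sp mk nk.
  by apply: (le_trans (H x)); rewrite mulrAC.
have srx := schwartz_reflect x sp; have srz := schwartz_reflect z sp.
have -> : dconv g phi z - dconv g phi x = g (fun y => - 1 * phi (x - y) + phi (z - y)).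
  by rewrite tg.1// mulN1r addrC.
have sl := schwartz_lin (- 1) srx srz.
apply: (le_trans (gC _ sl)); rewrite -!mulrA ler_wpM2l//.
apply: sn_le => // m n y mk nk; rewrite dmix_lin// !dmix_reflect//.
have [_ H] := schwartz_tame y sp mk nk.
have := H x z zx; rewrite mulN1r [in leLHS]addrC => /le_trans; apply.
by apply: le_of_eq; rewrite /B; ring.
Qed.

Lemma dconv_grows g phi : tempered g -> schwartz phi -> grows (dconv g phi).
Proof. by move=> tg sp; have [k [B /tame_grows]] := dconv_tame tg sp. Qed.

Lemma dconv_continuous g phi : tempered g -> schwartz phi -> continuous (dconv g phi).
Proof. by move=> tg sp; have [k [B /tame_continuous]] := dconv_tame tg sp. Qed.

Lemma schwartz_cv_reflect f phi : schwartz f -> schwartz phi ->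
  let T y := I2 (fun x => f x * phi (x - y)) in
  schwartz T /\ forall m n, dmix m n T =
    fun y => I2 (fun x => f x * ((- 1) ^+ (m + n) * dmix m n phi (x - y))).
Proof.
move=> sf sp T; have sr := schwartz_reflect 0 sp.
have TE : T = cv f (fun y => phi (0 - y)).
  by apply/funext => y; rewrite /T /cv; congr I2; apply/funext => x; rewrite sub0r opprB.
split; first by rewrite TE; exact: schwartz_cv.
move=> m n; rewrite TE dmix_cv// dmix_reflect//; apply/funext => y.
by rewrite /cv; congr I2; apply/funext => x; rewrite sub0r opprB.
Qed.

(* Both sides are limits of the same Riemann sums, as these converge in each
   Schwartz norm. *)
Lemma dconv_exchange g f phi : tempered g -> schwartz f -> schwartz phi ->
  I2 (fun x => f x * dconv g phi x) = g (fun y => I2 (fun x => f x * phi (x - y))).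
Proof.
move=> tg sf sp; set T := (X in _ = g X).
have [sT dT] := schwartz_cv_reflect sf sp; rewrite -/T in sT dT.
have [k [C [C0 gC]]] := tempered_bound tg.
have [l [B tG]] := dconv_tame tg sp.
have [c1 [c10 H1]] := riemann_prod l sf.
have [c2 [c20 H2]] := riemann_prod k sf.
pose B2 := sn k phi + sn k.+1 phi * 3 ^+ k.+1.
apply: subr0_eq; set X := (X in X = 0).
pose Q := c1 * B + C * (c2 * B2).
have key N : `|X| <= Q * N.+1%:R^-1.
  have [s sE] := rsum_seq R N.
  (* As a function of y, the Riemann sum of f x * phi (x - y) is a finite combination of reflected
     translates of phi, the weights being those of the grid times the values of f. *)
  have [sS dS gS] := reflect_sum [seq (p.1 * f p.2, p.2) | p <- s] sp.
  set S := fun y => _ in sS dS gS.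
  have gSE : g S = rsum N (fun x => f x * dconv g phi x).
    rewrite gS// big_map sE; apply: eq_bigr => p _; exact/esym/mulrA.
  have := H1 _ _ N tG; rewrite -gSE => h1.
  have sl := schwartz_lin (- 1) sT sS.
  have h2 : `|g S - g T| <= C * (c2 * B2 * N.+1%:R^-1).
    have -> : g S - g T = g (fun y => - 1 * T y + S y).
      by rewrite (tg.1 (- 1) T S sT sS) mulN1r addrC.
    apply: (le_trans (gC _ sl)); rewrite ler_wpM2l//.
    apply: sn_le => // m n y mk nk; rewrite dmix_lin// dT dS big_map.
    have := H2 _ _ N (schwartz_tame y sp mk nk); rewrite -/B2 sE distrC => h.
    rewrite mulN1r addrC (_ : \sum_(j <- s) _ = \sum_(p <- s) p.1 * (f p.2 * ((-1) ^+ (m + n) * dmix m n phi (p.2 - y)))).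
      by apply: (le_trans h); apply: le_of_eq; ring.
    by apply: eq_bigr => p _ /=; ring.
  rewrite /X -(subrKA (g S)) (le_trans (ler_normD _ _))// /Q mulrDl -mulrA lerD//.
  by rewrite mulrA.
  by rewrite -mulrA.
have Q0 : 0 <= Q by have := key 0%N; rewrite invr1 mulr1; apply: le_trans.
apply/eqP; rewrite -normr_le0; apply/ler_addgt0Pl => e e0; rewrite addr0.
have [N HN] : exists N : nat, Q / e < N.+1%:R.
  by exists (Num.truncn (Q / e)); exact: truncnS_gt.
apply: (le_trans (key N)); rewrite ler_pdivrMr// mulrC -ler_pdivrMr// ltW//.
Qed.

End TemperedExchange.

(** * Injectivity of the Fourier transform *)

Section Fourier.
Variable R : realType.
Implicit Types (f phi chi : plane R -> R) (x z h : plane R) (y : R).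

Local Notation Rm := (measurableTypeR R).
Local Notation mplane := (Rm * Rm)%type.
Let leb1 : {sigma_finite_measure set Rm -> \bar R} := @lebesgue_measure R.

Let e : R -> R := exponential_pdf 1.

Let e_ge0 k : 0 <= e k. Proof. exact: exponential_pdf_ge0. Qed.

(** The added 1 keeps the integrand non-negative, as required by the fundamental theorem of calculus
    on a half-line; it is subtracted again in [laplace_cos]. *)
Let lap (y k : R) : R := expR (- k) * (1 + cos (k * y)).

Let cont_cosM (y : R) : continuous (fun k : R => cos (k * y)).
Proof.
move=> k; apply: (@continuous_comp _ _ _ (fun k : R => k * y) cos).
  by apply: cvgMr_tmp; exact: cvg_id.
exact: continuous_cos.
Qed.

Let cont_expRN : continuous (fun k : R => expR (- k)).
Proof.
move=> k; apply: (@continuous_comp _ _ _ (fun k : R => - k) expR).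
  by apply: cvgN; exact: cvg_id.
exact: continuous_expR.
Qed.

Let cont_lap y : continuous (lap y).
Proof.
move=> k; apply: cvgM; first exact: cont_expRN.
by apply: cvgD; [exact: cvg_cst|exact: cont_cosM].
Qed.

(** The antiderivative of [lap y] that vanishes at infinity. *)
Let prim (y k : R) : R :=
  expR (- k) * ((y * sin (k * y) - cos (k * y)) / oneDsqr y - 1).

Let prim_derive y (k : R) : is_derive k (1 : R) (prim y) (lap y k).
Proof.
have o0 : oneDsqr y != 0 by rewrite gt_eqF// (lt_le_trans ltr01)// oneDsqr_ge1.
rewrite /prim; apply: is_derive_eq.
rewrite /GRing.scale /= /lap /oneDsqr in o0 *; field; exact: o0.
Qed.

Let prim_cvg y : prim y k @[k --> +oo] --> 0.
Proof.
pose M := `|y| + 2.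
have bd k : `|prim y k| <= M * expR (- k).
  rewrite /prim normrM (ger0_norm (expR_ge0 _)) mulrC ler_wpM2r ?expR_ge0//.
  apply: (le_trans (ler_normB _ _)); rewrite normr1 /M.
  suff : `|(y * sin (k * y) - cos (k * y)) / oneDsqr y| <= `|y| + 1 by lra.
  have o1 := oneDsqr_ge1 y.
  rewrite normrM normfV (ger0_norm (le_trans ler01 o1)).
  rewrite ler_pdivrMr ?(lt_le_trans ltr01)//.
  apply: (le_trans (ler_normB _ _)); rewrite normrM.
  have s1 : `|sin (k * y)| <= 1 by rewrite ler_norml sin_geN1 sin_le1.
  have c1 : `|cos (k * y)| <= 1 by rewrite ler_norml cos_geN1 cos_le1.
  have := normr_ge0 y; nra.
have cM : (fun k : R => M * expR (- k)) @ +oo --> (0 : R).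
  by rewrite -(mulr0 M); apply: cvgMl_tmp; exact: cvgr_expR.
apply: (@squeeze_cvgr _ _ _ _ (fun k => - (M * expR (- k))) (fun k => M * expR (- k))).
- by apply: nearW => k; rewrite -ler_norml.
- by rewrite -[X in _ --> X]oppr0; exact: cvgN.
- exact: cM.
Qed.

Let integral_lap y :
  (\int[leb1]_(k in `[0%R, +oo[) (lap y k)%:E = (1 + (oneDsqr y)^-1)%:E)%E.
Proof.
have H1 k : 0 <= k -> 0 <= lap y k.
  by move=> _; rewrite /lap mulr_ge0 ?expR_ge0.
have H2 : {within `[0, +oo[, continuous (lap y)}.
  by apply: continuous_subspaceT; exact: cont_lap.
have H3 k : 0 < k -> derivable (prim y) k 1 by case: (prim_derive y k).
have H4 : prim y k @[k --> 0^'+] --> prim y 0.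
  apply/cvg_at_right_filter/differentiable_continuous/derivable1_diffP.
  by case: (prim_derive y 0).
have H5 : {in `]0, +oo[, derive1 (prim y) =1 lap y}.
  by move=> k _; rewrite derive1E; exact: derive_val.
rewrite [LHS](ge0_continuous_FTC2y H1 H2 (prim_cvg y) H3 H4 H5).
rewrite /prim oppr0 expR0 mul0r sin0 cos0 mulr0 mul1r sub0r mulN1r.
by rewrite -EFinB; congr EFin; ring.
Qed.

Let integral_e_lap y : (\int[leb1]_k (e k * (1 + cos (k * y)))%:E = (1 + (oneDsqr y)^-1)%:E)%E.
Proof.
rewrite -integral_lap [RHS]integral_mkcond; apply: eq_integral => k _.
rewrite /e /exponential_pdf patchE [in RHS]patchE.
by case: ifPn => _; rewrite /= ?mul0r// mulN1r mul1r.
Qed.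

Let L1e : leb1.-integrable setT (EFin \o e).
Proof. exact: integrable_exponential_pdf. Qed.

Let me : measurable_fun (setT : set Rm) e.
Proof. exact: measurable_exponential_pdf. Qed.

Let mcosM y : measurable_fun (setT : set Rm) (fun k : R => cos (k * y)).
Proof. by apply: continuous_measurable_fun; exact: cont_cosM. Qed.

Let L1ecos y : leb1.-integrable setT (fun k => (e k * cos (k * y))%:E).
Proof.
apply: le_integrable L1e => //.
  by apply/measurable_EFinP; apply: measurable_funM; [exact: me|exact: mcosM].
move=> k _ /=; rewrite lee_fin normrM ler_piMr// ler_norml cos_le1 andbT.
exact: cos_geN1.
Qed.

Lemma laplace_cos y : (\int[leb1]_k (e k * cos (k * y))%:E = ((oneDsqr y)^-1)%:E)%E.
Proof.
have E1 : (\int[leb1]_k (e k)%:E = 1)%E by exact: integral_exponential_pdf.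
have E2 : (\int[leb1]_k (e k * (1 + cos (k * y)))%:E
    = \int[leb1]_k (e k)%:E + \int[leb1]_k (e k * cos (k * y))%:E)%E.
  rewrite -(integralD measurableT L1e (L1ecos y)).
  by apply: eq_integral => k _; rewrite /= -EFinD; congr EFin; ring.
have /fineK E3 : (\int[leb1]_k (e k * cos (k * y))%:E)%E \is a fin_num.
  exact: (integrable_fin_num measurableT (L1ecos y)).
move: E2; rewrite integral_e_lap E1 -E3 -EFinD => -[E].
by congr EFin; lra.
Qed.

(** Average the vanishing cosine integrals over k with density e^-k and exchange the integrals: the
    inner one is then the Laplace transform [laplace_cos]. Fubini applies because e^-k |f x| is
    integrable in (k, x). *)
Lemma poisson_vanish f (c : plane R -> R) : L1 f -> mfun2 c ->
  (forall k, I2 (fun x => f x * cos (k * c x)) = 0) ->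
  I2 (fun x => f x * (oneDsqr (c x))^-1) = 0.
Proof.
move=> Lf mc H.
have mf := L1_measurable Lf.
have mcos k : mfun2 (fun x => cos (k * c x)).
  apply: (measurableT_comp (f := cos)).
    exact: (continuous_measurable_fun (@continuous_cos R)).
  exact: mfun2Z.
have Lfc k : L1 (fun x => f x * cos (k * c x)).
  apply: (@L1_le _ _ (fun x => `|f x|)); [exact: mfun2M|exact: L1_norm|].
  by move=> x; rewrite normrM ler_piMr// ler_norml cos_le1 cos_geN1.
pose F (p : Rm * mplane) : R := e p.1 * (f p.2 * cos (p.1 * c p.2)).
pose F0 (p : Rm * mplane) : R := e p.1 * f p.2.
have me1 : measurable_fun setT (fun p : Rm * mplane => e p.1).
  exact: (measurableT_comp me measurable_fst).
have mf2 : measurable_fun setT (fun p : Rm * mplane => f p.2).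
  exact: (measurableT_comp mf measurable_snd).
have mF : measurable_fun setT (EFin \o F).
  apply/measurable_EFinP; apply: measurable_funM; first exact: me1.
  apply: measurable_funM; first exact: mf2.
  apply: (measurableT_comp (f := cos)).
    exact: (continuous_measurable_fun (@continuous_cos R)).
  apply: measurable_funM; first exact: measurable_fst.
  exact: (measurableT_comp mc measurable_snd).
have mF0 : measurable_fun setT (EFin \o F0).
  by apply/measurable_EFinP; apply: measurable_funM; [exact: me1|exact: mf2].
have mabsf : measurable_fun setT (fun x : mplane => `|(f x)%:E|%E).
  by apply: measurableT_comp => //; apply/measurable_EFinP; exact: mf.
have LF0 : (leb1 \x mu2 R)%E.-integrable setT (EFin \o F0).
  apply/(integrable12ltyP leb1 (mu2 R) mF0).
  have /integrableP[_ aoo] := Lf.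
  have inner (k : R) : (\int[mu2 R]_x `|(EFin \o F0) (k, x)| =
      (e k)%:E * \int[mu2 R]_x `|(f x)%:E|)%E.
    rewrite -ge0_integralZl//= ?lee_fin//.
    by apply: eq_integral => x _; rewrite /F0 /= -EFinM normrM ger0_norm.
  under eq_integral do rewrite inner.
  have fa : (\int[mu2 R]_x `|(f x)%:E|)%E \is a fin_num.
    by rewrite ge0_fin_numE//; exact: integral_ge0.
  rewrite -(fineK fa); set A := fine _.
  have A0 : (0 <= A%:E)%E by rewrite lee_fin fine_ge0// integral_ge0.
  under eq_integral do rewrite muleC.
  have mEe : measurable_fun setT (fun k : Rm => (e k)%:E).
    by apply/measurable_EFinP; exact: me.
  have -> : (\int[leb1]_k (A%:E * (e k)%:E) = A%:E * \int[leb1]_k (e k)%:E)%E.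
    by apply: ge0_integralZl => //; move=> k _; rewrite lee_fin.
  have -> : (\int[leb1]_k (e k)%:E = 1)%E by exact: integral_exponential_pdf.
  by rewrite mule1 ltry.
have LF : (leb1 \x mu2 R)%E.-integrable setT (EFin \o F).
  apply: le_integrable LF0 => //.
  move=> [k x] _; rewrite /= lee_fin /F /F0 /= !normrM ler_wpM2l// ler_piMr//.
  by rewrite ler_norml cos_le1 cos_geN1.
have FE := Fubini LF.
have lhs (k : R) : (\int[mu2 R]_x (EFin \o F) (k, x) = 0)%E.
  rewrite (_ : (fun x => _) = fun x => (e k)%:E * (f x * cos (k * c x))%:E)%E; last first.
    by apply/funext => x.
  rewrite integralZl//; last exact: Lfc.
  have /fineK <- := integrable_fin_num measurableT (Lfc k).
  by have := H k; rewrite /I2 /Rintegral => ->; rewrite mule0.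
have rhs x : (\int[leb1]_k (EFin \o F) (k, x) = (f x * (oneDsqr (c x))^-1)%:E)%E.
  rewrite (_ : (fun k => _) = fun k => (f x)%:E * (e k * cos (k * c x))%:E)%E; last first.
    by apply/funext => k; rewrite -EFinM; congr EFin; rewrite /F /=; ring.
  by rewrite integralZl// laplace_cos.
move: FE; under eq_integral do rewrite lhs; rewrite integral0.
under eq_integral do rewrite rhs.
by rewrite /I2 /Rintegral => <-.
Qed.

Lemma mfun2_cos (p q r : R) : mfun2 (fun x => cos (p * x.1 + q * x.2 + r)).
Proof.
apply: (measurableT_comp (f := cos)).
  exact: (continuous_measurable_fun (@continuous_cos R)).
by apply: measurable_funD => //; apply: measurable_funD; apply: mfun2Z;
  [exact: measurable_fst|exact: measurable_snd].
Qed.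

Lemma L1_cos f (p q r : R) : L1 f -> L1 (fun x => f x * cos (p * x.1 + q * x.2 + r)).
Proof.
move=> Lf; apply: (@L1_le _ _ (fun x => `|f x|)); last 1 first.
- by move=> x; rewrite normrM ler_piMr// ler_norml cos_le1 cos_geN1.
- by apply: mfun2M; [exact: L1_measurable|exact: mfun2_cos].
- exact: L1_norm.
Qed.

Lemma L1_sin f (p q : R) : L1 f -> L1 (fun x => f x * sin (p * x.1 + q * x.2)).
Proof.
move=> /(L1_cos p q (- (pi / 2))); under eq_fun do rewrite -sinDpihalf subrK.
exact.
Qed.

(* Testing against e^(-k - l) cos(k (x_1 - z_1)) cos(l (x_2 - z_2)) over k, l > 0
   turns the vanishing of the Fourier transform into that of all Poisson
   averages of f, at every scale. *)
Lemma fourier_vanish f (C : R) : continuous f -> (forall x, `|f x| <= C * wt x) ->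
  has_real_fourier f (fun=> 0) -> f = fun=> 0.
Proof.
move=> cf fC H; have mf := continuous_mfun2 cf; have Lf := L1_dom mf fC.
have shifted p q z : I2 (fun x => f x * cos (p * (x.1 - z.1) + q * (x.2 - z.2))) = 0.
  set a := p * z.1 + q * z.2.
  have E : (fun x => f x * cos (p * (x.1 - z.1) + q * (x.2 - z.2))) =
    (fun x => cos a * (f x * cos (p * x.1 + q * x.2 + 0)) + sin a * (f x * sin (p * x.1 + q * x.2))).
    apply/funext => x.
    rewrite (_ : p * (x.1 - z.1) + q * (x.2 - z.2) = (p * x.1 + q * x.2) - a).
      by rewrite addr0 cosB; ring.
    by rewrite /a; ring.
  rewrite E I2D; [|by apply: L1Z; exact: L1_cos|by apply: L1Z; exact: L1_sin].
  rewrite !I2Z; [|exact: L1_sin|exact: L1_cos].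
  have [H1 H2] := H (p, q); rewrite /= in H1 H2.
  under eq_fun do rewrite addr0.
  by rewrite -[I2 (fun x => f x * cos _)]/(\int[leb2]_(x in setT) _) H1
     -[I2 (fun x => f x * sin _)]/(\int[leb2]_(x in setT) _) H2 !mulr0 addr0.
have mc1 z (p : R) : mfun2 (fun x => p * (x.1 - z.1)).
  by apply: mfun2Z; apply: mfun2B; [exact: measurable_fst|exact: measurable_cst].
have mc2 z (p : R) : mfun2 (fun x => p * (x.2 - z.2)).
  by apply: mfun2Z; apply: mfun2B; [exact: measurable_snd|exact: measurable_cst].
have prod p q z : I2 (fun x => f x * cos (q * (x.2 - z.2)) * cos (p * (x.1 - z.1))) = 0.
  have E : (fun x => f x * cos (q * (x.2 - z.2)) * cos (p * (x.1 - z.1))) =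
    (fun x => 2^-1 * (f x * cos (p * (x.1 - z.1) + q * (x.2 - z.2))) +
      2^-1 * (f x * cos (p * (x.1 - z.1) + (- q) * (x.2 - z.2)))).
    by apply/funext => x; rewrite mulNr cosB cosD; field.
  have L p' q' : L1 (fun x => f x * cos (p' * (x.1 - z.1) + q' * (x.2 - z.2))).
    have := L1_cos p' q' (- (p' * z.1 + q' * z.2)) Lf.
    rewrite (_ : (fun x => _) = fun x => f x * cos (p' * (x.1 - z.1) + q' * (x.2 - z.2)))//.
    by apply/funext => x; congr (_ * cos _); ring.
  by rewrite E I2D; [rewrite !I2Z// !shifted !mulr0 addr0|exact: L1Z..].
have Lfg g : mfun2 g -> (forall x, `|g x| <= 1) -> L1 (fun x => f x * g x).
  move=> mg g1; apply: (@L1_le _ _ (fun x => `|f x|)); [exact: mfun2M|exact: L1_norm|].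
  by move=> x; rewrite normrM ler_piMr.
have o1 (t : R) : `|(oneDsqr t)^-1| <= 1.
  have o1 := oneDsqr_ge1 t.
  by rewrite ger0_norm ?invr_ge0 ?(le_trans ler01)// invf_le1// (lt_le_trans ltr01).
have mo c : mfun2 c -> mfun2 (fun x => (oneDsqr (c x))^-1).
  move=> mc; apply: (measurableT_comp (f := fun t : R => (oneDsqr t)^-1)) => //.
  exact: (continuous_measurable_fun (@continuous_oneDsqrV R)).
have mcos c : mfun2 c -> mfun2 (fun x => cos (c x)).
  move=> mc; apply: (measurableT_comp (f := cos)) => //.
  exact: (continuous_measurable_fun (@continuous_cos R)).
(* [poisson_vanish] is used once for each variable, with the factor belonging to the other variable
   counted as part of f. *)
have kern z (s : R) : I2 (fun x => f x * (oneDsqr (s * (x.1 - z.1)))^-1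
    * (oneDsqr (s * (x.2 - z.2)))^-1) = 0.
  apply: poisson_vanish; [|exact: mc2|move=> q].
    by apply: Lfg => //; apply: mo; exact: mc1.
  under eq_fun do rewrite mulrAC.
  apply: (@poisson_vanish (fun x => f x * cos (q * (s * (x.2 - z.2)))) (fun x => s * (x.1 - z.1))).
  - apply: Lfg; first by apply: mcos; apply: mfun2Z; exact: mc2.
    by move=> x; rewrite ler_norml cos_le1 cos_geN1.
  - exact: mc1.
  - by move=> p; under eq_fun do rewrite !mulrA; exact: prod.
(* The substitution x = z + y / (n + 1) makes the kernel the fixed weight [wt] and concentrates f at
   z. *)
have scaled z (n : nat) : I2 (fun x => f (affine2 n.+1%:R^-1 n.+1%:R^-1 z x) * wt x) = 0.
  set d : R := n.+1%:R^-1; have d0 : d != 0 by rewrite invr_eq0 pnatr_eq0.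
  have := kern z n.+1%:R; rewrite (@I2_affine _ d d z)//; last first.
    under eq_fun do rewrite -mulrA; apply: Lfg.
      by apply: mfun2M; apply: mo; [exact: mc1|exact: mc2].
    by move=> x; rewrite normrM mulr_ile1.
  move=> /eqP; rewrite !mulf_eq0 !normr_eq0 (negbTE d0) /= => /eqP E.
  rewrite -[RHS]E; congr I2; apply/funext => x; rewrite /= /wt -mulrA.
  by congr (_ * ((oneDsqr _)^-1 * (oneDsqr _)^-1)); rewrite addrK mulrA mulfV ?mul1r// pnatr_eq0.
apply/funext => z.
have C0 : 0 <= C.
  by have := le_trans (normr_ge0 _) (fC 0); rewrite pmulr_lge0// wt_gt0.
have wt1 x : wt x <= 1.
  by apply: le_trans (ler_norm _) _; rewrite /wt normrM mulr_ile1 ?o1.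
have maff n : mfun2 (fun x => f (affine2 n.+1%:R^-1 n.+1%:R^-1 z x) * wt x).
  apply: mfun2M; last exact: measurable_wt.
  exact: (measurableT_comp mf (measurable_affine2 _ _ z)).
have bound n x : `|f (affine2 n.+1%:R^-1 n.+1%:R^-1 z x) * wt x| <= C * wt x.
  rewrite normrM (ger0_norm (ltW (wt_gt0 x))) ler_wpM2r// ?(ltW (wt_gt0 _))//.
  by apply: (le_trans (fC _)); rewrite ler_piMr.
have cvgf x : f (affine2 n.+1%:R^-1 n.+1%:R^-1 z x) * wt x @[n --> \oo] --> f z * wt x.
  have c (t u : R) : n.+1%:R^-1 * t + u @[n --> \oo] --> u.
    rewrite -[X in _ --> X]add0r -(mul0r t); apply: cvgD; last exact: cvg_cst.
    by apply: cvgMr_tmp; exact: cvg_harmonic.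
  have cz : affine2 n.+1%:R^-1 n.+1%:R^-1 z x @[n --> \oo] --> (z.1, z.2).
    exact: (cvg_pair (c x.1 z.1) (c x.2 z.2)).
  rewrite -surjective_pairing in cz.
  by apply: cvgMr_tmp; exact: (cvg_comp _ _ cz (cf z)).
(* By dominated convergence the vanishing averages tend to f z times the integral of [wt], which is
   pi^2. *)
have [_] := I2_cvg maff (L1Z C (@L1_wt R)) bound cvgf.
under eq_fun do rewrite scaled.
move=> /(cvg_lim (@Rhausdorff R)); rewrite lim_cst//.
have pi0 : (pi : R) != 0 by rewrite gt_eqF// pi_gt0.
rewrite I2Z ?I2_wt; last exact: L1_wt.
by move=> /esym/eqP; rewrite !mulf_eq0 (negbTE pi0) !orbF => /eqP.
Qed.

Lemma fourier_inj f1 f2 fhat : schwartz f1 -> schwartz f2 ->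
  has_real_fourier f1 fhat -> has_real_fourier f2 fhat -> f1 = f2.
Proof.
move=> s1 s2 h1 h2.
have L1s f : schwartz f -> L1 f.
  move=> sf; apply: (@L1_dom _ (sn 4 f)); first exact: schwartz_mfun2.
  move=> x; apply: (le_trans (schwartz_bound x sf (leq0n 4) (leq0n 4))).
  by rewrite ler_wpM2l ?sn_ge0// brV4_wt.
have sd : schwartz (fun x => - 1 * f2 x + f1 x) by exact: schwartz_lin.
suff : (fun x => - 1 * f2 x + f1 x) = fun=> 0.
  by move=> E; apply/funext => x; have := congr1 (@^~ x) E; lra.
apply: (@fourier_vanish _ (sn 4 (fun x => - 1 * f2 x + f1 x))).
- exact: schwartz_continuous.
- move=> x; apply: (le_trans (schwartz_bound x sd (leq0n 4) (leq0n 4))).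
  by rewrite ler_wpM2l ?sn_ge0// brV4_wt.
move=> k; have [a1 b1] := h1 k; have [a2 b2] := h2 k.
split.
  rewrite -[LHS]/(I2 _) (_ : (fun x => _) = fun x =>
    f1 x * cos (k.1 * x.1 + k.2 * x.2 + 0) - f2 x * cos (k.1 * x.1 + k.2 * x.2 + 0)); last first.
    by apply/funext => x; rewrite addr0; ring.
  rewrite I2B; [|by apply: L1_cos; exact: L1s..].
  under eq_fun do rewrite addr0. under [X in _ - I2 X]eq_fun do rewrite addr0.
  by rewrite -[I2 _]/(\int[leb2]_(x in setT) _) a1 -[I2 _]/(\int[leb2]_(x in setT) _) a2 subrr.
rewrite -[LHS]/(I2 _) (_ : (fun x => _) = fun x =>
  f1 x * sin (k.1 * x.1 + k.2 * x.2) - f2 x * sin (k.1 * x.1 + k.2 * x.2)); last first.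
  by apply/funext => x; ring.
rewrite I2B; [|by apply: L1_sin; exact: L1s..].
by rewrite -[I2 _]/(\int[leb2]_(x in setT) _) b1 -[I2 _]/(\int[leb2]_(x in setT) _) b2 subrr.
Qed.

End Fourier.

(** * The semigroup psi *)

Section Kernel.
Variable R : realType.
Implicit Types (f phi chi : plane R -> R) (x y z h : plane R).
#[local] Hint Extern 0 (is_true (_ <= (br _ ^+ _)^-1)) => solve [exact: invbr_ge0] : core.

Definition scale2 (a b : R) x : plane R := (a * x.1, b * x.2).

Lemma scale2D a b x h : scale2 a b (x + h) = scale2 a b x + scale2 a b h.
Proof. by rewrite /scale2 /= !mulrDr. Qed.

Lemma affine2_scale2 a b : affine2 a b 0 = scale2 a b.
Proof. by apply/funext => x; rewrite /affine2 /scale2 /= !addr0. Qed.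

Lemma n1_scale2 a b x (c : R) : 0 <= a <= c -> 0 <= b <= c -> n1 (scale2 a b x) <= c * n1 x.
Proof.
move=> /andP[a0 ac] /andP[b0 bc]; rewrite /n1 /= !normrM mulrDr (ger0_norm a0) (ger0_norm b0).
by apply: lerD; apply: ler_wpM2r.
Qed.

(** Only membership in the Schwartz class and the chain rule are extracted from this, so the
    constants may depend on a and b in any way. *)
Lemma jet_scale2 a b phi : 0 < a -> 0 < b -> schwartz phi ->
  jet (fun m n x => a ^+ m * b ^+ n * dmix m n phi (scale2 a b x)).
Proof.
move=> a0 b0 sp m n k.
pose K := (k + (m + n).+2)%N.
have kK : (k <= K)%N by exact: leq_addr.
have mK : (m.+1 < K)%N by rewrite /K addnC ltn_addr// !ltnS leq_addr.
have nK : (n.+1 < K)%N by rewrite /K addnC ltn_addr// !ltnS leq_addl.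
pose c := a + b; pose q := 1 + a^-1 + b^-1.
have c0 : 0 <= c by rewrite addr_ge0// ltW.
have q0 : 0 <= q by rewrite !addr_ge0// invr_ge0 ltW.
have ac : 0 <= a <= c by rewrite ltW//= lerDl ltW.
have bc : 0 <= b <= c by rewrite ltW//= lerDr ltW.
have brs x : br x <= q * br (scale2 a b x).
  rewrite /br /n1 /scale2 /= !normrM (gtr0_norm a0) (gtr0_norm b0).
  have -> : q * (1 + (a * `|x.1| + b * `|x.2|)) = q + `|x.1| * (a * q) + `|x.2| * (b * q) by ring.
  have aq : 1 <= a * q.
    by rewrite /q !mulrDr mulfV ?gt_eqF// mulr1 (addrC a) -addrA lerDl addr_ge0 ?mulr_ge0 ?invr_ge0 ?ltW.
  have bq : 1 <= b * q.
    by rewrite /q !mulrDr mulfV ?gt_eqF// mulr1 addrC lerDl addr_ge0 ?mulr_ge0 ?invr_ge0 ?ltW.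
  have q1 : 1 <= q by rewrite /q -addrA lerDl addr_ge0 ?invr_ge0 ?ltW.
  have := normr_ge0 x.1; have := normr_ge0 x.2; nra.
have brsV x : (br (scale2 a b x) ^+ K)^-1 <= q ^+ K * (br x ^+ k)^-1.
  apply: (@le_trans _ _ (q ^+ K * (br x ^+ K)^-1)).
    rewrite ler_pdivlMr ?exprn_gt0// ler_pdivrMl ?exprn_gt0// mulrC -exprMn.
    by rewrite lerXn2r ?nnegrE ?mulr_ge0.
  rewrite ler_wpM2l ?exprn_ge0//.
  by rewrite lef_pV2 ?posrE ?exprn_gt0// ler_weXn2l.
pose s := sn K phi; have s0 : 0 <= s := sn_ge0 _ _.
pose A := a ^+ m * b ^+ n; have A0 : 0 <= A by apply: mulr_ge0; rewrite exprn_ge0// ltW.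
exists (A * s * q ^+ K * ((1 + c) ^+ K * c ^+ 2 + 1)).
have Q0 : 0 <= A * s * q ^+ K := mulr_ge0 (mulr_ge0 A0 s0) (exprn_ge0 K q0).
have c1 : 0 <= 1 + c by rewrite addr_ge0.
have cK : 0 <= (1 + c) ^+ K * c ^+ 2 by rewrite mulr_ge0 ?exprn_ge0.
split=> [x|x h h1].
  rewrite normrM (ger0_norm A0).
  apply: (@le_trans _ _ (A * (s * (q ^+ K * (br x ^+ k)^-1)))).
    rewrite ler_wpM2l//; apply: (le_trans (schwartz_bound _ sp (ltnW (ltnW mK)) (ltnW (ltnW nK)))).
    by rewrite ler_wpM2l.
  rewrite [leLHS](_ : _ = A * s * q ^+ K * 1 * (br x ^+ k)^-1); last by ring.
  by apply: ler_wpM2r => //; apply: ler_wpM2l => //; rewrite lerDr.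
rewrite scale2D (_ : _ - _ = A * (dmix m n phi (scale2 a b x + scale2 a b h) -
    dmix m n phi (scale2 a b x) - (scale2 a b h).1 * dmix m.+1 n phi (scale2 a b x)
    - (scale2 a b h).2 * dmix m n.+1 phi (scale2 a b x))); last first.
  by rewrite /A !exprS /=; ring.
rewrite normrM (ger0_norm A0).
apply: (@le_trans _ _ (A * ((c * n1 h) ^+ 2 * (s * (1 + c) ^+ K * (q ^+ K * (br x ^+ k)^-1))))).
  rewrite ler_wpM2l//; apply: (le_trans (schwartz_taylor2 _ _ sp mK nK)).
  have nh := n1_scale2 h ac bc.
  have bh : br (scale2 a b h) <= 1 + c.
    by rewrite /br lerD2l; apply: (le_trans nh); exact: ler_piMr.
  apply: ler_pM; rewrite ?sqr_ge0//.
  - by rewrite !mulr_ge0// exprn_ge0.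
  - by rewrite lerXn2r ?nnegrE ?mulr_ge0.
  - apply: ler_pM => //; first by rewrite mulr_ge0// exprn_ge0.
    by apply: ler_wpM2l => //; rewrite lerXn2r ?nnegrE.
rewrite [leLHS](_ : _ = n1 h ^+ 2 * (A * s * q ^+ K * ((1 + c) ^+ K * c ^+ 2) * (br x ^+ k)^-1));
  last by ring.
by rewrite ler_wpM2l ?sqr_ge0// ler_wpM2r// ler_wpM2l// lerDl.
Qed.

Lemma schwartz_scale2 a b phi : 0 < a -> 0 < b -> schwartz phi ->
  schwartz (fun x => phi (scale2 a b x)).
Proof.
move=> a0 b0 sp; have := jet_schwartz (jet_scale2 a0 b0 sp).
by under eq_fun do rewrite !expr0 !mul1r.
Qed.

Lemma dmix_scale2 a b phi m n : 0 < a -> 0 < b -> schwartz phi ->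
  dmix m n (fun x => phi (scale2 a b x)) =
  fun x => a ^+ m * b ^+ n * dmix m n phi (scale2 a b x).
Proof.
move=> a0 b0 sp; have := jetE (jet_scale2 a0 b0 sp) m n.
by under eq_fun do rewrite !expr0 !mul1r.
Qed.

Lemma schwartzZ (c : R) phi : schwartz phi -> schwartz (fun x => c * phi x).
Proof.
move=> sp; have := schwartz_lin c sp (schwartz0 R).
by under eq_fun do rewrite addr0.
Qed.

Lemma dmixZ (c : R) phi m n : schwartz phi ->
  dmix m n (fun x => c * phi x) = fun x => c * dmix m n phi x.
Proof.
move=> sp; have := dmix_lin c m n sp (schwartz0 R).
under eq_fun do rewrite addr0.
move=> ->; apply/funext => x.
have -> : dmix m n (fun=> 0) x = 0 :> R.
  have := dmix_lin (- 1) m n (schwartz0 R) (schwartz0 R).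
  by rewrite mulr0 addr0 => /(congr1 (@^~ x)) ->; ring.
by rewrite addr0.
Qed.

Lemma schwartz_L1 phi : schwartz phi -> L1 phi.
Proof.
move=> sp; apply: (@L1_dom _ (sn 4 phi)); first exact: schwartz_mfun2.
move=> x; apply: (le_trans (schwartz_bound x sp (leq0n 4) (leq0n 4))).
by rewrite ler_wpM2l ?sn_ge0// brV4_wt.
Qed.

Variable psi : R -> plane R -> R.
Hypothesis hpsi : is_psi psi.

Lemma schwartz_psi T : 0 < T -> schwartz (psi T).
Proof. by move=> /hpsi[]. Qed.

(** Reflection changes only the sign of the sine integrals, which vanish; hence both functions have
    the same transform. *)
Lemma psi_even T x : 0 < T -> psi T (- x) = psi T x.
Proof.
move=> T0; have [sp fp] := hpsi T0.
have sr := schwartz_reflect 0 sp.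
have : (fun y => psi T (0 - y)) = psi T.
  apply: (fourier_inj sr sp _ fp) => k; have [c s] := fp k.
  split.
    rewrite -[LHS]/(I2 _) -(@I2_reflect _ 0); last first.
      by have := L1_cos k.1 k.2 0 (schwartz_L1 sr); under eq_fun do rewrite addr0.
    rewrite -[RHS]c -[RHS]/(I2 _); congr I2; apply/funext => y.
    rewrite sub0r sub0r opprK -[in RHS]cosN; congr (_ * cos _).
    by rewrite /=; ring.
  rewrite -[LHS]/(I2 _) -(@I2_reflect _ 0); last exact: L1_sin (schwartz_L1 sr).
  rewrite -[RHS]oppr0 -[X in - X]s -mulN1r -[X in _ * X]/(I2 _) -I2Z; last first.
    exact: L1_sin (schwartz_L1 sp).
  congr I2; apply/funext => y.
  rewrite sub0r sub0r opprK mulrCA mulN1r -sinN; congr (_ * sin _).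
  by rewrite /=; ring.
by move=> /(congr1 (@^~ x)); rewrite sub0r.
Qed.

Lemma psi_mass T : 0 < T -> I2 (psi T) = 1.
Proof.
move=> T0; have [sp /(_ 0)[+ _]] := hpsi T0.
rewrite /= expr0n expr0n addr0 mulr0 expR0 -[LHS]/(I2 _) => <-.
by congr I2; apply/funext => x; rewrite !mul0r addr0 cos0 mulr1.
Qed.

(** The symbol k_1^4 + k_2^2 is homogeneous of degree 4 under (r k_1, r^2 k_2), so T = r^4
    corresponds to lengths r and r^2; r^3 is the Jacobian. *)
Lemma psi_scale r : 0 < r ->
  psi (r ^+ 4) = fun x => r ^- 3 * psi 1 (scale2 r^-1 (r ^- 2) x).
Proof.
move=> r0; have rn0 : r != 0 by rewrite gt_eqF.
have T0 : 0 < r ^+ 4 by rewrite exprn_gt0.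
have a0 : 0 < r^-1 by rewrite invr_gt0.
have b0 : 0 < r ^- 2 by rewrite invr_gt0 exprn_gt0.
have [sp fp] := hpsi T0; have [s1 f1] := hpsi (@ltr01 R).
have ss := schwartz_scale2 a0 b0 s1.
have sZ := schwartzZ (r ^- 3) ss.
apply: (fourier_inj sp sZ fp) => k.
have [c s] := f1 (k.1 * r, k.2 * r ^+ 2).
have r2n0 : r ^+ 2 != 0 by rewrite expf_neq0.
have norms : `|r| * `|r ^+ 2| = r ^+ 3 by rewrite -normrM -exprS gtr0_norm// exprn_gt0.
have key (g : R -> R) (G : plane R -> R): L1 (fun x => r ^- 3 * psi 1 (scale2 r^-1 (r ^- 2) x) * g (k.1 * x.1 + k.2 * x.2)) ->
   (forall x, G x = psi 1 x * g (k.1 * r * x.1 + k.2 * r ^+ 2 * x.2)) -> L1 G ->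
   I2 (fun x => r ^- 3 * psi 1 (scale2 r^-1 (r ^- 2) x) * g (k.1 * x.1 + k.2 * x.2)) = I2 G.
  move=> L GE LG; rewrite (I2_affine 0 rn0 r2n0 L) norms affine2_scale2.
  have r3 : r ^+ 3 != 0 by rewrite expf_neq0.
  rewrite (_ : _ \o _ = fun x => r ^- 3 * G x); first by rewrite I2Z// mulrA mulfV// mul1r.
  apply/funext => x; rewrite GE /scale2/= !mulKf// -surjective_pairing -[LHS]mulrA.
  by congr (_ * (_ * g _)); ring.
split.
  rewrite -[LHS]/(I2 _) (@key cos (fun x => psi 1 x * cos (k.1 * r * x.1 + k.2 * r ^+ 2 * x.2)))//.
  - rewrite -[LHS]/(\int[leb2]_(x in setT) _) c; congr expR; rewrite /=; ring.
  - by have := L1_cos k.1 k.2 0 (schwartz_L1 sZ); under eq_fun do rewrite addr0.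
  - by have := L1_cos (k.1 * r) (k.2 * r ^+ 2) 0 (schwartz_L1 s1); under eq_fun do rewrite addr0.
rewrite -[LHS]/(I2 _) (@key sin (fun x => psi 1 x * sin (k.1 * r * x.1 + k.2 * r ^+ 2 * x.2)))//.
- exact: L1_sin (schwartz_L1 sZ).
- exact: L1_sin (schwartz_L1 s1).
Qed.

End Kernel.

Section KernelSemigroup.
Variable R : realType.
Implicit Types (f phi chi : plane R -> R) (x y z h : plane R).

Lemma grows_bounded f (A : R) : mfun2 f -> (forall x, `|f x| <= A) -> grows f.
Proof. by move=> mf fA; split=> //; exists 0%N, A => y; rewrite expr0 mulr1. Qed.

Lemma cv_reflectE f phi x : grows f -> schwartz phi ->
  cv f phi x = I2 (fun u => f (x - u) * phi u).
Proof.
move=> gf sp; rewrite -(@I2_reflect _ x) /cv.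
  by congr I2; apply/funext => y; rewrite subKr.
have := L1_reflect x (grows_L1 x gf sp).
by under eq_fun do rewrite subKr.
Qed.

Definition even f := forall x, f (- x) = f x.

Lemma evenB f x y : even f -> f (x - y) = f (y - x).
Proof. by move=> ef; rewrite -ef opprB. Qed.

(** Fubini for a polynomially growing c, read off from [dconv_exchange]; evenness of phi brings the
    inner integral into convolution form. *)
Lemma dist_of_exchange f c phi : grows c -> schwartz f -> schwartz phi -> even phi ->
  I2 (fun x => f x * cv c phi x) = I2 (fun y => c y * cv f phi y).
Proof.
move=> gc sf sp ep; rewrite -[LHS]/(I2 (fun x => f x * dconv (dist_of c) phi x)).
rewrite (dconv_exchange (tempered_dist_of gc) sf sp).
rewrite -[LHS]/(I2 _); congr I2; apply/funext => y; congr (_ * I2 _).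
by apply/funext => x; rewrite (evenB _ _ ep).
Qed.

(** The sine integrals of phi vanish, so cosine and sine are eigenfunctions of convolution with phi,
    with eigenvalue [ph k]. Moving the convolution from f onto them gives the product. *)
Lemma fourier_cv f phi fh ph : schwartz f -> schwartz phi -> even phi ->
  has_real_fourier f fh -> has_real_fourier phi ph ->
  has_real_fourier (cv f phi) (fun k => fh k * ph k).
Proof.
move=> sf sp ep hf hp k; have [cf' sf'] := hf k; have [cp' sp'] := hp k.
have cf : I2 (fun x => f x * cos (k.1 * x.1 + k.2 * x.2)) = fh k := cf'.
have sf0 : I2 (fun x => f x * sin (k.1 * x.1 + k.2 * x.2)) = 0 := sf'.
have cp : I2 (fun x => phi x * cos (k.1 * x.1 + k.2 * x.2)) = ph k := cp'.
have sp0 : I2 (fun x => phi x * sin (k.1 * x.1 + k.2 * x.2)) = 0 := sp'.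
have Lc g : schwartz g -> L1 (fun x => g x * cos (k.1 * x.1 + k.2 * x.2)).
  by move=> sg; have := L1_cos k.1 k.2 0 (schwartz_L1 sg); under eq_fun do rewrite addr0.
have Ls g : schwartz g -> L1 (fun x => g x * sin (k.1 * x.1 + k.2 * x.2)).
  by move=> sg; exact: L1_sin (schwartz_L1 sg).
have mc : mfun2 (fun x => cos (k.1 * x.1 + k.2 * x.2)).
  by have := mfun2_cos k.1 k.2 0; under eq_fun do rewrite addr0.
have ms : mfun2 (fun x => sin (k.1 * x.1 + k.2 * x.2)).
  have := mfun2_cos k.1 k.2 (- (pi / 2)).
  by under eq_fun do rewrite -sinDpihalf subrK.
have gc : grows (fun x => cos (k.1 * x.1 + k.2 * x.2)).
  by apply: (@grows_bounded _ 1) => // x; rewrite ler_norml cos_le1 cos_geN1.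
have gs : grows (fun x => sin (k.1 * x.1 + k.2 * x.2)).
  by apply: (@grows_bounded _ 1) => // x; rewrite ler_norml sin_le1 sin_geN1.
have Ecv : cv (fun x => cos (k.1 * x.1 + k.2 * x.2)) phi =
    fun x => ph k * cos (k.1 * x.1 + k.2 * x.2).
  apply/funext => x; rewrite cv_reflectE//.
  have -> : (fun u => cos (k.1 * (x - u).1 + k.2 * (x - u).2) * phi u) = fun u =>
     cos (k.1 * x.1 + k.2 * x.2) * (phi u * cos (k.1 * u.1 + k.2 * u.2))
     + sin (k.1 * x.1 + k.2 * x.2) * (phi u * sin (k.1 * u.1 + k.2 * u.2)).
    apply/funext => u; rewrite /=.
    rewrite (_ : k.1 * (x.1 - u.1) + _ = (k.1 * x.1 + k.2 * x.2) - (k.1 * u.1 + k.2 * u.2)).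
      by rewrite cosB; ring.
    by ring.
  by rewrite I2D; [rewrite !I2Z ?cp ?sp0 ?mulr0 ?addr0 1?mulrC//; [exact: Ls|exact: Lc]
    |by apply: L1Z; exact: Lc|by apply: L1Z; exact: Ls].
have Esv : cv (fun x => sin (k.1 * x.1 + k.2 * x.2)) phi =
    fun x => ph k * sin (k.1 * x.1 + k.2 * x.2).
  apply/funext => x; rewrite cv_reflectE//.
  have -> : (fun u => sin (k.1 * (x - u).1 + k.2 * (x - u).2) * phi u) = fun u =>
     sin (k.1 * x.1 + k.2 * x.2) * (phi u * cos (k.1 * u.1 + k.2 * u.2))
     - cos (k.1 * x.1 + k.2 * x.2) * (phi u * sin (k.1 * u.1 + k.2 * u.2)).
    apply/funext => u; rewrite /=.
    rewrite (_ : k.1 * (x.1 - u.1) + _ = (k.1 * x.1 + k.2 * x.2) - (k.1 * u.1 + k.2 * u.2)).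
      by rewrite sinB; ring.
    by ring.
  by rewrite I2B; [rewrite !I2Z ?cp ?sp0 ?mulr0 ?subr0 1?mulrC//; [exact: Ls|exact: Lc]
    |by apply: L1Z; exact: Lc|by apply: L1Z; exact: Ls].
split; rewrite -[LHS]/(I2 _).
  under eq_fun do rewrite mulrC.
  rewrite -(dist_of_exchange gc sf sp ep) Ecv; under eq_fun do rewrite mulrCA.
  by rewrite I2Z ?cf 1?mulrC//; exact: Lc.
under eq_fun do rewrite mulrC.
rewrite -(dist_of_exchange gs sf sp ep) Esv; under eq_fun do rewrite mulrCA.
by rewrite I2Z ?sf0 ?mulr0//; exact: Ls.
Qed.

Variable psi : R -> plane R -> R.
Hypothesis hpsi : is_psi psi.

Lemma psi_semigroup s t : 0 < s -> 0 < t -> cv (psi s) (psi t) = psi (s + t).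
Proof.
move=> s0 t0; have st0 : 0 < s + t by exact: addr_gt0.
have ss := schwartz_psi hpsi s0; have sT := schwartz_psi hpsi t0.
apply: (fourier_inj (schwartz_cv ss sT) (schwartz_psi hpsi st0) _ (hpsi st0).2).
have et : even (psi t) by move=> x; exact: psi_even.
have := fourier_cv ss sT et (hpsi s0).2 (hpsi t0).2.
move=> H k; have [c s'] := H k; split=> //.
by rewrite c -expRD; congr expR; ring.
Qed.

(** [dconv_exchange] brings the integral inside g, where the kernels combine by [psi_semigroup]. For
    g = [dist_of f] this yields the law for functions. *)
Lemma dconv_semigroup (g : functional R) s t x : tempered g -> 0 < s -> 0 < t ->
  cv (dconv g (psi s)) (psi t) x = dconv g (psi (s + t)) x.
Proof.
move=> tg s0 t0; have ss := schwartz_psi hpsi s0; have sT := schwartz_psi hpsi t0.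
rewrite /cv; under eq_fun do rewrite mulrC.
rewrite (dconv_exchange tg (schwartz_reflect x sT) ss) /dconv; congr (g _).
apply/funext => y; rewrite -psi_semigroup// cv_reflectE//; last exact: schwartz_grows.
have es : even (psi s) by move=> z; exact: psi_even.
have L : L1 (fun z => psi t (x - z) * psi s (z - y)).
  under eq_fun do rewrite (evenB _ _ es).
  exact: grows_L1 (schwartz_grows (schwartz_reflect x sT)) ss.
rewrite -(I2_reflect x L); congr I2; apply/funext => z.
by rewrite subKr mulrC addrAC.
Qed.

Lemma cv_psi_cv f s t x : grows f -> 0 < s -> 0 < t ->
  cv (cv f (psi s)) (psi t) x = cv f (psi (s + t)) x.
Proof. by move=> gf s0 t0; exact: dconv_semigroup (tempered_dist_of gf) s0 t0. Qed.

Lemma I2_scale2 (F k0 : plane R -> R) (r : R) : 0 < r ->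
  L1 (fun w => F w * k0 (scale2 r^-1 (r ^- 2) w)) ->
  I2 (fun w => F w * k0 (scale2 r^-1 (r ^- 2) w)) =
  r ^+ 3 * I2 (fun u => F (scale2 r (r ^+ 2) u) * k0 u).
Proof.
move=> r0 L; have rn0 : r != 0 by rewrite gt_eqF.
have r2n0 : r ^+ 2 != 0 by rewrite expf_neq0.
rewrite (I2_affine 0 rn0 r2n0 L) affine2_scale2 -normrM -exprS.
rewrite gtr0_norm ?exprn_gt0//; congr (_ * I2 _); apply/funext => u.
by rewrite /= /scale2/= !mulKf// -surjective_pairing.
Qed.

End KernelSemigroup.

(** * Moments of the kernel and the rate of approximation by convolution *)

Section Moments.
Variable R : realType.
Implicit Types (f phi chi : plane R -> R) (x y z h : plane R).
#[local] Hint Extern 0 (is_true (_ <= (br _ ^+ _)^-1)) => solve [exact: invbr_ge0] : core.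

Definition dd x : R := `|x.1| + Num.sqrt `|x.2|.

Lemma pdistE x y : pdist x y = dd (x - y).
Proof. by []. Qed.

Lemma dd_ge0 x : 0 <= dd x.
Proof. by rewrite addr_ge0// sqrtr_ge0. Qed.

Lemma ddN x : dd (- x) = dd x.
Proof. by rewrite /dd /= !normrN. Qed.

Lemma sqrtr_le_sqr (a b : R) : 0 <= b -> a <= b ^+ 2 -> Num.sqrt a <= b.
Proof. by move=> b0 ab; rewrite -[b]ger0_norm// -sqrtr_sqr ler_wsqrtr. Qed.

Lemma ddD x y : dd (x + y) <= dd x + dd y.
Proof.
rewrite /dd addrACA lerD ?ler_normD//.
apply: sqrtr_le_sqr; first by rewrite addr_ge0 ?sqrtr_ge0.
apply: (le_trans (ler_normD _ _)).
by rewrite sqrrD !sqr_sqrtr// lerD2r lerDl mulrn_wge0// mulr_ge0 ?sqrtr_ge0.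
Qed.

Lemma dd_br x : dd x <= br x.
Proof.
rewrite /dd /br /n1 addrCA lerD2l.
apply: sqrtr_le_sqr; first by rewrite addr_ge0.
have := normr_ge0 x.2; nra.
Qed.

Lemma dd_scale (r : R) x : 0 <= r -> dd (scale2 r (r ^+ 2) x) = r * dd x.
Proof.
move=> r0; rewrite /dd /= !normrM mulrDr !(ger0_norm r0) -expr2.
by rewrite (sqrtrM _ (sqr_ge0 r)) sqrtr_sqr (ger0_norm r0).
Qed.

Lemma mfun2_dd_pow (p : R) : mfun2 (fun x => dd x `^ p).
Proof.
apply: (measurableT_comp (measurable_powR p)).
apply: measurable_funD; first by apply: measurableT_comp => //; exact: measurable_fst.
apply: (measurableT_comp (f := @Num.sqrt R)).
  exact: (continuous_measurable_fun (@sqrt_continuous R)).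
by apply: measurableT_comp => //; exact: measurable_snd.
Qed.

(** The range up to 4 contains the exponents 0, alpha, 2 alpha and 3 alpha at which moments are
    taken. *)
Lemma dd_pow_br (p : R) x : 0 <= p <= 4 -> dd x `^ p <= br x ^+ 4.
Proof.
move=> /andP[p0 p4]; rewrite -powR_mulrn//.
apply: (@le_trans _ _ (br x `^ p)).
  by apply: ge0_ler_powR => //; rewrite ?nnegrE ?dd_ge0// dd_br.
by apply: ler_powR.
Qed.

Lemma schwartz_pow_bound phi (j : nat) x : schwartz phi ->
  `|phi x| * br x ^+ j <= sn (j + 4) phi * wt x.
Proof.
move=> sp.
apply: (@le_trans _ _ (sn (j + 4) phi * (br x ^+ (j + 4))^-1 * br x ^+ j)).
  by rewrite ler_wpM2r ?exprn_ge0//; exact: (schwartz_bound x sp (leq0n _) (leq0n _)).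
rewrite exprD invfM -!mulrA ler_wpM2l ?sn_ge0//.
by rewrite mulrCA mulVf ?gt_eqF ?exprn_gt0// mulr1 brV4_wt.
Qed.

Lemma L1_schwartz_le phi (j : nat) f (A : R) : schwartz phi -> mfun2 f ->
  (forall x, `|f x| <= A * (`|phi x| * br x ^+ j)) -> 0 <= A -> L1 f.
Proof.
move=> sp mf fA A0; apply: (@L1_dom _ (A * sn (j + 4) phi)) => // x.
by apply: (le_trans (fA x)); rewrite -mulrA ler_wpM2l// schwartz_pow_bound.
Qed.

Lemma mfun2_norm f : mfun2 f -> mfun2 (fun x => `|f x|).
Proof. by move=> mf; apply: measurableT_comp. Qed.

Lemma mfun2_brX j : mfun2 (fun x : plane R => br x ^+ j).
Proof. by apply: measurable_funX; exact: mfun2_br. Qed.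

Lemma L1_brX phi j : schwartz phi -> L1 (fun x => `|phi x| * br x ^+ j).
Proof.
move=> sp; apply: (@L1_schwartz_le phi j _ 1) => //.
  by apply: mfun2M; [apply: mfun2_norm; exact: schwartz_mfun2|exact: mfun2_brX].
by move=> x; rewrite mul1r ger0_norm// mulr_ge0// exprn_ge0.
Qed.

Lemma L1_mom phi p : schwartz phi -> 0 <= p <= 4 -> L1 (fun x => `|phi x| * dd x `^ p).
Proof.
move=> sp p04; apply: (@L1_schwartz_le phi 4 _ 1) => //.
  by apply: mfun2M; [apply: mfun2_norm; exact: schwartz_mfun2|exact: mfun2_dd_pow].
move=> x; rewrite mul1r ger0_norm ?mulr_ge0 ?powR_ge0//.
by rewrite ler_wpM2l// dd_pow_br.
Qed.

Definition mom phi p : R := I2 (fun x => `|phi x| * dd x `^ p).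

Lemma mom_ge0 phi p : 0 <= mom phi p.
Proof. by apply: I2_ge0 => x; rewrite mulr_ge0// powR_ge0. Qed.

Lemma grows_affine (a b : R) : grows (fun z => a + b * z.1).
Proof.
split.
  by apply: mfun2D; [exact: measurable_cst|apply: mfun2Z; exact: measurable_fst].
exists 1%N, (`|a| + `|b|) => y; rewrite expr1 (le_trans (ler_normD _ _))// mulrDl normrM.
apply: lerD; first by rewrite ler_peMr.
by rewrite ler_wpM2l// /br /n1 addrCA lerDl addr_ge0.
Qed.

(** Smoothing an affine function gives an affine function of slope b times the mass of phi; its
    Taylor rest is zero, so the derivative is immediate. *)
Lemma cv_affine_d1 (a b : R) phi y : schwartz phi ->
  cv (fun z => a + b * z.1) (dmix 1 0 phi) y = b * I2 phi.
Proof.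
move=> sp; set f := fun z => _.
have gf : grows f by exact: grows_affine.
have E x h : cv f phi (x + h) - cv f phi x - h.1 * (b * I2 phi) - h.2 * 0 = 0.
  rewrite !cv_reflectE//.
  have L z : L1 (fun u => f (z - u) * phi u).
    have := L1_reflect z (grows_L1 z gf sp).
    by under eq_fun do rewrite subKr.
  rewrite -I2B//.
  rewrite (_ : (fun u => _) = fun u => h.1 * b * phi u); last first.
    by apply/funext => u; rewrite /f /=; ring.
  by rewrite I2Z; [ring|exact: schwartz_L1].
have [] := @diff_taylor _ (cv f phi) y (b * I2 phi) 0 0 _.
  by move=> h _; rewrite E normr0 mul0r.
move=> _ <- _; have [_ + _] := cv_diff 0 0 y gf sp.
by move=> <-.
Qed.

(** Apply the previous formula to the kernel d1 phi, whose mass is zero; that in turn is the case of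
    a constant function. *)
Lemma cv_affine_d11 (a b : R) phi y : schwartz phi ->
  cv (fun z => a + b * z.1) (dmix 2 0 phi) y = 0.
Proof.
move=> sp; have sd := schwartz_dmix 1 0 sp.
rewrite -[dmix 2 0 phi]/(dmix 1 0 (dmix 1 0 phi)) cv_affine_d1//.
have := cv_affine_d1 1 0 y sp; rewrite mul0r => E.
suff -> : I2 (dmix 1 0 phi) = 0 by rewrite mulr0.
rewrite -[RHS]E cv_reflectE//; last exact: grows_affine.
by congr I2; apply/funext => u; rewrite mul0r addr0 mul1r.
Qed.

Variable psi : R -> plane R -> R.
Hypothesis hpsi : is_psi psi.
Let s1 := schwartz_psi hpsi (@ltr01 R).

Lemma dmix20_psi_scale r : 0 < r -> dmix 2 0 (psi (r ^+ 4)) =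
  fun x => r ^- 5 * dmix 2 0 (psi 1) (scale2 r^-1 (r ^- 2) x).
Proof.
move=> r0; have a0 : 0 < r^-1 by rewrite invr_gt0.
have b0 : 0 < r ^- 2 by rewrite invr_gt0 exprn_gt0.
rewrite (psi_scale hpsi r0) dmixZ; last exact: schwartz_scale2.
rewrite dmix_scale2//; apply/funext => x; rewrite expr0 mulr1 mulrA; congr (_ * _).
by rewrite exprVn -invfM -exprD.
Qed.

Lemma psi_mom r p : 0 < r -> 0 <= p <= 4 ->
  I2 (fun w => `|psi (r ^+ 4) w| * dd w `^ p) = r `^ p * mom (psi 1) p.
Proof.
move=> r0 p04; have rn0 : r != 0 by rewrite gt_eqF.
have r3 : 0 <= r ^- 3 by rewrite invr_ge0 exprn_ge0// ltW.
have a0 : 0 < r^-1 by rewrite invr_gt0.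
have b0 : 0 < r ^- 2 by rewrite invr_gt0 exprn_gt0.
have E : (fun w => `|psi (r ^+ 4) w| * dd w `^ p) =
    fun w => r ^- 3 * (dd w `^ p * `|psi 1 (scale2 r^-1 (r ^- 2) w)|).
  by apply/funext => w; rewrite (psi_scale hpsi r0) normrM (ger0_norm r3) -mulrA (mulrC `|_|).
have L : L1 (fun w => dd w `^ p * `|psi 1 (scale2 r^-1 (r ^- 2) w)|).
  have := L1_mom (schwartz_scale2 a0 b0 s1) p04; cbv beta.
  rewrite (_ : (fun w => `|_| * _) = fun w => dd w `^ p * `|psi 1 (scale2 r^-1 (r ^- 2) w)|)//.
  by apply/funext => w; rewrite mulrC.
have S := @I2_scale2 _ (fun w => dd w `^ p) (fun w => `|psi 1 w|) r r0 L.
rewrite E (I2Z _ L); cbv beta in S; rewrite S mulrA mulVf ?expf_neq0// mul1r.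
rewrite -I2Z; last exact: L1_mom.
congr I2; apply/funext => u; rewrite dd_scale ?(ltW r0)//.
by rewrite powRM ?dd_ge0 ?(ltW r0)//; ring.
Qed.

(** Each derivative in x_1 costs one factor r^-1, whence r^-2 in comparison with [psi_mom]. *)
Lemma psi2_mom r p : 0 < r -> 0 <= p <= 4 ->
  I2 (fun w => `|dmix 2 0 (psi (r ^+ 4)) w| * dd w `^ p)
  = r ^- 2 * r `^ p * mom (dmix 2 0 (psi 1)) p.
Proof.
move=> r0 p04; have rn0 : r != 0 by rewrite gt_eqF.
have r5 : 0 <= r ^- 5 by rewrite invr_ge0 exprn_ge0// ltW.
have a0 : 0 < r^-1 by rewrite invr_gt0.
have b0 : 0 < r ^- 2 by rewrite invr_gt0 exprn_gt0.
have s2 := schwartz_dmix 2 0 s1.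
have E : (fun w => `|dmix 2 0 (psi (r ^+ 4)) w| * dd w `^ p) =
    fun w => r ^- 5 * (dd w `^ p * `|dmix 2 0 (psi 1) (scale2 r^-1 (r ^- 2) w)|).
  by apply/funext => w; rewrite (dmix20_psi_scale r0) normrM (ger0_norm r5) -mulrA (mulrC `|_|).
have L : L1 (fun w => dd w `^ p * `|dmix 2 0 (psi 1) (scale2 r^-1 (r ^- 2) w)|).
  have := L1_mom (schwartz_scale2 a0 b0 s2) p04; cbv beta.
  rewrite (_ : (fun w => `|_| * _) = fun w => dd w `^ p * `|dmix 2 0 (psi 1) (scale2 r^-1 (r ^- 2) w)|)//.
  by apply/funext => w; rewrite mulrC.
have S := @I2_scale2 _ (fun w => dd w `^ p) (fun w => `|dmix 2 0 (psi 1) w|) r r0 L.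
rewrite E (I2Z _ L); cbv beta in S; rewrite S mulrA.
rewrite (_ : r ^- 5 * r ^+ 3 = r ^- 2); last by field.
rewrite -mulrA; congr (_ * _); rewrite -I2Z; last exact: L1_mom.
congr I2; apply/funext => u; rewrite dd_scale ?(ltW r0)//.
by rewrite powRM ?dd_ge0 ?(ltW r0)//; ring.
Qed.

Lemma cv_psi_scaled f x r : grows f -> 0 < r ->
  L1 (fun u => f (x - scale2 r (r ^+ 2) u) * psi 1 u) /\
  cv f (psi (r ^+ 4)) x = I2 (fun u => f (x - scale2 r (r ^+ 2) u) * psi 1 u).
Proof.
move=> gf r0; have rn0 : r != 0 by rewrite gt_eqF.
have r2n0 : r ^+ 2 != 0 by rewrite expf_neq0.
have T0 : 0 < r ^+ 4 by rewrite exprn_gt0.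
have sT := schwartz_psi hpsi T0.
have L0 : L1 (fun u => f (x - u) * psi (r ^+ 4) u).
  have := L1_reflect x (grows_L1 x gf sT).
  by under eq_fun do rewrite subKr.
have L : L1 (fun u => f (x - u) * psi 1 (scale2 r^-1 (r ^- 2) u)).
  have := L1Z (r ^+ 3) L0; rewrite (psi_scale hpsi r0).
  rewrite (_ : (fun u => _ * _) = fun u => f (x - u) * psi 1 (scale2 r^-1 (r ^- 2) u))//.
  by apply/funext => u; rewrite mulrCA mulVKf// expf_neq0.
split.
  have := L1_affine 0 rn0 r2n0 L; rewrite affine2_scale2.
  rewrite (_ : _ \o _ = fun u => f (x - scale2 r (r ^+ 2) u) * psi 1 u)//.
  by apply/funext => u; rewrite /= /scale2/= !mulKf// -surjective_pairing.
rewrite cv_reflectE//.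
rewrite (_ : (fun u => f (x - u) * psi (r ^+ 4) u) =
   fun u => r ^- 3 * (f (x - u) * psi 1 (scale2 r^-1 (r ^- 2) u))); last first.
  by apply/funext => u; rewrite (psi_scale hpsi r0) mulrCA.
have S := @I2_scale2 _ (fun u => f (x - u)) (psi 1) r r0 L.
rewrite (I2Z _ L); cbv beta in S; rewrite S.
by rewrite mulrA mulVf ?mul1r// expf_neq0.
Qed.

Definition cpsi j : R := I2 (fun u => `|psi 1 u| * br u ^+ j).

Lemma cpsi_ge0 j : 0 <= cpsi j.
Proof. by apply: I2_ge0 => x; rewrite mulr_ge0// exprn_ge0. Qed.

Lemma br_scale_le (r : R) u : 0 < r <= 1 ->
  n1 (scale2 r (r ^+ 2) u) <= r * br u /\ br (scale2 r (r ^+ 2) u) <= br u.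
Proof.
move=> /andP[r0 r1].
have rr : 0 <= r <= r by rewrite lexx ltW.
have r2 : 0 <= r ^+ 2 <= r by rewrite sqr_ge0 expr2 ger_pMr.
have H := n1_scale2 u rr r2; have n0 := n1_ge0 u; split.
  by apply: (le_trans H); rewrite ler_wpM2l ?(ltW r0)// lerDr.
by rewrite /br lerD2l; apply: (le_trans H); rewrite ler_piMl.
Qed.

Lemma cvC f phi : schwartz f -> schwartz phi -> cv f phi = cv phi f.
Proof.
move=> sf sp; apply/funext => x; rewrite cv_reflectE//; last exact: schwartz_grows.
by rewrite /cv; congr I2; apply/funext => u; rewrite mulrC.
Qed.

Lemma L1_psi1M f (j : nat) (A : R) : mfun2 f -> (forall u, `|f u| <= A * br u ^+ j) -> 0 <= A ->
  L1 (fun u => f u * psi 1 u) /\ `|I2 (fun u => f u * psi 1 u)| <= A * cpsi j.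
Proof.
move=> mf fA A0; have m1 : mfun2 (psi 1) := schwartz_mfun2 s1.
have B u : `|f u * psi 1 u| <= A * (`|psi 1 u| * br u ^+ j).
  by rewrite normrM mulrC mulrCA ler_wpM2l.
have LA := L1Z A (L1_brX j s1); split; first exact: (L1_le (mfun2M mf m1) LA B).
by apply: (le_trans (normI2_le (mfun2M mf m1) LA B)); rewrite I2Z//; exact: L1_brX.
Qed.

Lemma mfun2_scale_reflect f x (r : R) : mfun2 f -> mfun2 (fun u => f (x - scale2 r (r ^+ 2) u)).
Proof.
move=> mf.
have := measurableT_comp (mfun2_reflect x mf) (measurable_affine2 r (r ^+ 2) 0).
by rewrite affine2_scale2.
Qed.

Lemma cv_psi_diff f x r : grows f -> 0 < r ->
  - 1 * f x + cv f (psi (r ^+ 4)) x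
  = I2 (fun u => (f (x - scale2 r (r ^+ 2) u) - f x) * psi 1 u).
Proof.
move=> gf r0; have [L ->] := cv_psi_scaled x gf r0.
rewrite (_ : (fun u => (f _ - f x) * _) = fun u => f (x - scale2 r (r ^+ 2) u) * psi 1 u - f x * psi 1 u).
  rewrite I2B//; last by apply: L1Z; exact: schwartz_L1.
  by rewrite I2Z ?psi_mass//; [ring|exact: schwartz_L1].
by apply/funext => u; rewrite mulrBl.
Qed.

(** A gain of r = T^(1/4) in every Schwartz norm, for the loss of one index; this rate suffices for
    uniqueness. The difference has the shape in which [tempered] states linearity. *)
Lemma cv_psi_approx phi k r : schwartz phi -> 0 < r <= 1 ->
  sn k (fun x => - 1 * phi x + cv phi (psi (r ^+ 4)) x) <= r * cpsi (k + 2) * sn k.+1 phi.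
Proof.
move=> sp r01; have /andP[r0 r1] := r01.
have T0 : 0 < r ^+ 4 by rewrite exprn_gt0.
have sT := schwartz_psi hpsi T0.
have sc := schwartz_cv sp sT.
apply: sn_le; first exact: schwartz_lin.
move=> m n x mk nk; rewrite dmix_lin// (cvC sp sT) (dmix_cv m n sT sp).
have sd := schwartz_dmix m n sp; rewrite (cvC sT sd) cv_psi_diff//; last exact: schwartz_grows.
set f := dmix m n phi.
have mk1 : (m < k.+1)%N by []. have nk1 : (n < k.+1)%N by [].
have t1 : 0 <= (1 : R) <= 1 by rewrite ler01 lexx.
have S0 : 0 <= sn k.+1 phi := sn_ge0 _ _.
have B u : `|f (x - scale2 r (r ^+ 2) u) - f x| <=
    r * sn k.+1 phi * (br x ^+ k)^-1 * br u ^+ (k + 2).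
  have := schwartz_taylor1 x (- scale2 r (r ^+ 2) u) sp mk1 nk1 t1.
  rewrite scale1r n1N brN => /le_trans; apply.
  have [H1 H2] := br_scale_le u r01.
  rewrite [leRHS](_ : _ = r * br u * (sn k.+1 phi * br u ^+ k.+1 * (br x ^+ k)^-1)); last first.
    by rewrite addn2 2!exprS; ring.
  apply: ler_pM => //; first by rewrite !mulr_ge0// exprn_ge0.
  apply: ler_pM => //; first by rewrite mulr_ge0// exprn_ge0.
    by rewrite ler_wpM2l// lerXn2r ?nnegrE.
  by rewrite lef_pV2 ?posrE ?exprn_gt0// ler_weXn2l.
have mg : mfun2 (fun u => f (x - scale2 r (r ^+ 2) u) - f x).
  apply: mfun2B; last exact: measurable_cst.
  by apply: mfun2_scale_reflect; exact: schwartz_mfun2.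
have A0 : 0 <= r * sn k.+1 phi * (br x ^+ k)^-1 by rewrite !mulr_ge0// ltW.
have [_] := L1_psi1M mg B A0.
by move=> /le_trans; apply; apply: le_of_eq; ring.
Qed.

Lemma psi1_odd_moment : L1 (fun u => u.1 * psi 1 u) /\ I2 (fun u => u.1 * psi 1 u) = 0.
Proof.
have [|u|//|L _] := @L1_psi1M (fun u => u.1) 1 1; first exact: measurable_fst.
  by rewrite mul1r expr1 /br /n1 addrCA lerDl addr_ge0.
split=> //; have := I2_reflect 0 L.
have -> : (fun y => (0 - y).1 * psi 1 (0 - y)) = fun u => - 1 * (u.1 * psi 1 u).
  by apply/funext => u; rewrite sub0r psi_even//= ; ring.
rewrite I2Z//; set X := I2 _; lra.
Qed.

(** The rate improves to r^2 = T^(1/2): the term linear in x_1 integrates to zero because psi is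
    even, and increments in x_2 already scale like r^2. *)
Lemma cv_psi_approx2 phi r x : schwartz phi -> 0 < r <= 1 ->
  `|cv phi (psi (r ^+ 4)) x - phi x| <= r ^+ 2 * (2 * cpsi 6) * sn 4 phi * (br x ^+ 4)^-1.
Proof.
move=> sp r01; have /andP[r0 r1] := r01.
rewrite (_ : _ - _ = - 1 * phi x + cv phi (psi (r ^+ 4)) x); last by ring.
rewrite cv_psi_diff//; last exact: schwartz_grows.
have S0 : 0 <= sn 4 phi := sn_ge0 _ _.
set s := scale2 r (r ^+ 2).
(* The increment with its x_1-linear part removed; the removed part has zero integral against
   [psi 1]. *)
pose F u := phi (x - s u) - phi x + (s u).1 * dmix 1 0 phi x.
have B u : `|F u| <= r ^+ 2 * 2 * sn 4 phi * (br x ^+ 4)^-1 * br u ^+ 6.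
  have := schwartz_taylor2 x (- s u) sp (isT : (1 < 4)%N) (isT : (1 < 4)%N).
  rewrite n1N brN; set T := (X in `|X|) => HT.
  (* F differs from the full Taylor rest T by the term linear in x_2, which is of size r^2. *)
  have -> : F u = T - (r ^+ 2 * u.2) * dmix 0 1 phi x by rewrite /F /T /s /=; ring.
  have [H1 H2] := br_scale_le u r01.
  have n0 := n1_ge0 (s u).
  apply: (le_trans (ler_normB _ _)).
  apply: (@le_trans _ _ ((r * br u) ^+ 2 * (sn 4 phi * br u ^+ 4 * (br x ^+ 4)^-1)
    + r ^+ 2 * br u ^+ 6 * (sn 4 phi * (br x ^+ 4)^-1))); last first.
    by apply: le_of_eq; ring.
  apply: lerD.
    apply: (le_trans HT); apply: ler_pM; rewrite ?sqr_ge0//.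
    - by rewrite !mulr_ge0// exprn_ge0.
    - by rewrite lerXn2r ?nnegrE ?mulr_ge0 ?(ltW r0).
    - by rewrite ler_wpM2r// ler_wpM2l// lerXn2r ?nnegrE.
  rewrite normrM; apply: ler_pM => //; last exact: (schwartz_bound x sp (isT : (0 <= 4)%N) (isT : (1 <= 4)%N)).
  rewrite normrM (ger0_norm (sqr_ge0 r)) ler_wpM2l ?sqr_ge0//.
  apply: (@le_trans _ _ (br u ^+ 1)); last by rewrite ler_weXn2l.
  by rewrite expr1 /br /n1 addrA lerDr addr_ge0.
have sc : grows phi by exact: schwartz_grows.
have mF : mfun2 F.
  apply: mfun2D.
    apply: mfun2B; last exact: measurable_cst.
    by apply: mfun2_scale_reflect; exact: schwartz_mfun2.
  rewrite (_ : (fun u => (s u).1 * dmix 1 0 phi x) = fun u => (r * dmix 1 0 phi x) * u.1).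
    by apply: mfun2Z; exact: measurable_fst.
  by apply/funext => u; rewrite /s /=; ring.
have A0 : 0 <= r ^+ 2 * 2 * sn 4 phi * (br x ^+ 4)^-1
  := mulr_ge0 (mulr_ge0 (mulr_ge0 (sqr_ge0 r) (ler0n _ 2)) S0) (invbr_ge0 x 4).
have [LF HF] := L1_psi1M mF B A0.
have [Lo Eo] := psi1_odd_moment.
have -> : I2 (fun u => (phi (x - s u) - phi x) * psi 1 u) = I2 (fun u => F u * psi 1 u).
  rewrite -[RHS]subr0 -(mulr0 (r * dmix 1 0 phi x)) -Eo -I2Z// -I2B//; last exact: L1Z.
  by congr I2; apply/funext => u; rewrite /F /s /=; ring.
by apply: (le_trans HF); apply: le_of_eq; ring.
Qed.

End Moments.

(** * Uniqueness and reconstruction *)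

Section Vanishing.
Variable R : realType.
Implicit Types (f phi chi : plane R -> R) (x y z h : plane R).

Lemma geometric_tail (u : nat -> R) (D q : R) : 0 <= q < 1 ->
  (forall n, `|u n.+1 - u n| <= D * q ^+ n) ->
  forall n m, `|u (n + m)%N - u n| <= D * q ^+ n / (1 - q).
Proof.
move=> /andP[q0 q1] H.
have D0 : 0 <= D by have := le_trans (normr_ge0 _) (H 0%N); rewrite expr0 mulr1.
have p0 : 0 < 1 - q by lra.
suff S n m : `|u (n + m)%N - u n| <= D * q ^+ n * (1 - q ^+ m) / (1 - q).
  move=> n m; apply: (le_trans (S n m)); rewrite ler_wpM2r ?invr_ge0 ?(ltW p0)//.
  by rewrite ler_piMr ?mulr_ge0 ?exprn_ge0// lerBlDr lerDl exprn_ge0.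
elim: m => [|m IH]; first by rewrite addn0 subrr normr0 expr0 subrr mulr0 mul0r.
rewrite addnS -(subrKA (u (n + m)%N)) (le_trans (ler_normD _ _))//.
apply: (le_trans (lerD (H _) IH)).
apply: le_of_eq; rewrite exprD exprS; field.
by rewrite gt_eqF.
Qed.

Lemma geometric_cvg (u : nat -> R) (D q : R) : 0 <= q < 1 ->
  (forall n, `|u n.+1 - u n| <= D * q ^+ n) ->
  u n @[n --> \oo] --> limn u /\ forall n, `|limn u - u n| <= D * q ^+ n / (1 - q).
Proof.
move=> q01 H; have /andP[q0 q1] := q01.
have T := geometric_tail q01 H.
have D0 : 0 <= D by have := le_trans (normr_ge0 _) (H 0%N); rewrite expr0 mulr1.
have cq : D * q ^+ n / (1 - q) @[n --> \oo] --> (0 : R).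
  rewrite -[X in _ --> X](mul0r (1 - q)^-1); apply: cvgMr_tmp.
  by rewrite -[X in _ --> X](mulr0 D); apply: cvgMl_tmp; apply: cvg_expr; rewrite ger0_norm.
have cu : cvgn u.
  apply: cauchy_cvg; apply: cauchy_exP => e e0.
  have /cvgrPdist_lt /(_ _ e0) [N _ HN] := cq.
  exists (u N); exists N => // n /= Nn.
  rewrite -ball_normE /= distrC -(subnKC Nn); apply: (le_lt_trans (T N _)).
  have := HN N (leqnn N); rewrite /= sub0r normrN; apply: le_lt_trans; exact: ler_norm.
split=> [//|n].
have cn : `|u m - u n| @[m --> \oo] --> `|limn u - u n|.
  by apply: cvg_norm; apply: cvgB => //; exact: cvg_cst.
rewrite -(cvg_lim _ cn)//; apply: limr_le; first by apply/cvg_ex; eexists; exact: cn.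
by exists n => // m /= nm; rewrite -(subnKC nm); exact: T.
Qed.

Variable psi : R -> plane R -> R.
Hypothesis hpsi : is_psi psi.
Let s1 := schwartz_psi hpsi (@ltr01 R).

Lemma psi_even' T : 0 < T -> even (psi T).
Proof. by move=> T0 x; exact: psi_even. Qed.

Lemma root4 (T : R) : 0 < T -> exists r, [/\ 0 < r, T = r ^+ 4 & r = T `^ 4^-1].
Proof.
move=> T0; exists (T `^ 4^-1); split => //; first exact: powR_gt0.
by rewrite -powR_mulrn ?powR_ge0// -powRrM mulVf ?powRr1 ?(ltW T0)// pnatr_eq0.
Qed.

Lemma dist_cv (g : functional R) phi T : tempered g -> schwartz phi -> 0 < T ->
  g (cv phi (psi T)) = I2 (fun x => phi x * dconv g (psi T) x).
Proof.
move=> tg sp T0; have sT := schwartz_psi hpsi T0.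
rewrite (dconv_exchange tg sp sT); congr g; apply/funext => y.
by congr I2; apply/funext => x; rewrite (evenB _ _ (psi_even' T0)).
Qed.

Lemma L1_bounded_mul f phi (A : R) : mfun2 f -> (forall x, `|f x| <= A) -> schwartz phi ->
  L1 (fun x => phi x * f x) /\ `|I2 (fun x => phi x * f x)| <= A * I2 (fun x => `|phi x|).
Proof.
move=> mf fA sp; have Lp := L1_norm (schwartz_L1 sp).
have A0 : 0 <= A := le_trans (normr_ge0 _) (fA 0).
have B x : `|phi x * f x| <= A * `|phi x| by rewrite normrM mulrC ler_wpM2r.
have M : mfun2 (fun x => phi x * f x) by apply: mfun2M => //; exact: schwartz_mfun2.
split; first exact: L1_le M (L1Z A Lp) B.
by apply: (le_trans (normI2_le M (L1Z A Lp) B)); rewrite I2Z.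
Qed.

Lemma I2_norm_le phi (A : R) : schwartz phi ->
  (forall x, `|phi x| <= A * (br x ^+ 4)^-1) -> I2 (fun x => `|phi x|) <= A * W R.
Proof.
move=> sp pA; have A0 : 0 <= A.
  by have := le_trans (normr_ge0 _) (pA 0); rewrite pmulr_lge0// invr_gt0 exprn_gt0.
rewrite /W -I2Z; last exact: L1_wt.
apply: le_I2; [exact: L1_norm (schwartz_L1 sp)|by apply: L1Z; exact: L1_wt|].
by move=> x; apply: (le_trans (pA x)); rewrite ler_wpM2l// brV4_wt.
Qed.

(* |g(phi)| <= |g(phi) - g(phi_T)| + |phi|_(L^1) ||g_T||. *)
Lemma dist_vanish (g : functional R) : tempered g ->
  (forall e : R, 0 < e -> exists2 d : R, 0 < d & forall T x, 0 < T < d -> `|dconv g (psi T) x| <= e) ->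
  forall phi, schwartz phi -> g phi = 0.
Proof.
move=> tg H phi sp; have [k [C [C0 gC]]] := tempered_bound tg.
apply/eqP; rewrite -normr_le0; apply/ler_addgt0Pl => e e0; rewrite addr0.
set N := I2 (fun x => `|phi x|).
have N0 : 0 <= N by apply: I2_ge0.
pose K := C * (cpsi psi (k + 2) * sn k.+1 phi).
have K0 : 0 <= K by rewrite !mulr_ge0 ?cpsi_ge0 ?sn_ge0.
pose e1 := e / (2 * (N + 1)).
have e10 : 0 < e1 by rewrite divr_gt0// mulr_gt0// ltr_wpDl.
have [d d0 dP] := H e1 e10.
(* The first two bounds give r^4 <= r < d, so that g is small at scale r^4; the third gives r * K <=
   e / 2. *)
pose r := Num.min (Num.min 1 (d / 2)) (e / (2 * (K + 1))).
have r0 : 0 < r by rewrite !lt_min ltr01 !divr_gt0// mulr_gt0// ltr_wpDl.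
have r1 : r <= 1 by rewrite !ge_min lexx.
have rd : r <= d / 2 by rewrite !ge_min lexx orbT.
have re : r <= e / (2 * (K + 1)) by rewrite !ge_min lexx orbT.
have T0 : 0 < r ^+ 4 by rewrite exprn_gt0.
have Td : 0 < r ^+ 4 < d.
  rewrite T0 /=; apply: (@le_lt_trans _ _ r); last by lra.
  by rewrite exprS ler_piMr ?(ltW r0)// exprn_ile1// ltW.
have sT := schwartz_psi hpsi T0.
have B1 : `|g (cv phi (psi (r ^+ 4)))| <= e1 * N.
  rewrite dist_cv//.
  have mD : mfun2 (dconv g (psi (r ^+ 4))) by case: (dconv_grows tg sT).
  by case: (L1_bounded_mul mD (fun x => dP _ x Td) sp).
have r01 : 0 < r <= 1 by rewrite r0.
have sc := schwartz_cv sp sT.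
have := gC _ (schwartz_lin (- 1) sp sc); rewrite (tg.1 _ _ _ sp sc) => B2.
have B3 := cv_psi_approx hpsi k sp r01.
have {}B2 : `|- 1 * g phi + g (cv phi (psi (r ^+ 4)))| <= r * K.
  apply: (le_trans B2); apply: (le_trans (ler_wpM2l C0 B3)).
  by apply: le_of_eq; rewrite /K; ring.
have -> : g phi = g (cv phi (psi (r ^+ 4))) - (- 1 * g phi + g (cv phi (psi (r ^+ 4)))) by ring.
apply: (le_trans (ler_normB _ _)).
have b1 : e1 * N <= e / 2.
  have E : e1 * (2 * (N + 1)) = e by rewrite /e1 divfK// gt_eqF// mulr_gt0// ltr_wpDl.
  nra.
have b2 : r * K <= e / 2.
  apply: (le_trans (ler_wpM2r K0 re)); rewrite mulrAC ler_pdivrMr ?mulr_gt0 ?ltr_wpDl//; nra.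
lra.
Qed.

End Vanishing.

Section Reconstruction.
Variable R : realType.
Implicit Types (f phi chi : plane R -> R) (x y z h : plane R).

Definition dyad (n : nat) : R := 2^-1 ^+ n.

Lemma dyad_gt0 n : 0 < dyad n. Proof. by rewrite exprn_gt0. Qed.
Lemma dyad_le1 n : dyad n <= 1.
Proof. by rewrite exprn_ile1// invf_le1// ler1n. Qed.
Lemma dyadS n : dyad n = dyad n.+1 + dyad n.+1.
Proof. by rewrite /dyad exprS; field. Qed.

(** The lower bound is strict so that T - 2^-n is a positive time, and the upper bound makes that
    time at most 2^-n, which is the constraint t <= s on the defect. *)
Lemma dyad_bracket (T : R) : 0 < T <= 1 -> exists n, dyad n < T <= dyad n + dyad n.
Proof.
move=> /andP[T0 T1].
have ex : exists n, dyad n < T.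
  have h : `|2^-1 : R| < 1 by rewrite ger0_norm// invf_lt1// ltr1n.
  have /cvgrPdist_lt /(_ _ T0) [N _ HN] := cvg_expr h.
  exists N; have := HN N (leqnn N); rewrite /= sub0r normrN.
  by apply: le_lt_trans; exact: ler_norm.
case: (ex_minnP ex) => [[|n]] nT minn.
  by move: nT; rewrite /dyad expr0 ltNge T1.
exists n.+1; rewrite nT -dyadS leNgt; apply/negP => /minn; by rewrite ltnn.
Qed.

Lemma dyad_small (T : R) : 0 < T -> exists n, dyad n < T.
Proof.
move=> T0; have m0 : 0 < Num.min 1 T <= 1 by rewrite lt_min ltr01 T0 ge_min lexx.
have [n /andP[nT _]] := dyad_bracket m0; exists n; apply: lt_le_trans nT _.
by rewrite ge_min lexx orbT.
Qed.

Lemma dyad_mono n m : (n <= m)%N -> dyad m <= dyad n.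
Proof. by move=> nm; rewrite /dyad ler_wiXn2l// invf_le1// ler1n. Qed.

Lemma powR_exprn (a p : R) n : 0 <= a -> (a ^+ n) `^ p = (a `^ p) ^+ n.
Proof. by move=> a0; rewrite -(powR_mulrn n a0) -powRrM mulrC powRrM powR_mulrn ?powR_ge0. Qed.

Lemma one_powR (p : R) : (1 : R) `^ p = 1. Proof. by rewrite powR1. Qed.

Lemma half_powR_lt1 (p : R) : 0 < p -> 0 <= (2^-1 : R) `^ p < 1.
Proof.
move=> p0; rewrite powR_ge0/= -[ltRHS](one_powR p).
by apply: gt0_ltr_powR; rewrite ?nnegrE// invf_lt1// ltr1n.
Qed.

Lemma le0_of_geometric (X D q : R) N : 0 <= q < 1 ->
  (forall n, (N <= n)%N -> X <= D * q ^+ n) -> X <= 0.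
Proof.
move=> /andP[q0 q1] H; apply/ler_addgt0Pl => e e0; rewrite addr0.
have cq : D * q ^+ n @[n --> \oo] --> (0 : R).
  by rewrite -[X in _ --> X](mulr0 D); apply: cvgMl_tmp; apply: cvg_expr; rewrite ger0_norm.
have /cvgrPdist_lt /(_ _ e0) [M _ HM] := cq.
apply: (le_trans (H (maxn N M) (leq_maxl _ _))).
have := HM (maxn N M) (leq_maxr _ _); rewrite /= sub0r normrN => /ltW.
by apply: le_trans; exact: ler_norm.
Qed.

Variable psi : R -> plane R -> R.
Hypothesis hpsi : is_psi psi.
Let s1 := schwartz_psi hpsi (@ltr01 R).
Let sP T (T0 : 0 < T) := schwartz_psi hpsi T0.

Let cn := mom (psi 1) 0.
Let cn0 : 0 <= cn := mom_ge0 _ _.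

Lemma psi_L1norm T : 0 < T -> I2 (fun w => `|psi T w|) = mom (psi 1) 0.
Proof.
move=> T0; have [r [r0 -> _]] := root4 T0.
have := @psi_mom R psi hpsi r 0 r0; rewrite lexx /= ler0n => /(_ isT).
rewrite powRr0 mul1r => <-; congr I2; apply/funext => w.
by rewrite powRr0 mulr1.
Qed.

Lemma cv_bounded f (D : R) T x : mfun2 f -> (forall y, `|f y| <= D) -> 0 < T ->
  `|cv f (psi T) x| <= D * mom (psi 1) 0.
Proof.
move=> mf fD T0; have [_] := L1_bounded_mul mf fD (schwartz_reflect x (sP T0)).
rewrite (@I2_reflect _ x (fun y => `|psi T y|)) ?psi_L1norm//; last first.
  exact: L1_norm (schwartz_L1 (sP T0)).
by rewrite /cv; under eq_fun do rewrite mulrC.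
Qed.

Lemma cvB f g phi x : grows f -> grows g -> schwartz phi ->
  cv f phi x - cv g phi x = cv (fun y => f y - g y) phi x.
Proof.
move=> gf gg sp; rewrite /cv -I2B; [|exact: grows_L1..].
by congr I2; apply/funext => y; rewrite mulrBl.
Qed.

(** Abstract data of the reconstruction: delta > 0 makes the defects summable over dyadic scales,
    and beta < 1/2 makes the pairings converge. B is purely qualitative and does not enter the
    conclusion. *)
Variables (F : R -> plane R -> R) (A B beta delta : R).
Hypothesis mF : forall T, 0 < T <= 1 -> mfun2 (F T).
Hypothesis bF : forall T x, 0 < T <= 1 -> `|F T x| <= B * T `^ (- beta).
Hypothesis hF : forall s t x, 0 < t <= s -> s + t <= 1 ->
  `|cv (F s) (psi t) x - F (s + t) x| <= A * s `^ delta.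
Hypothesis beta_ge0 : 0 <= beta.
Hypothesis beta_lt : beta < 2^-1.
Hypothesis delta_gt0 : 0 < delta.

Let d01 n : 0 < dyad n <= 1. Proof. by rewrite dyad_gt0 dyad_le1. Qed.

Let gF T : 0 < T <= 1 -> grows (F T).
Proof. by move=> T01; apply: (grows_bounded (mF T01)) => x; exact: bF. Qed.

Let A0 : 0 <= A.
Proof.
have h0 : 0 < (2^-1 : R) by rewrite invr_gt0.
have := le_trans (normr_ge0 _) (@hF 2^-1 2^-1 0 _ _).
rewrite h0 lexx => /(_ isT); rewrite pmulr_lge0 ?powR_gt0//; apply.
by apply: le_of_eq; field.
Qed.

(* The approximation of the reconstructed distribution at scale [T]. *)
Let H n T := cv (F (dyad n)) (psi (T - dyad n)).

Let q : R := 2^-1 `^ delta.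
Let q01 : 0 <= q < 1 := half_powR_lt1 delta_gt0.

Let dyad_delta n : dyad n `^ delta = q ^+ n.
Proof. exact: powR_exprn. Qed.

(** By the semigroup law both terms are convolutions with psi (T - 2^-n); what is convolved is the
    defect for s = t = 2^-(n+1). *)
Let H_step n T x : dyad n < T -> `|H n.+1 T x - H n T x| <= A * cn * q ^+ n.+1.
Proof.
move=> nT; have t0 : 0 < T - dyad n by rewrite subr_gt0.
have s0 := dyad_gt0 n.+1.
rewrite /H (_ : T - dyad n.+1 = dyad n.+1 + (T - dyad n)); last by rewrite (dyadS n); ring.
rewrite -(cv_psi_cv hpsi x (gF (d01 n.+1)) s0 t0) cvB; [|..|exact: sP].
- rewrite -dyad_delta mulrAC; apply: cv_bounded => //.
    apply: mfun2B; last exact: mF (d01 n).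
    by apply: continuous_mfun2; apply: cv_continuous; [exact: gF|exact: sP].
  move=> y; rewrite (dyadS n); apply: hF; first by rewrite s0 lexx.
  by rewrite -dyadS dyad_le1.
- apply: (@grows_bounded _ _ (B * dyad n.+1 `^ (- beta) * cn)).
    by apply: continuous_mfun2; apply: cv_continuous; [exact: gF|exact: sP].
  by move=> y; apply: cv_bounded; [exact: mF|move=> z; exact: bF|].
- exact: gF.
Qed.

Let G T x := limn (fun n => H n T x).

Let K0 := cn / (1 - q).
Let K00 : 0 <= K0. Proof. by case/andP: q01 => _ q1; rewrite divr_ge0// subr_ge0 ltW. Qed.

Let G_cvg_approx N T x : dyad N < T ->
  H n T x @[n --> \oo] --> G T x /\ `|G T x - H N T x| <= K0 * A * q ^+ N.
Proof.
(* For 2^-n >= T the kernel psi (T - 2^-n) is unspecified, so the sequence is considered from N on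
   only. *)
move=> NT; pose u j := H (N + j)%N T x.
have q0 : 0 <= q by case/andP : q01.
have q1 : q < 1 by case/andP : q01.
have us j : `|u j.+1 - u j| <= A * cn * q ^+ N * q ^+ j.
  rewrite /u addnS; apply: (le_trans (H_step _ _)).
    by apply: le_lt_trans NT; exact: dyad_mono (leq_addr _ _).
  by rewrite -[leRHS]mulrA -exprD ler_wpM2l ?mulr_ge0// ler_wiXn2l// ltW.
have [cu /(_ 0%N)] := geometric_cvg q01 us.
have cH : H n T x @[n --> \oo] --> limn u.
  rewrite -(cvg_shiftn N); rewrite /u in cu.
  by under eq_fun do rewrite addnC.
have -> : G T x = limn u by apply: cvg_lim.
rewrite expr0 mulr1 /u addn0 => E; split => //.
by apply: (le_trans E); apply: le_of_eq; rewrite /K0; ring.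
Qed.

(** With 2^-N < T <= 2 * 2^-N, the term H N T is one defect away from F T, and the remaining steps
    to G T form a geometric tail. *)
Let G_F T x : 0 < T <= 1 -> `|G T x - F T x| <= (K0 + 1) * A * T `^ delta.
Proof.
move=> T01; have [N /andP[NT TN]] := dyad_bracket T01.
have /andP[T0 T1] := T01.
have [_ E1] := G_cvg_approx x NT.
have E2 : `|H N T x - F T x| <= A * q ^+ N.
  have t0 : 0 < T - dyad N <= dyad N by rewrite subr_gt0 NT lerBlDr.
  have := @hF (dyad N) (T - dyad N) x t0; rewrite addrC subrK => /(_ T1).
  by rewrite dyad_delta.
have E3 : q ^+ N <= T `^ delta.
  rewrite -dyad_delta; apply: ge0_ler_powR; rewrite ?nnegrE ?(ltW (dyad_gt0 _)) ?ltW//.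
rewrite -(subrKA (H N T x)); apply: (le_trans (ler_normD _ _)).
apply: (le_trans (lerD E1 E2)).
rewrite [leLHS](_ : _ = (K0 + 1) * A * q ^+ N); last by rewrite !mulrDl mul1r.
by rewrite ler_wpM2l// mulr_ge0// addr_ge0.
Qed.

Let mG T : 0 < T -> mfun2 (G T).
Proof.
move=> T0; have [N NT] := dyad_small T0.
have M n : mfun2 (H (n + N)%N T).
  apply: continuous_mfun2; apply: cv_continuous; first exact: gF.
  apply: sP; rewrite subr_gt0; apply: le_lt_trans NT; exact: dyad_mono (leq_addl _ _).
apply: (measurable_fun_cvg M) => x _.
have [c _] := G_cvg_approx x NT.
by rewrite -(cvg_shiftn N) in c.
Qed.

Let B' := B + (K0 + 1) * A.

Let bG T x : 0 < T <= 1 -> `|G T x| <= B' * T `^ (- beta).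
Proof.
move=> T01; have /andP[T0 T1] := T01.
rewrite -(subrK (F T x) (G T x)) (le_trans (ler_normD _ _))// addrC /B' mulrDl.
apply: lerD; first exact: bF.
apply: (le_trans (G_F x T01)); rewrite ler_wpM2l ?mulr_ge0 ?addr_ge0//.
apply: (@le_trans _ _ 1); last first.
  by rewrite powRN invf_ge1 ?powR_gt0// -[leRHS](one_powR beta) ge0_ler_powR ?nnegrE// ltW.
by rewrite -[leRHS](one_powR delta) ge0_ler_powR ?nnegrE// ltW.
Qed.

Let gG T : 0 < T <= 1 -> grows (G T).
Proof.
by move=> T01; apply: grows_bounded => [|x]; [apply: mG; case/andP: T01|exact: bG].
Qed.

(** Each H n satisfies the law exactly, and its distance to G is geometrically small uniformly in
    the point, hence still small after convolution. *)
Let G_semi T t x : 0 < T <= 1 -> 0 < t -> cv (G T) (psi t) x = G (T + t) x.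
Proof.
move=> T01 t0; have /andP[T0 T1] := T01; have [N NT] := dyad_small T0.
apply: subr0_eq; apply/eqP; rewrite -normr_le0.
apply: (@le0_of_geometric _ (K0 * A * cn + K0 * A) q N) => // n Nn.
have nT : dyad n < T by apply: le_lt_trans NT; exact: dyad_mono.
have nTt : dyad n < T + t by rewrite ltr_wpDr// ltW.
have Tn0 : 0 < T - dyad n by rewrite subr_gt0.
have [_ E1] := G_cvg_approx x nTt.
have HE : H n (T + t) x = cv (H n T) (psi t) x.
  rewrite /H (_ : T + t - dyad n = T - dyad n + t); last by ring.
  by rewrite cv_psi_cv//; exact: gF.
have E2 : `|cv (G T) (psi t) x - H n (T + t) x| <= K0 * A * q ^+ n * cn.
  have gH : grows (H n T).
    apply: (@grows_bounded _ _ (B * dyad n `^ (- beta) * cn)).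
      by apply: continuous_mfun2; apply: cv_continuous; [exact: gF|exact: sP].
    by move=> y; apply: cv_bounded => //; [exact: mF|move=> z; exact: bF].
  rewrite HE cvB; [|exact: gG|exact: gH|exact: sP].
  apply: cv_bounded => //.
    by apply: mfun2B; [exact: mG|case: gH].
  by move=> y; case: (G_cvg_approx y nT).
rewrite -(subrKA (H n (T + t) x)) (le_trans (ler_normD _ _))//.
rewrite mulrDl; apply: lerD; last by rewrite distrC.
by rewrite mulrAC.
Qed.

(** Net gain at scale s in the pairings: s^(1/2) from smoothing the test function, against the
    growth s^-beta of G. *)
Let gam := 2^-1 - beta.
Let gam0 : 0 < gam. Proof. by rewrite subr_gt0. Qed.
Let p : R := 2^-1 `^ gam.
Let p01 : 0 <= p < 1 := half_powR_lt1 gam0.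

Let B'0 : 0 <= B'.
Proof.
have := le_trans (normr_ge0 _) (@bG 1 0 _); rewrite ltr01 lexx => /(_ isT).
by rewrite powR1 mulr1.
Qed.

Let c2 : R := 2 * cpsi psi 6.
Let c20 : 0 <= c2. Proof. by rewrite mulr_ge0 ?cpsi_ge0. Qed.

Let pair n phi := I2 (fun y => phi y * G (dyad n) y).

Let approx_half phi (s : R) x : schwartz phi -> 0 < s <= 1 ->
  `|cv phi (psi s) x - phi x| <= s `^ 2^-1 * c2 * sn 4 phi * (br x ^+ 4)^-1.
Proof.
move=> sp /andP[s0 s1']; have [r [r0 sE rE]] := root4 s0.
have r1 : r <= 1 by rewrite rE -[leRHS](one_powR 4^-1) ge0_ler_powR ?nnegrE ?invr_ge0// ltW.
have r01 : 0 < r <= 1 by rewrite r0.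
have r2 : s `^ 2^-1 = r ^+ 2.
  by rewrite rE -(powR_mulrn _ (powR_ge0 _ _)) -powRrM; congr (_ `^ _); field.
rewrite r2 {1}sE; exact: cv_psi_approx2.
Qed.

(** With s = 2^-(n+1), G at 2^-n is G at s convolved with psi s. Moving this convolution onto phi
    leaves a pairing of G at s with phi_s - phi. *)
Let pair_step n phi : schwartz phi ->
  `|pair n.+1 phi - pair n phi| <= B' * c2 * W R * sn 4 phi * p ^+ n.
Proof.
move=> sp; set s := dyad n.+1; have s01 : 0 < s <= 1 := d01 _.
have /andP[s0 sl1] := s01.
have sT := sP s0; have sc := schwartz_cv sp sT.
have -> : pair n phi = I2 (fun y => cv phi (psi s) y * G s y).
  rewrite /pair (dyadS n) -/s; under eq_fun do rewrite -(G_semi _ s01 s0).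
  rewrite (dist_of_exchange (gG s01) sp sT (psi_even' hpsi s0)).
  by congr I2; apply/funext => y; rewrite mulrC.
have sd := schwartz_lin (- 1) sp sc.
have dE : (fun y => - 1 * phi y + cv phi (psi s) y) = fun y => cv phi (psi s) y - phi y.
  by apply/funext => y; rewrite mulN1r addrC.
rewrite dE in sd.
have [La _] := L1_bounded_mul (mG s0) (fun x => bG x s01) sp.
have [Lb _] := L1_bounded_mul (mG s0) (fun x => bG x s01) sc.
rewrite distrC /pair -/s -(I2B Lb La).
have [_ Hd] := L1_bounded_mul (mG s0) (fun x => bG x s01) sd.
rewrite (_ : (fun x => _ - _) = fun x => (cv phi (psi s) x - phi x) * G s x); last first.
  by apply/funext => x; rewrite mulrBl.
apply: (le_trans Hd).
have Hn := I2_norm_le sd (fun x => approx_half x sp s01).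
have bs : 0 <= B' * s `^ (- beta) by rewrite mulr_ge0// powR_ge0.
apply: (le_trans (ler_wpM2l bs Hn)).
rewrite [leLHS](_ : _ = B' * c2 * W R * sn 4 phi * (s `^ (2^-1) * s `^ (- beta))); last by ring.
have -> : s `^ 2^-1 * s `^ (- beta) = p ^+ n.+1.
  by rewrite -powRD ?gt_eqF ?implybT// -/gam /s /dyad powR_exprn.
apply: ler_wpM2l; first by rewrite (mulr_ge0 (mulr_ge0 (mulr_ge0 B'0 c20) (W_ge0 R)) (sn_ge0 _ _)).
by case/andP : p01 => p0 p1; rewrite exprS ler_piMl ?exprn_ge0// ltW.
Qed.

(** [limn] is total; the limit exists for Schwartz phi, the only arguments at which a [functional]
    has a meaning. *)
Let bu : functional R := fun phi => limn (fun n => pair n phi).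

Let bu_cvg phi : schwartz phi -> pair n phi @[n --> \oo] --> bu phi.
Proof. by move=> sp; case: (geometric_cvg p01 (fun n => pair_step n sp)). Qed.

Let bu_tempered : tempered bu.
Proof.
(* The first summand bounds the distance of [bu phi] to the pairing at scale 1, the second that
   pairing itself. *)
apply: (@temperedI _ _ 4 (B' * c2 * W R / (1 - p) + B' * W R)) => [c f1 f2 sf1 sf2|phi sp].
  apply: cvg_lim => //.
  rewrite (_ : (fun n => _) = fun n => c * pair n f1 + pair n f2); last first.
    apply/funext => n; rewrite /pair.
    have [L1' _] := L1_bounded_mul (mG (dyad_gt0 n)) (fun x => bG x (d01 n)) sf1.
    have [L2' _] := L1_bounded_mul (mG (dyad_gt0 n)) (fun x => bG x (d01 n)) sf2.
    rewrite -(I2Z c L1') -(I2D (L1Z c L1') L2').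
    by congr I2; apply/funext => y; ring.
  by apply: cvgD; [apply: cvgMl_tmp|]; exact: bu_cvg.
have [_ /(_ 0%N)] := geometric_cvg p01 (fun n => pair_step n sp).
rewrite expr0 mulr1 -/(bu phi) => E1.
have [_ E2] := L1_bounded_mul (mG (dyad_gt0 0)) (fun x => bG x (d01 0)) sp.
have E3 := I2_norm_le sp (fun x => schwartz_bound x sp (leq0n 4) (leq0n 4)).
rewrite {2}/dyad expr0 powR1 mulr1 in E2.
rewrite -(subrK (pair 0 phi) (bu phi)) (le_trans (ler_normD _ _))// mulrDl.
apply: lerD; first by apply: (le_trans E1); rewrite mulrAC.
by apply: (le_trans E2); apply: (le_trans (ler_wpM2l B'0 E3)); rewrite mulrA mulrAC.
Qed.

(** The pairing of G at 2^-n with psi T is G (T + 2^-n), so the assertion amounts to continuity of G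
    in time along this sequence. *)
Let bu_psi T x : 0 < T <= 1 -> dconv bu (psi T) x = G T x.
Proof.
move=> T01; have /andP[T0 T1] := T01.
have U0 : 0 < T / 2 by rewrite divr_gt0.
have U1 : 0 < T / 2 <= 1 by rewrite U0/=; lra.
have h : 0 < (2^-1 : R) by rewrite invr_gt0.
apply: cvg_lim => //.
pose D := B' * (T / 2) `^ (- beta) * (c2 * sn 4 (psi (T / 2)) * W R).
have key n : `|pair n (fun y => psi T (x - y)) - G T x| <= D * (2^-1 `^ 2^-1) ^+ n.
  have n0 := dyad_gt0 n.
  have -> : pair n (fun y => psi T (x - y)) = cv (G (dyad n)) (psi T) x.
    by rewrite /pair /cv; congr I2; apply/funext => y; rewrite mulrC.
  rewrite (G_semi x (d01 n) T0).
  (* Half of the time stays in G (T / 2), which is bounded; the other half makes the kernel Schwartz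
     independently of n, so [approx_half] applies to it. *)
  have -> : dyad n + T = T / 2 + (T / 2 + dyad n) by field.
  have {3}-> : T = T / 2 + T / 2 by field.
  have Un0 : 0 < T / 2 + dyad n by rewrite addr_gt0.
  rewrite -(G_semi x U1 U0) -(G_semi x U1 Un0) -(psi_semigroup hpsi U0 n0).
  have sU := sP U0; have sN := sP n0; have sc := schwartz_cv sU sN.
  have sd := schwartz_lin (- 1) sU sc.
  set k := cv (psi (T / 2)) (psi (dyad n)).
  rewrite (_ : (fun y => _) = fun y => k y - psi (T / 2) y) in sd; last first.
    by apply/funext => y; rewrite mulN1r addrC.
  rewrite /cv -(I2B (grows_L1 x (gG U1) sc) (grows_L1 x (gG U1) sU)).
  have [_ Hd] := L1_bounded_mul (mG U0) (fun x => bG x U1) (schwartz_reflect x sd).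
  rewrite (_ : (fun y => _ - _) = fun y => (k (x - y) - psi (T / 2) (x - y)) * G (T / 2) y); last first.
    by apply/funext => y; rewrite -mulrBr mulrC.
  apply: (le_trans Hd).
  rewrite (@I2_reflect _ x (fun y => `|k y - psi (T / 2) y|));
    last exact: L1_norm (schwartz_L1 sd).
  have Hn := I2_norm_le sd (fun x => approx_half x sU (d01 n)).
  have bs : 0 <= B' * (T / 2) `^ (- beta) by rewrite mulr_ge0// powR_ge0.
  apply: (le_trans (ler_wpM2l bs Hn)).
  rewrite /dyad powR_exprn// /D.
  by apply: le_of_eq; ring.
have := half_powR_lt1 h => /andP[h0 h1].
apply/cvgrPdist_lt => e e0.
have cq : D * (2^-1 `^ 2^-1) ^+ n @[n --> \oo] --> (0 : R).
  by rewrite -[X in _ --> X](mulr0 D); apply: cvgMl_tmp; apply: cvg_expr; rewrite ger0_norm.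
have /cvgrPdist_lt /(_ _ e0) [M _ HM] := cq.
exists M => // n /HM /=; rewrite sub0r normrN distrC; apply: le_lt_trans.
exact: le_trans (key n) (ler_norm _).
Qed.

Lemma reconstruction : exists bu : functional R, tempered bu /\
  forall T x, 0 < T <= 1 ->
    `|dconv bu (psi T) x - F T x| <=
      (mom (psi 1) 0 / (1 - 2^-1 `^ delta) + 1) * A * T `^ delta.
Proof.
exists bu; split; first exact: bu_tempered.
by move=> T x T01; rewrite bu_psi//; exact: G_F.
Qed.

End Reconstruction.

(** * The product estimate *)

Section WeightedBounds.
Variable R : realType.
Implicit Types (f g phi chi : plane R -> R) (x y z h : plane R).

Lemma dd_near x (e : R) : 0 < e -> \forall y \near x, dd (y - x) <= e.
Proof.
move=> e0; pose r := Num.min 1 ((e / 2) ^+ 2).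
have r0 : 0 < r by rewrite lt_min ltr01 exprn_gt0// divr_gt0.
have r1 : r <= 1 by rewrite ge_min lexx.
have re : r <= (e / 2) ^+ 2 by rewrite ge_min lexx orbT.
have e2 : 0 <= e / 2 by rewrite divr_ge0// ltW.
have nx : \forall y \near x, `|x - y| < r by apply/nbhs_ballP; exists r => // y /=; rewrite -ball_normE.
near=> y.
have yx : `|y - x| < r.
  by rewrite distrC; near: y.
have [h1 h2] : `|(y - x).1| <= r /\ `|(y - x).2| <= r.
  by split; apply: le_trans (ltW yx); rewrite [leRHS]/Num.norm/= le_max lexx ?orbT.
have s2 : Num.sqrt r <= e / 2 by apply: sqrtr_le_sqr.
have rs : r <= Num.sqrt r.
  by rewrite -{1}(sqr_sqrtr (ltW r0)) expr2 ler_piMl ?sqrtr_ge0// -sqrtr1 ler_wsqrtr.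
rewrite /dd (splitr e) lerD//; first by rewrite (le_trans h1)// (le_trans rs).
by apply: le_trans s2; exact: ler_wsqrtr.
Unshelve. all: by end_near. Qed.

(** The constant may depend on x: for u it contains |nu x|, on which there is no uniform bound. *)
Lemma locally_holder_continuous f (p : R) : 0 < p ->
  (forall x, exists c : R, forall y, dd (y - x) <= 1 -> `|f y - f x| <= c * dd (y - x) `^ p) ->
  continuous f.
Proof.
move=> p0 H x; have [c Hc] := H x; apply/cvgrPdist_le => e e0.
pose d := (e / (`|c| + 1)) `^ p^-1.
have c1 : 0 < `|c| + 1 by rewrite ltr_wpDl.
have d0 : 0 < d by rewrite powR_gt0// divr_gt0.
near=> y.
have y1 : dd (y - x) <= 1 by near: y; exact: dd_near.
have yd : dd (y - x) <= d by near: y; exact: dd_near.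
rewrite distrC (le_trans (Hc _ y1))//.
have E : dd (y - x) `^ p <= e / (`|c| + 1).
  have -> : e / (`|c| + 1) = d `^ p.
    by rewrite -powRrM mulVf ?gt_eqF// powRr1// ltW// divr_gt0.
  by rewrite ge0_ler_powR ?nnegrE ?dd_ge0// ltW.
apply: (@le_trans _ _ ((`|c| + 1) * dd (y - x) `^ p)).
  by rewrite ler_wpM2r ?powR_ge0// (le_trans (ler_norm c))// lerDl.
apply: (le_trans (ler_wpM2l (ltW c1) E)).
by rewrite mulrC divfK ?gt_eqF.
Unshelve. all: by end_near. Qed.

Lemma powR_add_le (a c p : R) : 0 <= a -> 0 <= c -> 0 <= p <= 2 ->
  (a + c) `^ p <= 4 * (a `^ p + c `^ p).
Proof.
move=> a0 c0 /andP[p0 p2]; pose m := Num.max a c.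
have m0 : 0 <= m by rewrite le_max a0.
have E1 : (a + c) `^ p <= (2 * m) `^ p.
  apply: ge0_ler_powR; rewrite ?nnegrE ?addr_ge0 ?mulr_ge0//.
  by rewrite mulr2n mulrDl !mul1r lerD// le_max lexx ?orbT.
apply: (le_trans E1); rewrite powRM//.
have E2 : (2 : R) `^ p <= 4.
  have -> : (4 : R) = 2 `^ 2 by rewrite powR_mulrn//; ring.
  by rewrite ler_powR// ler1n.
have E3 : m `^ p <= a `^ p + c `^ p.
  by rewrite /m; case: (leP a c) => _; rewrite ?lerDl ?lerDr powR_ge0.
by rewrite ler_pM ?powR_ge0.
Qed.

(** Two exponents at once, as in all three uses: 2 alpha and 0 for the modelling rest, 2 alpha and
    alpha for the size of u'', alpha and 3 alpha for the defect. *)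
Lemma cv_mom_le f phi x (P Q p q : R) : mfun2 f -> schwartz phi ->
  0 <= p <= 4 -> 0 <= q <= 4 ->
  (forall y, `|f y| <= P * dd (x - y) `^ p + Q * dd (x - y) `^ q) ->
  `|cv f phi x| <= P * mom phi p + Q * mom phi q.
Proof.
move=> mf sp p4 q4 fB.
have Lp := L1_mom sp p4; have Lq := L1_mom sp q4.
pose G y := P * (`|phi y| * dd y `^ p) + Q * (`|phi y| * dd y `^ q).
have LG : L1 G by apply: L1D; apply: L1Z.
have <- : I2 (fun y => G (x - y)) = P * mom phi p + Q * mom phi q.
  by rewrite (I2_reflect x LG) /G I2D ?I2Z//; exact: L1Z.
apply: normI2_le => [||y].
- by apply: mfun2M => //; apply: mfun2_reflect; exact: schwartz_mfun2.
- exact: L1_reflect.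
- rewrite normrM mulrC (le_trans (ler_wpM2l (normr_ge0 _) (fB y)))//.
  by rewrite /G le_eqVlt; apply/orP; left; apply/eqP; ring.
Qed.

Lemma growsD f g : grows f -> grows g -> grows (fun y => f y + g y).
Proof.
move=> [mf [p [A fA]]] [mg [q [B gB]]]; split; first exact: mfun2D.
exists (p + q)%N, (`|A| + `|B|) => y.
have b1 := br_ge1 y.
rewrite (le_trans (ler_normD _ _))// mulrDl; apply: lerD.
  apply: (le_trans (fA y)); rewrite (le_trans (ler_wpM2r _ (ler_norm A))) ?exprn_ge0//.
  by rewrite ler_wpM2l// ler_weXn2l// leq_addr.
apply: (le_trans (gB y)); rewrite (le_trans (ler_wpM2r _ (ler_norm B))) ?exprn_ge0//.
by rewrite ler_wpM2l// ler_weXn2l// leq_addl.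
Qed.

Lemma growsZ (c : R) f : grows f -> grows (fun y => c * f y).
Proof.
move=> [mf [p [A fA]]]; split; first exact: mfun2Z.
exists p, (`|c| * A) => y; rewrite normrM -mulrA ler_wpM2l//.
Qed.

Lemma growsB f g : grows f -> grows g -> grows (fun y => f y - g y).
Proof.
move=> gf /(growsZ (-1)) gg.
rewrite (_ : (fun y => _) = fun y => f y + - 1 * g y); first exact: growsD.
by apply/funext => y; rewrite mulN1r.
Qed.

Lemma grows0 : grows (fun=> 0 : R).
Proof. by apply: (@grows_bounded _ _ 0) => [|x]; [exact: measurable_cst|rewrite normr0]. Qed.

Lemma grows_sum n (f : 'I_n -> plane R -> R) :
  (forall i, grows (f i)) -> grows (fun y => \sum_(i < n) f i y).
Proof.
elim: n f => [|n IH] f gf.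
  by under eq_fun do rewrite big_ord0; exact: grows0.
under eq_fun do rewrite big_ord_recr/=.
by apply: growsD => //; exact: IH.
Qed.

Lemma cv_sum n (f : 'I_n -> plane R -> R) phi x : (forall i, grows (f i)) -> schwartz phi ->
  cv (fun y => \sum_(i < n) f i y) phi x = \sum_(i < n) cv (f i) phi x.
Proof.
move=> gf sp; rewrite /cv -I2_sum => [|i]; last exact: grows_L1.
by congr I2; apply/funext => y; rewrite mulr_suml.
Qed.

Lemma cvZ (c : R) f phi x : grows f -> schwartz phi ->
  cv (fun y => c * f y) phi x = c * cv f phi x.
Proof.
move=> gf sp; rewrite /cv -I2Z; last exact: grows_L1.
by congr I2; apply/funext => y; rewrite mulrA.
Qed.

End WeightedBounds.

Section Product.
Variable R : realType.
Implicit Types (f g phi chi : plane R -> R) (x y z h : plane R).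

(** The final algebra of [germ_semigroup]: P is B1 * M, Q the commutator sum, ra and rb are powers
    of s^(1/4), pa and pb powers of t^(1/4), and the rest are moments. *)
Lemma germ_arith (P Q X m0 m2 k1 k3 ra rb pa pb : R) : 0 <= P -> 0 <= Q -> 0 <= X ->
  0 <= m0 -> 0 <= m2 -> 0 <= k1 -> 0 <= k3 -> ra * pa <= X -> rb * pb <= X ->
  (4 * P * m2 + Q) * ra * (pa * k1) + 4 * P * m0 * rb * (pb * k3)
  <= (4 * (m2 * k1 + m0 * k3) + k1) * (P + Q) * X.
Proof.
move=> P0 Q0 X0 h0 h2 h1 h3 e1 e2.
have c1 : 0 <= (4 * P * m2 + Q) * k1 by rewrite mulr_ge0// addr_ge0// !mulr_ge0.
have c2 : 0 <= 4 * P * m0 * k3 by rewrite !mulr_ge0.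
have := lerD (ler_wpM2l c1 e1) (ler_wpM2l c2 e2).
rewrite [leLHS](_ : _ = (4 * P * m2 + Q) * ra * (pa * k1)
   + 4 * P * m0 * rb * (pb * k3)); last by ring.
move=> h; apply: (le_trans h); rewrite -subr_ge0.
rewrite (_ : _ - _ = (P * k1 + 4 * (m2 * k1 + m0 * k3) * Q) * X); last by ring.
rewrite mulr_ge0// addr_ge0//; first exact: mulr_ge0.
by rewrite mulr_ge0// mulr_ge0// addr_ge0// mulr_ge0.
Qed.

Variable psi : R -> plane R -> R.
Hypothesis hpsi : is_psi psi.
Let sP T (T0 : 0 < T) := schwartz_psi hpsi T0.
Let sP2 T (T0 : 0 < T) := schwartz_dmix 2 0 (sP T0).

(** All semi-norms enter as pointwise real bounds, and the derivative in a_0 only through the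
    Lipschitz bound [G_lip]. *)
Variables (alpha lam : R) (n : nat) (b u a nu : plane R -> R).
Variables (v : 'I_n -> R -> plane R -> R) (bv : 'I_n -> R -> functional R).
Variables (sigma : 'I_n -> plane R -> R) (M B0 B1 A1 : R) (N K S0 S1 : 'I_n -> R).

Let G i T a0 := comm psi b (d11 (v i a0)) (bv i a0) T.

Hypothesis alpha_bounds : 2 / 3 < alpha < 1.
Hypothesis b_bound : forall x, `|b x| <= B0.
Hypothesis b_holder : forall x y, `|b y - b x| <= B1 * dd (y - x) `^ alpha.
Hypothesis a_holder : forall x y, `|a y - a x| <= A1 * dd (y - x) `^ alpha.
Hypothesis a_range : forall x, prange lam (a x).
Hypothesis s_bound : forall i x, `|sigma i x| <= S0 i.
Hypothesis s_holder : forall i x y, `|sigma i y - sigma i x| <= S1 i * dd (y - x) `^ alpha.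
Hypothesis v_holder : forall i a0 x y, prange lam a0 ->
  `|v i a0 y - v i a0 x| <= N i * dd (y - x) `^ alpha.
Hypothesis bv_tempered : forall i a0, prange lam a0 -> tempered (bv i a0).
Hypothesis G_bound : forall i a0 T x, prange lam a0 -> 0 < T <= 1 ->
  `|G i T a0 x| <= K i * (T `^ 4^-1) `^ (2 * alpha - 2).
Hypothesis G_lip : forall i a0 a1 T x, prange lam a0 -> prange lam a1 -> 0 < T <= 1 ->
  `|G i T a1 x - G i T a0 x| <= K i * (T `^ 4^-1) `^ (2 * alpha - 2) * `|a1 - a0|.
Hypothesis u_modelled : forall x y,
  `|u y - u x - \sum_(i < n) sigma i x * (v i (a x) y - v i (a x) x) - nu x * (y.1 - x.1)|
  <= M * dd (y - x) `^ (2 * alpha).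
Hypothesis N_ge0 : forall i, 0 <= N i.
Hypothesis B1_ge0 : 0 <= B1.
Hypothesis M_ge0 : 0 <= M.
Hypothesis A1_ge0 : 0 <= A1.
Hypothesis S1_ge0 : forall i, 0 <= S1 i.

Let al0 : 0 < alpha. Proof. by case/andP: alpha_bounds => h _; apply: lt_trans h; rewrite divr_gt0. Qed.
Let al1 : alpha < 1. Proof. by case/andP: alpha_bounds. Qed.
Let al23 : 2 < 3 * alpha.
Proof. by case/andP: alpha_bounds => h _; rewrite ltr_pdivrMr// mulrC in h. Qed.

Let cont_holder f (c : R) : (forall x y, `|f y - f x| <= c * dd (y - x) `^ alpha) -> continuous f.
Proof. by move=> H; apply: (locally_holder_continuous al0) => x; exists c => y _. Qed.

Let b_cont : continuous b := cont_holder b_holder.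
Let a_cont : continuous a := cont_holder a_holder.
Let s_cont i : continuous (sigma i) := cont_holder (@s_holder i).
Let v_cont i a0 : prange lam a0 -> continuous (v i a0).
Proof. by move=> pa; apply: cont_holder => x y; exact: v_holder. Qed.

Let S0_ge0 i : 0 <= S0 i. Proof. exact: le_trans (normr_ge0 _) (s_bound i 0). Qed.

Let K_ge0 i : 0 <= K i.
Proof.
have := le_trans (normr_ge0 _) (@G_bound i _ 1 0 (a_range 0) _).
by rewrite ltr01 lexx powR1 powR1 mulr1 => /(_ isT).
Qed.

Let dd_le1 x (p : R) : p <= 1 -> dd x <= 1 -> 0 <= p -> dd x <= dd x `^ p.
Proof.
move=> p1 d1 p0; have := dd_ge0 x; rewrite le_eqVlt => /orP[/eqP <-|d0].
  exact: powR_ge0.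
rewrite -{1}(powRr1 (ltW d0)); by apply: ger_powR => //; rewrite d0.
Qed.

Let sum_v x y : `|\sum_(i < n) sigma i x * (v i (a x) y - v i (a x) x)|
  <= (\sum_(i < n) S0 i * N i) * dd (y - x) `^ alpha.
Proof.
rewrite mulr_suml (le_trans (ler_norm_sum _ _ _))//; apply: ler_sum => i _.
by rewrite normrM -mulrA ler_pM//; exact: v_holder.
Qed.

Let u_diff x y : `|u y - u x| <= M * dd (y - x) `^ (2 * alpha)
   + (\sum_(i < n) S0 i * N i) * dd (y - x) `^ alpha + `|nu x| * dd (y - x).
Proof.
set s := \sum_(i < n) sigma i x * (v i (a x) y - v i (a x) x).
rewrite (_ : u y - u x = (u y - u x - s - nu x * (y.1 - x.1)) + s + nu x * (y.1 - x.1)); last by ring.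
rewrite (le_trans (ler_normD _ _))// lerD//.
  by rewrite (le_trans (ler_normD _ _))// lerD ?u_modelled ?sum_v.
by rewrite normrM ler_wpM2l// /dd lerDl sqrtr_ge0.
Qed.

Let u_cont : continuous u.
Proof.
apply: (locally_holder_continuous al0) => x.
exists (M + (\sum_(i < n) S0 i * N i) + `|nu x|) => y d1.
apply: (le_trans (u_diff x y)); rewrite (mulrDl (M + _)) (mulrDl M); apply: lerD; first apply: lerD => //.
  rewrite ler_wpM2l//; have := dd_ge0 (y - x); rewrite le_eqVlt => /orP[/eqP <-|d0].
    have a20 : 0 < 2 * alpha by rewrite mulr_gt0.
    by rewrite (powR0 (lt0r_neq0 a20)) (powR0 (lt0r_neq0 al0)).
  by apply: ger_powR; [rewrite d0|rewrite ler_peMl ?ltW// ltr1n].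
by rewrite ler_wpM2l//; apply: dd_le1 => //; exact: ltW.
Qed.

Let grows_cont_dd f (c : R) : continuous f -> (forall y, `|f y| <= c * br y ^+ 4) -> grows f.
Proof. by move=> cf fc; split; [exact: continuous_mfun2|exists 4, c]. Qed.

Let pow_br x (p : R) : 0 <= p <= 4 -> dd x `^ p <= br x ^+ 4 := @dd_pow_br R p x.

Let al4 : 0 <= alpha <= 4.
Proof. by move: al0 al1 => h0 h1; apply/andP; split; lra. Qed.
Let al24 : 0 <= 2 * alpha <= 4.
Proof. by move: al0 al1 => h0 h1; apply/andP; split; lra. Qed.
Let al34 : 0 <= 3 * alpha <= 4.
Proof. by move: al0 al1 => h0 h1; apply/andP; split; lra. Qed.

Let u_grows : grows u.
Proof.
pose s := \sum_(i < n) S0 i * N i.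
have s0 : 0 <= s by apply: sumr_ge0 => i _; rewrite mulr_ge0.
apply: (@grows_cont_dd _ (M + s + `|nu 0| + `|u 0|)) => // y.
rewrite -(subrK (u 0) (u y)) (le_trans (ler_normD _ _))// mulrDl; apply: lerD; last first.
  by rewrite ler_peMr// exprn_ege1// br_ge1.
apply: (le_trans (u_diff 0 y)); rewrite subr0 (mulrDl (M + _)) (mulrDl M); apply: lerD; first apply: lerD.
- by rewrite ler_wpM2l ?pow_br.
- by rewrite ler_wpM2l ?pow_br.
- rewrite ler_wpM2l// -(powRr1 (dd_ge0 y)); apply: pow_br; lra.
Qed.

Let v_grows i a0 : prange lam a0 -> grows (v i a0).
Proof.
move=> pa; apply: (@grows_cont_dd _ (N i + `|v i a0 0|)) => [|y]; first exact: v_cont.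
rewrite -(subrK (v i a0 0) (v i a0 y)) (le_trans (ler_normD _ _))// mulrDl; apply: lerD.
  by apply: (le_trans (v_holder i 0 y pa)); rewrite subr0 ler_wpM2l ?pow_br.
by rewrite ler_peMr// exprn_ege1// br_ge1.
Qed.

Let V i a0 T := cv (v i a0) (dmix 2 0 (psi T)).
Let U T := cv u (dmix 2 0 (psi T)).
Let Bv i a0 T := dconv (bv i a0) (psi T).

Let GE i T a0 x : 0 < T -> G i T a0 x = b x * V i a0 T x - Bv i a0 T x.
Proof. by move=> T0; rewrite /G /comm dconv_d11//; exact: sP. Qed.

Let VE i a0 T : 0 < T -> V i a0 T = dconv (d11 (v i a0)) (psi T).
Proof. by move=> T0; rewrite dconv_d11//; exact: sP. Qed.

Let UE T : 0 < T -> U T = dconv (d11 u) (psi T).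
Proof. by move=> T0; rewrite dconv_d11//; exact: sP. Qed.

Let V_cont i a0 T : prange lam a0 -> 0 < T -> continuous (V i a0 T).
Proof. by move=> pa T0; apply: cv_continuous; [exact: v_grows|exact: sP2]. Qed.

Let V_grows i a0 T : prange lam a0 -> 0 < T -> grows (V i a0 T).
Proof.
move=> pa T0; rewrite (VE _ _ T0).
by apply: dconv_grows; [do 2 apply: tempered_d1; apply: tempered_dist_of; exact: v_grows|exact: sP].
Qed.

Let U_grows T : 0 < T -> grows (U T).
Proof.
move=> T0; rewrite (UE T0).
by apply: dconv_grows; [do 2 apply: tempered_d1; exact: tempered_dist_of|exact: sP].
Qed.

Let Bv_grows i a0 T : prange lam a0 -> 0 < T -> grows (Bv i a0 T).
Proof. by move=> pa T0; apply: dconv_grows; [exact: bv_tempered|exact: sP]. Qed.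

Let V_semi i a0 s t x : prange lam a0 -> 0 < s -> 0 < t ->
  cv (V i a0 s) (psi t) x = V i a0 (s + t) x.
Proof.
move=> pa s0 t0; rewrite (VE _ _ s0) (VE _ _ (addr_gt0 s0 t0)).
by apply: dconv_semigroup => //; do 2 apply: tempered_d1; apply: tempered_dist_of; exact: v_grows.
Qed.

Let U_semi s t x : 0 < s -> 0 < t -> cv (U s) (psi t) x = U (s + t) x.
Proof.
move=> s0 t0; rewrite (UE s0) (UE (addr_gt0 s0 t0)).
by apply: dconv_semigroup => //; do 2 apply: tempered_d1; exact: tempered_dist_of.
Qed.

Let Bv_semi i a0 s t x : prange lam a0 -> 0 < s -> 0 < t ->
  cv (Bv i a0 s) (psi t) x = Bv i a0 (s + t) x.
Proof. by move=> pa s0 t0; apply: dconv_semigroup => //; exact: bv_tempered. Qed.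

(** The local approximation F^T of the product. *)
Definition germ T x : R := b x * dconv (d11 u) (psi T) x - \sum_(i < n) sigma i x * G i T (a x) x.

Let germE T x : 0 < T -> germ T x = b x * U T x - \sum_(i < n) sigma i x * G i T (a x) x.
Proof. by move=> T0; rewrite /germ dconv_d11//; exact: sP. Qed.

(** The variable x is both the point and, through a x, the parameter. At a frozen parameter the
    function is made of continuous convolutions, and moving the parameter is controlled by [G_lip].
    This yields measurability of the germ. *)
Let Ga_cont i T : 0 < T <= 1 -> continuous (fun x => G i T (a x) x).
Proof.
move=> T01 x; have /andP[T0 T1] := T01; have pa := a_range x.
rewrite /continuous_at -[X in _ --> X]addr0.
rewrite (_ : (fun y => _) = fun y => G i T (a x) y + (G i T (a y) y - G i T (a x) y)); last first.
  by apply/funext => y; rewrite addrC subrK.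
apply: cvgD.
  rewrite (_ : G i T (a x) = fun y => b y * V i (a x) T y - Bv i (a x) T y); last first.
    by apply/funext => y; exact: GE.
  apply: cvgB; first by apply: cvgM; [exact: b_cont|exact: V_cont].
  by apply: dconv_continuous; [exact: bv_tempered|exact: sP].
apply/cvgrPdist_le => e e0.
pose c := K i * (T `^ 4^-1) `^ (2 * alpha - 2).
have c0 : 0 <= c by rewrite mulr_ge0 ?powR_ge0.
have c1 : 0 < c + 1 by rewrite ltr_wpDl.
have := @a_cont x => /cvgrPdist_le /(_ _ (divr_gt0 e0 c1)); apply: filterS => y ay.
rewrite sub0r normrN (le_trans (@G_lip i (a x) (a y) T y pa (a_range y) T01))// -/c distrC.
apply: (le_trans (ler_wpM2l c0 ay)); rewrite mulrCA.
by rewrite ler_piMr ?(ltW e0)// ler_pdivrMr// mul1r lerDl.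
Qed.

Let germ_mfun T : 0 < T <= 1 -> mfun2 (germ T).
Proof.
move=> T01; have /andP[T0 T1] := T01; apply: continuous_mfun2 => x.
rewrite /continuous_at (_ : germ T = fun x => b x * U T x - \sum_(i < n) sigma i x * G i T (a x) x); last first.
  by apply/funext => y; exact: germE.
apply: cvgB; first by apply: cvgM; [exact: b_cont|apply: cv_continuous => //; exact: sP2].
apply: cvg_big => [|i _]; first exact: add_continuous.
by apply: cvgM; [exact: s_cont|exact: Ga_cont].
Qed.

Let rest x z := u z - u x - \sum_(i < n) sigma i x * (v i (a x) z - v i (a x) x) - nu x * (z.1 - x.1).

Let rest_cv x y T : 0 < T ->
  cv (rest x) (dmix 2 0 (psi T)) y = U T y - \sum_(i < n) sigma i x * V i (a x) T y.
Proof.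
move=> T0; have sT := sP2 T0; have pa := a_range x.
pose c := - u x + \sum_(i < n) sigma i x * v i (a x) x + nu x * x.1.
rewrite (_ : rest x = fun z => (u z - \sum_(i < n) sigma i x * v i (a x) z)
     - (- c + nu x * z.1)); last first.
  apply/funext => z; rewrite /rest /c.
  rewrite (eq_bigr (fun i => sigma i x * v i (a x) z - sigma i x * v i (a x) x)); last first.
    by move=> i _; rewrite mulrBr.
  by rewrite sumrB; ring.
have gs : grows (fun z => \sum_(i < n) sigma i x * v i (a x) z).
  by apply: grows_sum => i; apply: growsZ; exact: v_grows.
rewrite -cvB//; [|exact: growsB|exact: grows_affine].
rewrite cv_affine_d11 ?subr0; last exact: sP.
rewrite -cvB// cv_sum//; last by move=> i; apply: growsZ; exact: v_grows.
by congr (_ - _); apply: eq_bigr => i _; rewrite cvZ//; exact: v_grows.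
Qed.

Let rest_mfun x : mfun2 (rest x).
Proof.
apply: mfun2B; last first.
  by apply: continuous_mfun2 => z; apply: cvgMl_tmp; apply: cvgB; [exact: cvg_fst|exact: cvg_cst].
apply: mfun2B; first by apply: mfun2B; [exact: continuous_mfun2|exact: measurable_cst].
have [] // : grows (fun z => \sum_(i < n) sigma i x * (v i (a x) z - v i (a x) x)).
apply: grows_sum => i; apply: growsZ; apply: growsB; first exact: v_grows.
by apply: (@grows_bounded _ _ `|v i (a x) x|) => [|//]; exact: measurable_cst.
Qed.

Let mom2 p := mom (dmix 2 0 (psi 1)) p.
Let mom1 p := mom (psi 1) p.

(** The modelling rest is centred at x but the kernel at y; the triangle inequality splits dd (z -
    x) ^ (2 alpha) into a moment of that order and a constant factor dd (x - y) ^ (2 alpha). *)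
Let bracket x y (r : R) : 0 < r ->
  `|U (r ^+ 4) y - \sum_(i < n) sigma i x * V i (a x) (r ^+ 4) y|
  <= 4 * M * (r ^- 2 * r `^ (2 * alpha) * mom2 (2 * alpha) + r ^- 2 * mom2 0 * dd (x - y) `^ (2 * alpha)).
Proof.
move=> r0; have T0 : 0 < r ^+ 4 by rewrite exprn_gt0.
rewrite -rest_cv//.
have p0 : 0 <= (0 : R) <= 4 by rewrite lexx ler0n.
have bnd z : `|rest x z| <= 4 * M * dd (y - z) `^ (2 * alpha)
    + 4 * M * dd (x - y) `^ (2 * alpha) * dd (y - z) `^ 0.
  rewrite powRr0 mulr1 (le_trans (u_modelled x z))// -mulrDr (mulrC 4) -mulrA ler_wpM2l//.
  have a22 : 0 <= 2 * alpha <= 2 by move: al0 al1 => h0 h1; apply/andP; split; lra.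
  apply: le_trans (powR_add_le (dd_ge0 _) (dd_ge0 _) a22).
  apply: ge0_ler_powR; rewrite ?nnegrE ?addr_ge0 ?dd_ge0//; first by case/andP: a22.
  rewrite -(ddN (y - z)) -(ddN (x - y)) !opprB (le_trans _ (ddD _ _))//.
  by rewrite addrA subrK.
apply: (le_trans (cv_mom_le (rest_mfun x) (sP2 T0) al24 p0 bnd)).
rewrite /mom !(psi2_mom hpsi)// powRr0.
by apply: le_of_eq; rewrite /mom2; ring.
Qed.

Let powD (r p q : R) : 0 < r -> r `^ p * r `^ q = r `^ (p + q).
Proof. by move=> r0; rewrite powRD// (gt_eqF r0) implybT. Qed.

Let powN2 (r : R) : 0 < r -> r ^- 2 = r `^ (- 2).
Proof. by move=> r0; rewrite powRN powR_mulrn// ltW. Qed.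

Let pow4 (r p : R) : 0 < r -> (r ^+ 4) `^ p = r `^ (4 * p).
Proof. by move=> r0; rewrite -powR_mulrn ?ltW// -powRrM. Qed.

Let u_affine x T : 0 < T ->
  cv (fun z => u z - u x - nu x * (z.1 - x.1)) (dmix 2 0 (psi T)) x = U T x.
Proof.
move=> T0; rewrite (_ : (fun z => _) = fun z => u z - (u x - nu x * x.1 + nu x * z.1)); last first.
  by apply/funext => z; ring.
rewrite -cvB//; [|exact: grows_affine|exact: sP2].
by rewrite cv_affine_d11 ?subr0//; exact: sP.
Qed.

(** Only the affine part is removed here, while the v_i are kept and contribute order alpha, whence
    the exponent alpha - 2. The constant only serves for the qualitative bound [germ_bounded]. *)
Let U_bound x (r : R) : 0 < r <= 1 -> `|U (r ^+ 4) x| <=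
  (M * mom2 (2 * alpha) + (\sum_(i < n) S0 i * N i) * mom2 alpha) * r `^ (alpha - 2).
Proof.
move=> /andP[r0 r1]; have T0 : 0 < r ^+ 4 by rewrite exprn_gt0.
have sm : 0 <= \sum_(i < n) S0 i * N i by apply: sumr_ge0 => i _; rewrite mulr_ge0.
rewrite -u_affine//.
have mf : mfun2 (fun z => u z - u x - nu x * (z.1 - x.1)).
  apply: continuous_mfun2 => z; apply: cvgB.
    by apply: cvgB; [exact: u_cont|exact: cvg_cst].
  by apply: cvgMl_tmp; apply: cvgB; [exact: cvg_fst|exact: cvg_cst].
have bnd z : `|u z - u x - nu x * (z.1 - x.1)| <= M * dd (x - z) `^ (2 * alpha)
    + (\sum_(i < n) S0 i * N i) * dd (x - z) `^ alpha.
  set q := \sum_(i < n) sigma i x * (v i (a x) z - v i (a x) x).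
  rewrite (_ : u z - _ - _ = (u z - u x - q - nu x * (z.1 - x.1)) + q); last by ring.
  rewrite -ddN opprB (le_trans (ler_normD _ _))// lerD ?sum_v//.
apply: (le_trans (cv_mom_le mf (sP2 T0) al24 al4 bnd)).
rewrite /mom !(psi2_mom hpsi)// [leRHS]mulrDl powN2// !powD//.
apply: lerD; last by rewrite -/(mom _ _) /mom2 addrC le_eqVlt; apply/orP; left; apply/eqP; ring.
rewrite -!mulrA ler_wpM2l// mulrC ler_wpM2l ?mom_ge0//.
apply: ger_powR; first by rewrite r0.
by move: al0 => h; lra.
Qed.

Lemma germ_bounded : exists B, forall T x, 0 < T <= 1 ->
  `|germ T x| <= B * T `^ (- ((2 - alpha) / 4)).
Proof.
exists (B0 * (M * mom2 (2 * alpha) + (\sum_(i < n) S0 i * N i) * mom2 alpha)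
  + \sum_(i < n) S0 i * K i) => T x T01.
have /andP[T0 T1] := T01; have [r [r0 TE rE]] := root4 T0.
have r1 : r <= 1.
  by rewrite rE -[leRHS](one_powR 4^-1) ge0_ler_powR ?nnegrE ?invr_ge0// ltW.
have B00 : 0 <= B0 := le_trans (normr_ge0 _) (b_bound 0).
rewrite germE// TE pow4// (_ : 4 * _ = alpha - 2); last by field.
rewrite (le_trans (ler_normB _ _))// [leRHS]mulrDl; apply: lerD.
  by rewrite normrM -mulrA ler_pM// U_bound// r0.
rewrite mulr_suml (le_trans (ler_norm_sum _ _ _))//; apply: ler_sum => i _.
rewrite normrM -mulrA ler_pM//.
have := G_bound i x (a_range x) T01; rewrite -rE => h; rewrite -TE; apply: (le_trans h).
rewrite ler_wpM2l//; apply: ger_powR; first by rewrite r0.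
by move: al0 => h'; lra.
Qed.

(** The factor produced by [germ_arith]; it depends on alpha and on moments of [psi 1] only. *)
Definition germ_const : R :=
  4 * (mom2 (2 * alpha) * mom1 alpha + mom2 0 * mom1 (3 * alpha)) + mom1 alpha.

Let A := B1 * M + \sum_(i < n) K i * (S1 i + S0 i * A1).

(** The germ at y with b, sigma and the parameter frozen at x. It is a fixed linear combination of
    smoothed distributions, so its convolution is exactly the germ at s + t, and the defect at x is
    the smoothing of germ minus frozen germ. *)
Let frozen x s y := b x * U s y - \sum_(i < n) sigma i x * (b x * V i (a x) s y - Bv i (a x) s y).

Let frozen_semi x s t : 0 < s -> 0 < t -> cv (frozen x s) (psi t) x = germ (s + t) x.
Proof.
move=> s0 t0; have pa := a_range x; have st := sP t0; have st0 := addr_gt0 s0 t0.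
have gG i : grows (fun y => b x * V i (a x) s y - Bv i (a x) s y).
  by apply: growsB; [apply: growsZ; exact: V_grows|exact: Bv_grows].
have gs : grows (fun y => \sum_(i < n) sigma i x * (b x * V i (a x) s y - Bv i (a x) s y)).
  by apply: grows_sum => i; exact: growsZ.
rewrite (germE _ st0) -(cvB _ (growsZ (b x) (U_grows s0)) gs st).
rewrite (cvZ _ _ (U_grows s0) st) U_semi// cv_sum//; last by move=> i; exact: growsZ.
congr (_ - _); apply: eq_bigr => i _; rewrite (cvZ _ _ (gG i) st) (GE _ _ _ st0).
rewrite -(cvB _ (growsZ (b x) (V_grows i pa s0)) (Bv_grows i pa s0) st).
by rewrite (cvZ _ _ (V_grows i pa s0) st) V_semi// Bv_semi.
Qed.

(** Unfreezing b leaves its increment times the second derivative of the modelling rest; unfreezing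
    sigma and a leaves increments of the given commutators. *)
Let germ_frozen x s y : 0 < s -> germ s y - frozen x s y =
  (b y - b x) * (U s y - \sum_(i < n) sigma i x * V i (a x) s y) +
  \sum_(i < n) (sigma i x * G i s (a x) y - sigma i y * G i s (a y) y).
Proof.
move=> s0; rewrite germE// /frozen sumrB.
have -> : \sum_(i < n) sigma i x * G i s (a x) y =
    b y * (\sum_(i < n) sigma i x * V i (a x) s y) - \sum_(i < n) sigma i x * Bv i (a x) s y.
  by rewrite mulr_sumr -sumrB; apply: eq_bigr => i _; rewrite GE//; ring.
have -> : \sum_(i < n) sigma i x * (b x * V i (a x) s y - Bv i (a x) s y) =
    b x * (\sum_(i < n) sigma i x * V i (a x) s y) - \sum_(i < n) sigma i x * Bv i (a x) s y.
  by rewrite mulr_sumr -sumrB; apply: eq_bigr => i _; ring.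
by ring.
Qed.

Let A'0 : 0 <= \sum_(i < n) K i * (S1 i + S0 i * A1).
Proof. by apply: sumr_ge0 => i _; rewrite mulr_ge0// addr_ge0// mulr_ge0. Qed.

Let sum_G x y (r : R) : 0 < r <= 1 ->
  `|\sum_(i < n) (sigma i x * G i (r ^+ 4) (a x) y - sigma i y * G i (r ^+ 4) (a y) y)|
  <= (\sum_(i < n) K i * (S1 i + S0 i * A1)) * r `^ (2 * alpha - 2) * dd (x - y) `^ alpha.
Proof.
move=> /andP[r0 r1]; have T01 : 0 < r ^+ 4 <= 1 by rewrite exprn_gt0// exprn_ile1// ltW.
have rE : (r ^+ 4) `^ 4^-1 = r by rewrite pow4// mulfV// powRr1// ltW.
rewrite !mulr_suml (le_trans (ler_norm_sum _ _ _))//; apply: ler_sum => i _.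
rewrite (_ : _ - _ = (sigma i x - sigma i y) * G i (r ^+ 4) (a x) y
   + sigma i y * (G i (r ^+ 4) (a x) y - G i (r ^+ 4) (a y) y)); last by ring.
rewrite (le_trans (ler_normD _ _))// !normrM.
rewrite [leRHS](_ : _ = K i * S1 i * r `^ (2 * alpha - 2) * dd (x - y) `^ alpha
   + K i * (S0 i * A1) * r `^ (2 * alpha - 2) * dd (x - y) `^ alpha); last by ring.
have g1 := @G_bound i _ _ y (a_range x) T01; rewrite rE in g1.
have g2 := @G_lip i _ _ _ y (a_range y) (a_range x) T01; rewrite rE in g2.
have k0 : 0 <= K i * r `^ (2 * alpha - 2) by rewrite mulr_ge0 ?powR_ge0.
apply: lerD.
  apply: (le_trans (ler_pM (normr_ge0 _) (normr_ge0 _) (s_holder i y x) g1)).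
  by apply: le_of_eq; ring.
apply: (le_trans (ler_pM (normr_ge0 _) (normr_ge0 _) (s_bound i y) g2)).
apply: (le_trans (ler_wpM2l (S0_ge0 i) (ler_wpM2l k0 (a_holder y x)))).
by apply: le_of_eq; ring.
Qed.

(** With r = s^(1/4) and rho = t^(1/4) the terms are r^(2 alpha - 2) rho^alpha and r^-2 rho^(3
    alpha). For rho <= r both are at most r^(3 alpha - 2). *)
Lemma germ_semigroup s t x : 0 < t <= s -> s + t <= 1 ->
  `|cv (germ s) (psi t) x - germ (s + t) x| <= germ_const * A * s `^ ((3 * alpha - 2) / 4).
Proof.
move=> /andP[t0 ts] st1; have s0 : 0 < s := lt_le_trans t0 ts.
have s01 : 0 < s <= 1 by rewrite s0 (le_trans _ st1)// lerDl ltW.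
have [r [r0 sE rE]] := root4 s0; have [rho [rho0 tE rhoE]] := root4 t0.
have r1 : r <= 1.
  by case/andP: s01 => _ ?; rewrite rE -[leRHS](one_powR 4^-1) ge0_ler_powR ?nnegrE ?invr_ge0// ltW.
have r01 : 0 < r <= 1 by rewrite r0.
have rr : rho <= r by rewrite rE rhoE ge0_ler_powR ?nnegrE ?invr_ge0// ltW.
have [B gB] := germ_bounded.
have gg : grows (germ s) by apply: grows_bounded => [|y]; [exact: germ_mfun|exact: gB].
have gf : grows (frozen x s).
  apply: growsB; first by apply: growsZ; exact: U_grows.
  apply: grows_sum => i; apply: growsZ; apply: growsB; last exact: Bv_grows.
  by apply: growsZ; exact: V_grows.
rewrite -(frozen_semi x s0 t0) (cvB x gg gf (sP t0)).
set Q := \sum_(i < n) K i * (S1 i + S0 i * A1).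
have bnd y : `|germ s y - frozen x s y| <=
   (4 * (B1 * M) * mom2 (2 * alpha) + Q) * r `^ (2 * alpha - 2) * dd (x - y) `^ alpha
   + 4 * (B1 * M) * mom2 0 * r `^ (- 2) * dd (x - y) `^ (3 * alpha).
  rewrite germ_frozen// sE (le_trans (ler_normD _ _))//.
  have E1 := sum_G x y r01; rewrite -/Q in E1.
  apply: (le_trans (lerD (lexx _) E1)); rewrite normrM.
  have b1 := b_holder x y; rewrite -ddN opprB in b1.
  have := ler_pM (normr_ge0 _) (normr_ge0 _) b1 (bracket x y r0).
  rewrite powN2// powD// (_ : - 2 + 2 * alpha = 2 * alpha - 2); last by rewrite addrC.
  have -> : dd (x - y) `^ (3 * alpha) = dd (x - y) `^ alpha * dd (x - y) `^ (2 * alpha).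
    rewrite -powRD; first by congr (_ `^ _); ring.
    by apply/implyP => /eqP h; exfalso; move: al0 h; lra.
  move=> h; apply: (le_trans (lerD h (lexx _))).
  by apply: le_of_eq; ring.
have mh : mfun2 (fun y => germ s y - frozen x s y).
  by apply: mfun2B; [exact: germ_mfun|case: gf].
apply: (le_trans (cv_mom_le mh (sP t0) al4 al34 bnd)).
rewrite tE /mom !(psi_mom hpsi)// -/(mom1 alpha) -/(mom1 (3 * alpha)).
have pw p : 0 <= p -> rho `^ p <= r `^ p by move=> p0; rewrite ge0_ler_powR ?nnegrE// ltW.
have BM0 : 0 <= B1 * M by rewrite mulr_ge0.
have m2 p : 0 <= mom2 p by exact: mom_ge0.
have m1 p : 0 <= mom1 p by exact: mom_ge0.
rewrite sE pow4// (_ : 4 * ((3 * alpha - 2) / 4) = 3 * alpha - 2); last by field.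
set X := r `^ (3 * alpha - 2).
have e1 : r `^ (2 * alpha - 2) * rho `^ alpha <= X.
  rewrite /X (_ : 3 * alpha - 2 = 2 * alpha - 2 + alpha); last by ring.
  by rewrite -(powD (2 * alpha - 2) alpha r0) ler_wpM2l ?powR_ge0// pw// ltW.
have e2 : r `^ (- 2) * rho `^ (3 * alpha) <= X.
  by rewrite /X (addrC (3 * alpha)) -(powD (- 2) (3 * alpha) r0) ler_wpM2l ?powR_ge0// pw// mulr_ge0// ltW.
have X0 : 0 <= X by exact: powR_ge0.
exact: (germ_arith BM0 A'0 X0 (m2 _) (m2 _) (m1 _) (m1 _) e1 e2).
Qed.

(** For beta = (2 - alpha) / 4 and delta = (3 alpha - 2) / 4 the side conditions follow from alpha <
    1, alpha > 0 and 3 alpha > 2 respectively. *)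
Lemma germ_reconstruction : exists bu : functional R, tempered bu /\
  forall T x, 0 < T <= 1 -> `|dconv bu (psi T) x - germ T x| <=
    (mom (psi 1) 0 / (1 - 2^-1 `^ ((3 * alpha - 2) / 4)) + 1) * (germ_const * A)
      * T `^ ((3 * alpha - 2) / 4).
Proof.
have [B gB] := germ_bounded.
apply: (reconstruction hpsi germ_mfun gB germ_semigroup).
- by move: al1 => h; rewrite divr_ge0//; lra.
- by move: al0 => h; lra.
- by rewrite divr_gt0// subr_gt0.
Qed.

End Product.

(** * Semi-norms with a parameter *)

Section SemiNorms.
Variable R : realType.
Implicit Types (f g phi : plane R -> R) (x y z : plane R).

Lemma dd_gt0 x : x != 0 -> 0 < dd x.
Proof.
move=> x0; rewrite lt_def dd_ge0 andbT; apply: contraNneq x0 => /eqP.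
rewrite paddr_eq0 ?sqrtr_ge0// sqrtr_eq0 normr_le0 normr_eq0 => /andP[/eqP h1 /eqP h2].
by rewrite (surjective_pairing x) h1 h2.
Qed.

Lemma supnorm_le f (c : R) : (forall x, `|f x| <= c) -> (supnorm f <= c%:E)%E.
Proof. by move=> fc; apply: ge_ereal_sup => _ [x _ <-]; rewrite lee_fin. Qed.

Lemma le_supnorm f (c : R) x : (supnorm f <= c%:E)%E -> `|f x| <= c.
Proof.
move=> fc; rewrite -lee_fin; apply: le_trans fc.
by apply: ereal_sup_ubound; exists x.
Qed.

Lemma supnorm_ge0 f : (0 <= supnorm f)%E.
Proof. by apply: (@le_trans _ _ `|f 0|%:E); [rewrite lee_fin|apply: ereal_sup_ubound; exists 0]. Qed.

Lemma supnorm_fin f : (supnorm f < +oo)%E -> exists2 c : R, supnorm f = c%:E & 0 <= c.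
Proof.
move=> fo; have f0 := supnorm_ge0 f.
have ff : supnorm f \is a fin_num by rewrite ge0_fin_numE.
by exists (fine (supnorm f)); rewrite ?fineK// fine_ge0.
Qed.

Lemma plane_neq : ((0, 0) : plane R) != (1, 0).
Proof. by rewrite xpair_eqE eq_sym oner_eq0. Qed.

Lemma holder_ge0 (p : R) f : (0 <= holder p f)%E.
Proof.
apply: (@le_trans _ _ (`|f (0, 0) - f (1, 0)| / pdist (0, 0) (1, 0) `^ p)%:E).
  by rewrite lee_fin divr_ge0// powR_ge0.
by apply: ereal_sup_ubound; exists ((0, 0), (1, 0)) => //=; exact: plane_neq.
Qed.

Lemma holder_fin (p : R) f : (holder p f < +oo)%E -> exists2 c : R, holder p f = c%:E & 0 <= c.
Proof.
move=> fo; have f0 := holder_ge0 p f.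
have ff : holder p f \is a fin_num by rewrite ge0_fin_numE.
by exists (fine (holder p f)); rewrite ?fineK// fine_ge0.
Qed.

Lemma le_holder (p c : R) f x y : 0 < p -> (holder p f <= c%:E)%E ->
  `|f y - f x| <= c * dd (y - x) `^ p.
Proof.
move=> p0 fc; have [->|yx] := eqVneq y x.
  by rewrite !subrr normr0 /dd/= normr0 sqrtr0 addr0 powR0 ?mulr0// gt_eqF.
rewrite -ler_pdivrMr ?powR_gt0 ?dd_gt0 ?subr_eq0// -lee_fin; apply: le_trans fc.
by apply: ereal_sup_ubound; exists (y, x) => //=; rewrite pdistE.
Qed.

Lemma le_comm_norm (p c : R) (F : R * plane R -> R) T x :
  (comm_norm p F <= c%:E)%E -> 0 < T <= 1 -> `|F (T, x)| <= c * (T `^ 4^-1) `^ p.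
Proof.
move=> Fc T01; have /andP[T0 _] := T01.
have w0 : 0 < (T `^ 4^-1) `^ p by rewrite !powR_gt0.
rewrite -ler_pdivrMr// -powRN -lee_fin; apply: le_trans Fc.
apply: (@le_trans _ _ (((T `^ 4^-1) `^ (- p))%:E * supnorm (fun x => F (T, x)))%E); last first.
  by apply: ereal_sup_ubound; exists T.
rewrite mulrC EFinM lee_wpmul2l ?lee_fin ?powR_ge0//.
by apply: ereal_sup_ubound; exists x.
Qed.

Lemma comm_norm_ge0 p (F : R * plane R -> R) : (0 <= comm_norm p F)%E.
Proof.
apply: (@le_trans _ _ ((((1 : R) `^ 4^-1) `^ (- p))%:E * supnorm (fun x => F (1%R, x)))%E).
  by rewrite mule_ge0 ?supnorm_ge0// lee_fin powR_ge0.
by apply: ereal_sup_ubound; exists 1 => //=; rewrite ltr01 lexx.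
Qed.

(** [norm1] is an infimum over candidate derivatives, so a witness comes with a slack e, which is
    removed at each use by letting e tend to 0. *)
Lemma norm1_witness (P : Type) lam (D : set P) Nn (F : R -> P -> R) (c e : R) :
  (norm1 lam D Nn F <= c%:E)%E -> 0 < e ->
  exists F' : R -> P -> R,
    (forall q, D q -> derivative_within (prange lam) (F ^~ q) (F' ^~ q)) /\
    forall a0, prange lam a0 -> (Nn (F a0) <= (c + e)%:E)%E /\ (Nn (F' a0) <= (c + e)%:E)%E.
Proof.
move=> Fc e0; have : (norm1 lam D Nn F < (c + e)%:E)%E.
  by apply: (le_lt_trans Fc); rewrite lte_fin ltrDl.
move=> /ereal_inf_lt [_ [F' dF <-] lt]; exists F'; split => // a0 pa.
have : (maxe (Nn (F a0)) (Nn (F' a0)) <= (c + e)%:E)%E.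
  by apply: le_trans (ltW lt); apply: ereal_sup_ubound; exists a0.
by rewrite ge_max => /andP.
Qed.

Lemma norm1_le (P : Type) lam (D : set P) Nn (F : R -> P -> R) (c a0 : R) :
  (norm1 lam D Nn F <= c%:E)%E -> prange lam a0 -> (Nn (F a0) <= c%:E)%E.
Proof.
move=> Fc pa; apply/lee_addgt0Pr => e e0.
by have [F' [_ /(_ _ pa) [h _]]] := norm1_witness Fc e0; rewrite -EFinD.
Qed.

Lemma derivative_within_near (A : set R) (g g' : R -> R) (x e : R) : derivative_within A g g' ->
  A x -> 0 < e -> exists2 d : R, 0 < d & forall t, A t -> t != x -> `|t - x| < d ->
    `|g' x - (g t - g x) / (t - x)| <= e.
Proof.
move=> dg Ax e0; have /cvgrPdist_le /(_ _ e0) := dg x Ax.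
move=> /nbhs_ballP [d d0 H]; exists d => // t At tx td; apply: H => //.
by rewrite /ball/= distrC.
Qed.

(** Mean value theorem on the segment between a0 and a1. At its end points the relative derivative
    yields continuity, which is all that is needed there; if lam = 1 the two parameters coincide. *)
Lemma derivative_within_lip lam (g g' : R -> R) (c a0 a1 : R) :
  derivative_within (prange lam) g g' ->
  (forall x : R, prange lam x -> `|g' x| <= c) -> prange lam a0 -> prange lam a1 ->
  `|g a1 - g a0| <= c * `|a1 - a0|.
Proof.
move=> dg g'c.
wlog a01 : a0 a1 / a0 < a1.
  move=> H p0 p1; have [l|l|->] := ltgtP a0 a1; first exact: H.
    by rewrite distrC (distrC a1); exact: H.
  by rewrite !subrr normr0 mulr0.
move=> p0 p1.
have seg t : a0 <= t <= a1 -> prange lam t.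
  move=> /andP[h1 h2]; move: p0 p1 => /= /andP[q1 _] /andP[_ q2].
  by rewrite /prange/= (le_trans q1)// (le_trans h2).
have c0 : 0 <= c := le_trans (normr_ge0 _) (g'c _ p0).
(* Near x the difference quotient is within 1 of g' x, hence bounded by c + 1. *)
have cont (x e : R) : prange lam x -> 0 < e -> exists2 d : R, 0 < d &
    forall t, prange lam t -> `|t - x| < d -> `|g x - g t| <= e.
  move=> px e0; have [d d0 H] := derivative_within_near dg px ltr01.
  have c1 : 0 < c + 1 by rewrite ltr_wpDl.
  exists (Num.min d (e / (c + 1))) => [|t pt]; first by rewrite lt_min d0 divr_gt0.
  rewrite lt_min => /andP[td te]; have [->|tx] := eqVneq t x; first by rewrite subrr normr0 ltW.
  have tx0 : t - x != 0 by rewrite subr_eq0.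
  have := H t pt tx td; set w := _ / _ => hw.
  have wc : `|w| <= c + 1.
    rewrite -(subrK (g' x) w) (le_trans (ler_normD _ _))// addrC lerD ?g'c//.
    by rewrite distrC.
  have -> : g x - g t = - (w * (t - x)) by rewrite /w divfK// opprB.
  rewrite normrN normrM (le_trans (ler_pM _ _ wc (ltW te)))//.
  by rewrite mulrC divfK ?gt_eqF.
have der (x : R) : x \in `]a0, a1[ -> is_derive x 1 g (g' x).
  rewrite in_itv/= => /andP[x0 x1].
  have px : prange lam x by apply: seg; rewrite !ltW.
  have cd : h^-1 *: (g (h *: 1 + x) - g x) @[h --> 0^'] --> g' x.
    apply/cvgrPdist_le => e e0; have [d d0 H] := derivative_within_near dg px e0.
    pose r := Num.min d (Num.min (x - a0) (a1 - x)).
    have r0 : 0 < r by rewrite !lt_min d0 !subr_gt0 x0.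
    near=> h.
    have h0 : h != 0 by near: h; exact: nbhs_dnbhs_neq.
    have : `|h| < r by near: h; apply: dnbhs0_lt.
    rewrite !lt_min => /andP[hd /andP[hl hr]].
    have pt : prange lam (h + x).
      by apply: seg; move: hl hr; rewrite !ltr_norml => /andP[? ?] /andP[? ?]; apply/andP; split; lra.
    have hx : h + x - x = h by rewrite addrK.
    have := H (h + x) pt; rewrite hx mulrC => H'.
    rewrite /GRing.scale/= mulr1; apply: H' => //.
    by rewrite -subr_eq0 hx.
  apply: DeriveDef; first by apply/cvg_ex; exists (g' x).
  exact: cvg_lim cd.
have wc : {within `[a0, a1], continuous g}.
  apply/continuous_within_itvP => //; split.
  - by move=> x /der d; apply: differentiable_continuous; apply/derivable1_diffP; exact: ex_derive.
  - apply/cvgrPdist_le => e e0; have [d d0 H] := cont _ _ p0 e0.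
    near=> t; have t0 : a0 < t by near: t; exact: nbhs_right_gt.
    have t1 : t < a1 by near: t; exact: nbhs_right_lt.
    have td : t < a0 + d by near: t; apply: nbhs_right_lt; rewrite ltrDl.
    by apply: H; [apply: seg; rewrite !ltW|rewrite gtr0_norm ?subr_gt0// ltrBlDl].
  - apply/cvgrPdist_le => e e0; have [d d0 H] := cont _ _ p1 e0.
    near=> t; have t1 : t < a1 by near: t; exact: nbhs_left_lt.
    have t0 : a0 < t by near: t; exact: nbhs_left_gt.
    have td : a1 - d < t by near: t; apply: nbhs_left_gt; rewrite ltrBlDr ltrDl.
    apply: H; first by apply: seg; rewrite !ltW.
    by rewrite distrC gtr0_norm ?subr_gt0// ltrBlDr -ltrBlDl.
have [x xin ->] := MVT a01 der wc.
rewrite normrM ler_wpM2r// g'c//; apply: seg.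
by move: xin; rewrite in_itv/= => /andP[h1 h2]; rewrite !ltW.
Unshelve. all: by end_near. Qed.

End SemiNorms.

(** * Independence of the kernel, convergence in supremum norm, and the theorem *)

Section Conclusion.
Variable R : realType.

(** The absolute value makes the constant non-negative without discussing the signs of its
    factors. *)
Definition product_const (psi : R -> plane R -> R) (alpha : R) : R :=
  `|(mom (psi 1) 0 / (1 - 2^-1 `^ ((3 * alpha - 2) / 4)) + 1) * germ_const psi alpha|.

(** The constant sees psi through [psi 1] only, and that function is determined by its Fourier
    transform. *)
Lemma product_const_psi (psi1 psi2 : R -> plane R -> R) alpha : is_psi psi1 -> is_psi psi2 ->
  product_const psi1 alpha = product_const psi2 alpha.
Proof.
move=> h1 h2; suff E : psi1 1 = psi2 1 by rewrite /product_const /germ_const E.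
by have [s1 f1] := h1 1 ltr01; have [s2 f2] := h2 1 ltr01; exact: fourier_inj s1 s2 f1 f2.
Qed.

Lemma near0_powR_le (K delta e : R) : 0 <= K -> 0 < delta -> 0 < e ->
  \forall T \near 0^'+, 0 < T <= 1 /\ K * T `^ delta <= e.
Proof.
move=> K0 d0 e0; have K1 : 0 < K + 1 by rewrite ltr_wpDl.
near=> T.
have T0 : 0 < T by near: T; exact: nbhs_right_gt.
have T1 : T < 1 by near: T; exact: nbhs_right_lt.
have Te : T < (e / (K + 1)) `^ delta^-1.
  by near: T; apply: nbhs_right_lt; rewrite powR_gt0 ?divr_gt0.
split; first by rewrite T0 ltW.
have E : T `^ delta <= e / (K + 1).
  have -> : e / (K + 1) = ((e / (K + 1)) `^ delta^-1) `^ delta.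
    by rewrite -powRrM mulVf ?gt_eqF// powRr1// ltW// divr_gt0.
  by rewrite ge0_ler_powR ?nnegrE ?powR_ge0// ltW.
apply: (le_trans (ler_wpM2l K0 E)); rewrite mulrCA ler_piMr ?(ltW e0)//.
by rewrite ler_pdivrMr// mul1r lerDl.
Unshelve. all: by end_near. Qed.

(** The norm is extended real, so convergence to 0 includes that it is eventually finite. *)
Lemma supnorm_cvg0 (F : R -> plane R -> R) (K delta : R) : 0 <= K -> 0 < delta ->
  (forall T x, 0 < T <= 1 -> `|F T x| <= K * T `^ delta) ->
  supnorm (F T) @[T --> 0^'+] --> (0 : \bar R).
Proof.
move=> K0 d0 FB; apply/fine_cvgP; split.
  have := near0_powR_le K0 d0 ltr01; apply: filterS => T [T01 _].
  rewrite ge0_fin_numE ?supnorm_ge0//; apply: le_lt_trans (ltry _).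
  by apply: supnorm_le => x; exact: FB.
apply/cvgrPdist_le => e e0; have := near0_powR_le K0 d0 e0.
apply: filterS => T [T01 Te]; rewrite sub0r normrN /=.
have := supnorm_le (fun x => le_trans (FB T x T01) Te).
have := supnorm_ge0 (F T); case: (supnorm (F T)) => [r| |]//=.
by rewrite !lee_fin => r0 re; rewrite ger0_norm.
Qed.

Lemma supnorm_cvg0_near (F : R -> plane R -> R) (e : R) : 0 < e ->
  supnorm (F T) @[T --> 0^'+] --> (0 : \bar R) ->
  exists2 d : R, 0 < d & forall T x, 0 < T < d -> `|F T x| <= e.
Proof.
move=> e0 /fine_cvgP [h1 /cvgrPdist_le /(_ _ e0) h2].
have : \forall T \near 0^'+, forall x, `|F T x| <= e.
  near=> T => x; apply: le_supnorm.
  have f1 : supnorm (F T) \is a fin_num by near: T; exact: h1.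
  have f2 : `|0 - fine (supnorm (F T))| <= e by near: T; exact: h2.
  rewrite -(fineK f1) lee_fin; apply: le_trans f2.
  by rewrite sub0r normrN ler_norm.
move=> /nbhs_ballP [d d0 H]; exists d => // T x /andP[T0 Td].
by apply: H => //; rewrite /ball/= sub0r normrN gtr0_norm.
Unshelve. all: by end_near. Qed.

Lemma tempered_sub (g h : functional R) : tempered g -> tempered h ->
  tempered (fun phi => g phi - h phi).
Proof.
move=> tg th; have [k [C [C0 gC]]] := tempered_bound tg.
have [l [D [D0 hD]]] := tempered_bound th.
have [lg _] := tg; have [lh _] := th.
have mono phi i j : schwartz phi -> (i <= j)%N -> sn i phi <= sn j phi.
  move=> sp ij; apply: sn_le => // m n x mi ni.
  apply: (le_trans (schwartz_bound x sp (leq_trans mi ij) (leq_trans ni ij))).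
  rewrite ler_wpM2l ?sn_ge0// lef_pV2 ?posrE ?exprn_gt0//.
  by rewrite ler_weXn2l// br_ge1.
apply: (@temperedI _ _ (k + l) (C + D)) => [c f1 f2 s1 s2|phi sp].
  by rewrite lg// lh//; ring.
rewrite (le_trans (ler_normB _ _))// mulrDl; apply: lerD.
  by apply: (le_trans (gC _ sp)); rewrite ler_wpM2l// mono// leq_addr.
by apply: (le_trans (hD _ sp)); rewrite ler_wpM2l// mono// leq_addl.
Qed.

End Conclusion.

Unset Implicit Arguments.
Set Strict Implicit.

Theorem lemma3p5 (R : realType) (alpha lam : R)
    (halpha : 2 / 3 < alpha < 1) (hlam : 0 < lam <= 1) :
  exists C : R,
  forall (psi : R -> plane R -> R), is_psi psi ->
  forall (I : nat) (b : plane R -> R)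
    (v : 'I_I -> R -> plane R -> R)
    (bv : 'I_I -> R -> functional R)
    (N0 : R) (N : 'I_I -> R)
    (u a : plane R -> R) (sigma : 'I_I -> plane R -> R) (M : R),
  holder_function alpha b ->
  (forall i a0, prange lam a0 -> tempered (bv i a0)) ->
  (forall i, (holder1 alpha lam (v i) <= (N i)%:E)%E) ->
  (forall i,
    (comm_norm1 (2 * alpha - 2) lam
       (fun a0 p => comm psi b (d11 (v i a0)) (bv i a0) p.1 p.2)
     <= (N0 * N i)%:E)%E) ->
  holder_function alpha a ->
  (forall x, prange lam (a x)) ->
  (forall i, holder_function alpha (sigma i)) ->
  modelled alpha u v a sigma M ->
  let is_product (bu : functional R) :=
    tempered bu /\
    supnorm (fun x => comm psi b (d11 u) bu T x
      - \sum_(i < I) sigma i x *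
          evalE a (fun a0 => comm psi b (d11 (v i a0)) (bv i a0) T) x)
      @[T --> 0^'+] --> (0 : \bar R) in
  exists bu : functional R,
    [/\ is_product bu,
        (forall bu' : functional R, is_product bu' -> dist_eq bu' bu) &
        (holder alpha a <= 1)%E ->
        (comm_norm (2 * alpha - 2) (fun p => comm psi b (d11 u) bu p.1 p.2)
         <= C%:E * (holder alpha b * M%:E
              + N0%:E * \sum_(i < I)
                  ((N i)%:E * (holder alpha (sigma i) + supnorm (sigma i)))))%E].
Proof.
(* C precedes psi in the statement, so it is computed from an arbitrarily chosen psi;
   [product_const_psi] transfers it to the given one. If there is none, the claim is vacuous and 0
   will do. The added 1 pays for the sum of sigma_i E[b,(.)_T]<>v_i'' itself. *)
pose C : R := if pselect (exists psi : R -> plane R -> R, is_psi psi) is left e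
              then product_const (projT1 (cid e)) alpha + 1 else 0.
exists C => psi hpsi n b v bv N0 N u a sigma M [bs bh] tbv hv hG [_ ah] apr hs [nu hM] is_product.
have {}CE : C = product_const psi alpha + 1.
  rewrite /C; case: pselect => [e|]; last by case; exists psi.
  by rewrite (product_const_psi alpha (projT2 (cid e)) hpsi).
have al0 : 0 < alpha by case/andP: halpha => h _; apply: lt_trans h; rewrite divr_gt0.
have al1 : alpha < 1 by case/andP: halpha.
have al23 : 2 < 3 * alpha by case/andP: halpha => h _; rewrite ltr_pdivrMr// mulrC in h.
have [B0 B0E B00] := supnorm_fin bs; have [B1 B1E B10] := holder_fin bh.
have [A1 A1E A10] := holder_fin ah.
pose S0 i := fine (supnorm (sigma i)); pose S1 i := fine (holder alpha (sigma i)).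
have S0E i : supnorm (sigma i) = (S0 i)%:E.
  by have [sb _] := hs i; have [c cE _] := supnorm_fin sb; rewrite /S0 cE.
have S1E i : holder alpha (sigma i) = (S1 i)%:E.
  by have [_ sh] := hs i; have [c cE _] := holder_fin sh; rewrite /S1 cE.
have S00 i : 0 <= S0 i by rewrite -lee_fin -S0E supnorm_ge0.
have S10 i : 0 <= S1 i by rewrite -lee_fin -S1E holder_ge0.
(* A parameter in the range, at which N i >= 0 and N0 * N i >= 0 can be read off from norms. *)
have plam : prange lam lam.
  by case/andP: hlam => l0 l1; rewrite /prange/= lexx (le_trans l1)// invf_ge1.
have hv' i a0 (pa : prange lam a0) : (holder alpha (v i a0) <= (N i)%:E)%E.
  exact: norm1_le (hv i) pa.
have N_ge0 i : 0 <= N i by rewrite -lee_fin (le_trans (holder_ge0 alpha (v i lam)))// hv'.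
have hG' i a0 (pa : prange lam a0) := norm1_le (hG i) pa.
have K0 i : 0 <= N0 * N i.
  by rewrite -lee_fin (le_trans (comm_norm_ge0 _ _) (hG' i lam plam)).
have Gb i a0 T x : prange lam a0 -> 0 < T <= 1 ->
    `|comm psi b (d11 (v i a0)) (bv i a0) T x| <= N0 * N i * (T `^ 4^-1) `^ (2 * alpha - 2).
  by move=> pa T01; exact: (le_comm_norm x (hG' i a0 pa) T01).
have Gl i a0 a1 T x : prange lam a0 -> prange lam a1 -> 0 < T <= 1 ->
    `|comm psi b (d11 (v i a1)) (bv i a1) T x - comm psi b (d11 (v i a0)) (bv i a0) T x|
    <= N0 * N i * (T `^ 4^-1) `^ (2 * alpha - 2) * `|a1 - a0|.
  move=> p0 p1 T01; have /andP[T0 _] := T01.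
  have w0 : 0 <= (T `^ 4^-1) `^ (2 * alpha - 2) * `|a1 - a0| by rewrite mulr_ge0 ?powR_ge0.
  set w := _ * `|a1 - a0| in w0.
  rewrite -mulrA -/w; apply/ler_addgt0Pr => e e0.
  (* The slack of the witness gets multiplied by w, and e / (w + 1) * w <= e. *)
  have e1 : 0 < e / (w + 1) by rewrite divr_gt0// ltr_wpDl.
  have [F' [dF FB]] := norm1_witness (hG i) e1.
  have := derivative_within_lip (dF (T, x) T01) _ p0 p1.
  move=> /(_ ((N0 * N i + e / (w + 1)) * (T `^ 4^-1) `^ (2 * alpha - 2))) /= H.
  apply: (le_trans (H _)) => [t pt|]; first by have [_ h] := FB t pt; exact: (le_comm_norm x h T01).
  rewrite -mulrA -/w mulrDl lerD2l -mulrA ler_piMr ?(ltW e0)//.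
  by rewrite mulrC ler_pdivrMr ?ltr_wpDl// mul1r lerDl.
have umod x y : `|u y - u x - \sum_(i < n) sigma i x * (v i (a x) y - v i (a x) x) - nu x * (y.1 - x.1)|
    <= M * dd (y - x) `^ (2 * alpha).
  have a20 : 0 < 2 * alpha by rewrite mulr_gt0.
  (* The diagonal is excluded from the supremum in [modelled]; there both sides vanish, as the
     exponent is positive. *)
  have [->|yx] := eqVneq y x.
    rewrite big1; last by move=> i _; rewrite subrr mulr0.
    by rewrite !subrr mulr0 !subr0 normr0 /dd/= normr0 sqrtr0 addr0 powR0 ?mulr0// gt_eqF.
  rewrite [leRHS]mulrC -ler_pdivrMl ?powR_gt0 ?dd_gt0 ?subr_eq0// -lee_fin -hM -pdistE.
  by apply: ereal_sup_ubound; exists (x, y) => //=; rewrite eq_sym.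
have M0 : 0 <= M.
  rewrite -lee_fin -hM; set S := [set _ | _ in _].
  have zS : ([set: plane R * plane R] ((0, 0), (1, 0))) by [].
  pose q z := ((pdist z.2 z.1 `^ (2 * alpha))^-1 * `|u z.2 - u z.1
     - \sum_(i < n) sigma i z.1 * (v i (a z.1) z.2 - v i (a z.1) z.1)
     - nu z.1 * (z.2.1 - z.1.1)|) : R.
  apply: (@le_trans _ _ (q ((0, 0), (1, 0)))%:E).
    by rewrite lee_fin mulr_ge0// invr_ge0 powR_ge0.
  by apply: ereal_sup_ubound; exists ((0, 0), (1, 0)) => //=; exact: plane_neq.
have bB x : `|b x| <= B0 by apply: le_supnorm; rewrite B0E.
have bH x y : `|b y - b x| <= B1 * dd (y - x) `^ alpha by apply: le_holder; rewrite ?B1E.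
have aH x y : `|a y - a x| <= A1 * dd (y - x) `^ alpha by apply: le_holder; rewrite ?A1E.
have sB i x : `|sigma i x| <= S0 i by apply: le_supnorm; rewrite S0E.
have sH i x y : `|sigma i y - sigma i x| <= S1 i * dd (y - x) `^ alpha.
  by apply: le_holder; rewrite ?S1E.
have vH i a0 x y (pa : prange lam a0) : `|v i a0 y - v i a0 x| <= N i * dd (y - x) `^ alpha.
  by apply: le_holder => //; exact: hv'.
have [bu [tbu]] := germ_reconstruction hpsi halpha bB bH aH apr sB sH vH tbv Gb Gl umod N_ge0 B10 M0 A10 S10.
set A := B1 * M + _; set delta := (3 * alpha - 2) / 4 => hbu.
have A0 : 0 <= A.
  by rewrite addr_ge0 ?mulr_ge0// sumr_ge0// => i _; rewrite mulr_ge0// addr_ge0// mulr_ge0.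
have d0 : 0 < delta by rewrite divr_gt0// subr_gt0.
pose K := product_const psi alpha; have KK0 : 0 <= K by exact: normr_ge0.
pose G T x := \sum_(i < n) sigma i x * evalE a (fun a0 => comm psi b (d11 (v i a0)) (bv i a0) T) x.
have key T x : 0 < T <= 1 -> `|comm psi b (d11 u) bu T x - G T x| <= K * A * T `^ delta.
  move=> T01.
  have -> : comm psi b (d11 u) bu T x - G T x = - (dconv bu (psi T) x - germ psi b u a v bv sigma T x).
    by rewrite /comm /germ /G /evalE /comm; ring.
  rewrite normrN (le_trans (hbu T x T01))// mulrA ler_wpM2r ?powR_ge0// ler_wpM2r//.
  exact: ler_norm.
have prod_bu : is_product bu.
  by split => //; apply: (supnorm_cvg0 (mulr_ge0 KK0 A0) d0).
exists bu; split => // [bu' [tbu' cbu'] phi sphi|a1].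
  apply/eqP; rewrite -subr_eq0; apply/eqP.
  apply: (@dist_vanish R psi hpsi (fun phi => bu' phi - bu phi)) => //; first exact: tempered_sub.
  move=> e e0; have e2 : 0 < e / 2 by rewrite divr_gt0.
  have [d1 d10 h1] := supnorm_cvg0_near e2 cbu'.
  have [_ cbu] := prod_bu; have [d2 d20 h2] := supnorm_cvg0_near e2 cbu.
  exists (Num.min d1 d2) => [|T x]; first by rewrite lt_min d10.
  rewrite lt_min => /andP[T0 /andP[Td1 Td2]].
  have := h1 T x; rewrite T0 Td1 => /(_ isT) g1.
  have := h2 T x; rewrite T0 Td2 => /(_ isT) g2.
  (* The terms b u''_T and G T cancel between the two candidates, and the smoothed difference of the
     products remains. *)
  rewrite (_ : dconv _ _ _ = (comm psi b (d11 u) bu T x - G T x) - (comm psi b (d11 u) bu' T x - G T x)).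
    by rewrite (le_trans (ler_normB _ _))// (splitr e) lerD.
  by rewrite /comm /dconv; ring.
(* The assumption on [a] enters here: it bounds S0 i * A1 by S0 i, so that A is at most the
   right-hand side of the theorem. *)
have A11 : A1 <= 1 by rewrite -lee_fin -A1E.
rewrite B1E.
have -> : (N0%:E * \sum_(i < n) ((N i)%:E * (holder alpha (sigma i) + supnorm (sigma i))) =
   (\sum_(i < n) N0 * N i * (S1 i + S0 i))%:E)%E.
  under eq_bigr do rewrite S0E S1E -EFinD -EFinM.
  by rewrite sumEFin -EFinM mulr_sumr; congr EFin; apply: eq_bigr => i _; rewrite mulrA.
rewrite -EFinM CE -/K.
set S := \sum_(i < n) _.
have S_ge : \sum_(i < n) S0 i * (N0 * N i) <= S.
  by apply: ler_sum => i _; rewrite mulrC ler_wpM2l// lerDr.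
have A_le : A <= B1 * M + S.
  rewrite lerD2l; apply: ler_sum => i _; rewrite ler_wpM2l// lerD2l.
  by rewrite ler_piMr.
apply: ge_ereal_sup => _ [T T01 <-]; have /andP[T0 T1] := T01.
set w := (T `^ 4^-1) `^ (2 * alpha - 2).
have w0 : 0 < w by rewrite !powR_gt0.
(* The distance to G T gives the factor K, and G T itself, bounded through the given commutators,
   the additional 1 in C. *)
have bnd x : `|comm psi b (d11 u) bu T x| <= K * A * T `^ delta + w * \sum_(i < n) S0 i * (N0 * N i).
  rewrite -(subrK (G T x) (comm _ _ _ _ _ _)) (le_trans (ler_normD _ _))// lerD ?key//.
  rewrite mulr_sumr (le_trans (ler_norm_sum _ _ _))//; apply: ler_sum => i _.
  rewrite normrM mulrCA ler_pM// mulrC; exact: Gb.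
rewrite powRN -/w.
apply: (le_trans (lee_wpmul2l _ (supnorm_le bnd))); first by rewrite lee_fin invr_ge0 ltW.
rewrite -EFinM lee_fin mulrDr mulKf ?gt_eqF// mulrDl mul1r.
apply: lerD.
  apply: (@le_trans _ _ (K * A)); last exact: ler_wpM2l.
  (* T^delta <= w because T <= 1 and delta exceeds the exponent (2 alpha - 2) / 4 of w. *)
  rewrite mulrCA ler_piMr ?mulr_ge0// ler_pdivrMl// mulr1 /w -powRrM.
  apply: ger_powR; first by rewrite T0.
  by rewrite /delta; lra.
by apply: (le_trans S_ge); rewrite lerDr mulr_ge0.
Qed.
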